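(* Let $\ell,x>0$, and consider on $E_\ell$ over $K=\mathrm{SU}(2)\times\mathrm U(1)$ the triples $(V_+^x,\operatorname{div}_+^x,I_x)$, $(V_+^x,\operatorname{div}_+^x,J_x)$, $(V_+^x,\operatorname{div}_+^x,K_x)$ described in the context. They induce an embedding of the $N=4$ superconformal vertex algebra of central charge $c=6$ into the universal superaffine vertex algebra associated to $\mathfrak g_\ell$ with level $k=2$. More precisely, let $J_0^I,H'_I$; $J_0^J,H'_J$; $J_0^K,H'_K$ denote the generators $J_0$, $H'$ (as defined in the context) of the $N=2$ superconformal vertex algebras associated to $(V_+^x,\operatorname{div}_+^x,I_x)$, $(V_+^x,\operatorname{div}_+^x,J_x)$, $(V_+^x,\operatorname{div}_+^x,K_x)$ respectively. Then $H'_I=H'_J=H'_K$ and furthermore $$[{J_0^I}_\Lambda J_0^J]=-(2\chi+S)J_0^K,\qquad[{J_0^J}_\Lambda J_0^K]=-(2\chi+S)J_0^I,\qquad[{J_0^K}_\Lambda J_0^I]=-(2\chi+S)J_0^J.$$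
   Context: The geometry. $K=\mathrm{SU}(2)\times\mathrm U(1)$ has left-invariant vector fields $v_1,\dots,v_4$ with $[v_2,v_3]=-v_1$, $[v_3,v_1]=-v_2$, $[v_1,v_2]=-v_3$, $[v_4,\cdot]=0$, spanning the Lie algebra $\mathfrak k$, with dual basis $v^1,\dots,v^4$. $E_\ell=TK\oplus T^*K$ is the Courant algebroid with three-form $H_\ell=\ell v^1\wedge v^2\wedge v^3$. Its left-invariant sections form the quadratic Lie algebra $\mathfrak g_\ell=\mathfrak k\oplus\mathfrak k^*$ with pairing $(v+\alpha|v+\alpha)=\alpha(v)$ and bracket $[v+\alpha,w+\beta]=[v,w]-\beta([v,\cdot])+\alpha([w,\cdot])+\ell\,i_wi_v(v^1\wedge v^2\wedge v^3)$. Put $g_x=\ell(v^1\otimes v^1+v^2\otimes v^2+v^3\otimes v^3+x^2v^4\otimes v^4)$, $V_+^x=\{v+g_x(v):v\in\mathfrak k\}$, $\varepsilon_+^x=-\frac12(\frac1{\ell x}v_4+xv^4)$ (this encodes the partial divergence operator $\operatorname{div}_+^x=\operatorname{div}_0|_{V_+^x}-(\varepsilon_+^x|\cdot)$, where $\operatorname{div}_0(X+\xi)=L_X\mu_{g_x}/\mu_{g_x}$ with $\mu_{g_x}$ the volume element of $g_x$, and does not enter the formulae for $J_0,H'$). The $g_x$-compatible complex structures $I_x,J_x,K_x$ on $\mathfrak k$, transported to $V_+^x\cong\mathfrak k$, are given by $I_xv_4=xv_1$, $I_xv_2=v_3$; $J_xv_4=xv_2$, $J_xv_3=v_1$; $K_xv_4=xv_3$,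 $K_xv_1=v_2$. SUSY vertex algebras are $N_K=1$ SUSY vertex algebras in the sense of Heluani--Kac: superspaces over $\mathbb C$ with odd endomorphism $S$, $T=S^2$, normally ordered product $:ab:$ and $\Lambda$-bracket $[a_\Lambda b]$ polynomial in $\Lambda=(\lambda,\chi)$, $\lambda$ even, $\chi$ odd, $\chi^2=-\lambda$, $S\lambda=\lambda S$, $S\chi+\chi S=2\lambda$, satisfying $[Sa_\Lambda b]=\chi[a_\Lambda b]$, $[a_\Lambda Sb]=-(-1)^{|a|}(S+\chi)[a_\Lambda b]$, skew-symmetry $[a_\Lambda b]=(-1)^{|a||b|}[b_{-\Lambda-\nabla}a]$ ($\nabla=(T,S)$), Jacobi $[a_\Lambda[b_\Gamma c]]=(-1)^{|a|+1}[[a_\Lambda b]_{\Lambda+\Gamma}c]+(-1)^{(|a|+1)(|b|+1)}[b_\Gamma[a_\Lambda c]]$, quasicommutativity $:ab:-(-1)^{|a||b|}:ba:=\int_{-\nabla}^0d\Lambda[a_\Lambda b]$, quasiassociativity, and the non-commutative Wick formula $[a_\Lambda:bc:]=:[a_\Lambda b]c:+(-1)^{(|a|+1)|b|}:b[a_\Lambda c]:+\int_0^\Lambda d\Gamma[[a_\Lambda b]_\Gamma c]$ (where $\int d\Lambda$ means $\int d\lambda\,\partial_\chi$). $:a:bc::$ means $:a(:bc:):$. The universal superaffine vertex algebra $V^k(\mathfrak g_{\rm super})$ is the universal enveloping SUSY vertex algebra generated by the odd copy $\Pi\mathfrak g$ of (the complexification of) $\mathfrak g$ with $[a_\Lambda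 b]=[a,b]+\chi k(a|b)$. The vectors. For a complex structure $I$ on $V_+^x$ let $l,\overline l$ be its $+i$, $-i$ eigenspaces in $V_+^x\otimes\mathbb C$, with bases $\epsilon_j,\overline\epsilon_j$, $(\epsilon_j|\overline\epsilon_k)=\delta_{jk}$, $e_j=\Pi\epsilon_j$, $e^j=\Pi\overline\epsilon_j$, $w=[e^j,e_j]_l-[e^j,e_j]_{\overline l}$ (orthogonal projections to $l,\overline l$). With $k=2$ and summation over repeated indices, $J_0=\frac ik:e^je_j:$ and $H'=\frac1k(:e_j(Se^j):+:e^j(Se_j):)+\frac1{k^2}(:e_j:e^k[e^j,e_k]::+:e^j:e_k[e_j,e^k]::-:e_j:e_k[e^j,e^k]::-:e^j:e^k[e_j,e_k]::)+\frac1kTw$. The $N=2$ superconformal vertex algebra of central charge $c$ is the SUSY vertex algebra generated by an even $J$ and an odd $H$ with $[J_\Lambda J]=-(H+\frac{\lambda\chi}3c)$, $[H_\Lambda J]=(2T+2\lambda+\chi S)J$, $[H_\Lambda H]=(2T+\chi S+3\lambda)H+\frac{\chi\lambda^2}3c$. The (small) $N=4$ superconformal vertex algebra of central charge $c$ is the SUSY vertex algebra generated by an odd $H$ and even $J^1,J^2,J^3$ such that each pair $(J^i,H)$ satisfies the three relations of the $N=2$ superconformal vertex algebra of central charge $c$, and $[{J^i}_\Lambda J^j]=-\varepsilon_{ijk}(S+2\chi)J^k$ for $i\ne j$, where $\varepsilon_{ijk}$ is the totally antisymmetric tensor. Here ''generated'' means that it is the universal enveloping SUSY vertex algebra of the SUSY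 Lie conformal algebra freely generated over $\mathbb C[S]$ by these vectors together with the scalar $c$. The embedding in the claim sends $H$ to $H'_I=H'_J=H'_K$ and $J^1,J^2,J^3$ to $J_0^I,J_0^J,J_0^K$.
   Formalization: ''Embedding'' is proved as a vertex algebra morphism injective on the N=4 SUSY Lie conformal algebra (generators over C[S] and the scalar); injectivity on the whole universal N=4 algebra fails, since :J^+J^+: with J^+=J^2+iJ^3 is nonzero there but maps to 0. *)

(* Defs.v *)
From HB Require Import structures.
From mathcomp Require Import all_boot all_order all_algebra.
From mathcomp Require Import finmap complex reals.
From mathcomp.multinomials Require Import monalg.

Set Implicit Arguments.
Unset Strict Implicit.
Unset Printing Implicit Defensive.

Import Order.TTheory GRing.Theory Num.Theory.
Local Open Scope ring_scope.

(** * Polynomials in [Lambda = (lambda, chi)] with coefficients in a module *)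

(* The monomial [(j, e)] is [lambda^j chi^e], coefficients stand on its right:
   [<< v *g (j, e) >>] is [lambda^j chi^e v].  As [chi^2 = - lambda], these
   monomials span [C[Lambda]].  In two variables [Lambda = (lambda, chi)],
   [Gamma = (gamma, eta)], the monomial [((i, d), (j, e))] is
   [lambda^i chi^d gamma^j eta^e]; [chi] and [eta] anticommute, the other
   pairs commute. *)
Definition mon : choiceType := (nat * bool)%type.
Definition mon2 : choiceType := (mon * mon)%type.
Notation LPoly V := {malg V[mon]}.
Notation LPoly2 V := {malg V[mon2]}.

Definition sg (V : zmodType) (b : bool) (v : V) : V := if b then - v else v.

Definition lin_ext (V W : zmodType) (K : choiceType) (f : K -> V -> W)
    (p : {malg V[K]}) : W :=
  \sum_(m <- msupp p) f m p@_m.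

Definition cstL (V : zmodType) (v : V) : LPoly V := << v *g (0%N, false) >>.
Definition cstL2 (V : zmodType) (v : V) : LPoly2 V :=
  << v *g ((0%N, false), (0%N, false)) >>.

(* [chi (lambda^j chi^e) = (-1)^e lambda^(j+e) chi^(1-e)] *)
Definition chi_mon (m : mon) : mon := ((m.1 + m.2)%N, ~~ m.2).
Definition lam_mon (m : mon) : mon := (m.1.+1, m.2).

Section Operators.
Variable V : zmodType.

Definition lam : LPoly V -> LPoly V := lin_ext (fun m v => << v *g lam_mon m >>).
Definition chi : LPoly V -> LPoly V :=
  lin_ext (fun m v => sg m.2 << v *g chi_mon m >>).

(* [S] on [V[Lambda]]: [S lambda = lambda S] and [S chi = - chi S + 2 lambda]. *)
Definition Sact (S : V -> V) : LPoly V -> LPoly V :=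
  lin_ext (fun m v =>
    if m.2 then << v *+ 2 *g (m.1.+1, false) >> - << S v *g m >>
    else << S v *g m >>).
Definition Tact (S : V -> V) (p : LPoly V) : LPoly V := Sact S (Sact S p).

Definition lam2 : LPoly2 V -> LPoly2 V :=
  lin_ext (fun m v => << v *g (lam_mon m.1, m.2) >>).
Definition chi2 : LPoly2 V -> LPoly2 V :=
  lin_ext (fun m v => sg m.1.2 << v *g (chi_mon m.1, m.2) >>).
Definition gam2 : LPoly2 V -> LPoly2 V :=
  lin_ext (fun m v => << v *g (m.1, lam_mon m.2) >>).
Definition eta2 : LPoly2 V -> LPoly2 V :=
  lin_ext (fun m v => sg (m.1.2 (+) m.2.2) << v *g (m.1, chi_mon m.2) >>).

(* Substitution [lambda := L], [chi := X] in a polynomial, with [L] and [X]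
   operators acting from the left on the (embedded) coefficients. *)
Definition evalL (W : zmodType) (L X : W -> W) (emb : V -> W) (p : LPoly V) : W :=
  lin_ext (fun (m : mon) v => iter m.1 L (iter m.2 X (emb v))) p.

Definition inLambda : LPoly V -> LPoly2 V := evalL lam2 chi2 (@cstL2 V).
Definition inGamma : LPoly V -> LPoly2 V := evalL gam2 eta2 (@cstL2 V).
Definition inLambdaGamma : LPoly V -> LPoly2 V :=
  evalL (fun p => lam2 p + gam2 p) (fun p => chi2 p + eta2 p) (@cstL2 V).

End Operators.

Section Integrals.
Variables (F : fieldType) (V : lmodType F).

(* [\int_{-nabla}^0 dLambda p], where [\int dLambda = \int dlambda d/dchi] *)
Definition int_nabla (S : V -> V) : LPoly V -> V :=
  lin_ext (fun m v =>
    if m.2 then - ((-1) ^+ m.1.+1 / m.1.+1%:R) *: iter m.1.+1 (S \o S) v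
    else 0).

(* [:(\int_0^nabla dLambda a) p:], the operator [\int_0^nabla lambda^j dlambda]
   acting on [a] only *)
Definition int_nop (S : V -> V) (nop : V -> V -> V) (a : V) : LPoly V -> V :=
  lin_ext (fun m v =>
    if m.2 then m.1.+1%:R^-1 *: nop (iter m.1.+1 (S \o S) a) v else 0).

(* [\int_0^Lambda dGamma p]; moving [d/deta] past [chi^d] gives [(-1)^d]. *)
Definition int_0Lambda : LPoly2 V -> LPoly V :=
  lin_ext (fun m v =>
    if m.2.2
    then sg m.1.2 << m.2.1.+1%:R^-1 *: v *g ((m.1.1 + m.2.1.+1)%N, m.1.2) >>
    else 0).

End Integrals.

(** * SUSY Lie conformal algebras and SUSY vertex algebras ([N_K = 1]) *)

(* [par false] and [par true] are the even and the odd part. *)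
Record superspace (F : fieldType) := Superspace {
  ss_sort :> lmodType F;
  par : bool -> ss_sort -> Prop;
  par0 : forall p, par p 0;
  par_lin : forall p (a : F) u v, par p u -> par p v -> par p (a *: u + v);
  par_decomp : forall v, exists u0 u1,
    [/\ par false u0, par true u1 & v = u0 + u1];
  par_direct : forall v, par false v -> par true v -> v = 0
}.

(* The bracket and the integral sign are odd, which gives the Koszul signs
   - [[a_Lambda (gamma^j eta^e u)] = (-1)^(e (|a|+1)) gamma^j eta^e [a_Lambda u]],
   - [[(lambda^j chi^e u)_Gamma c] = (-1)^e lambda^j chi^e [u_Gamma c]]. *)
Section Brackets.
Variables (F : fieldType) (V : superspace F) (br : V -> V -> LPoly V).

(* [[a_Lambda q(Gamma)]], [a] of parity [pa] *)
Definition br_Lambda_r (pa : bool) (a : V) : LPoly V -> LPoly2 V :=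
  lin_ext (fun m u =>
    sg (m.2 && ~~ pa) (iter m.1 (@gam2 V) (iter m.2 (@eta2 V)
      (inLambda (br a u))))).

(* [[b_Gamma p(Lambda)]], [b] of parity [pb] *)
Definition br_Gamma_r (pb : bool) (b : V) : LPoly V -> LPoly2 V :=
  lin_ext (fun m u =>
    sg (m.2 && ~~ pb) (iter m.1 (@lam2 V) (iter m.2 (@chi2 V)
      (inGamma (br b u))))).

(* [[p(Lambda)_Psi c]], where [inPsi] substitutes [Psi] in the outer bracket *)
Definition br_l (inPsi : LPoly V -> LPoly2 V) (p : LPoly V) (c : V) : LPoly2 V :=
  lin_ext (fun m u =>
    sg m.2 (iter m.1 (@lam2 V) (iter m.2 (@chi2 V) (inPsi (br u c))))) p.

End Brackets.

Record susyLCA (F : fieldType) := SusyLCA {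
  lca_space :> superspace F;
  Sop : {linear lca_space -> lca_space};
  br : lca_space -> lca_space -> LPoly lca_space;
  Sop_odd : forall p v, par p v -> par (~~ p) (Sop v);
  br_linl : forall v m, linear (fun u => (br u v)@_m);
  br_linr : forall u m, linear (fun v => (br u v)@_m);
  br_par : forall pa pb a b m, par pa a -> par pb b ->
    par (pa (+) pb (+) ~~ m.2) (br a b)@_m;
  br_Sl : forall a b, br (Sop a) b = chi (br a b);
  br_Sr : forall pa a b, par pa a ->
    br a (Sop b) = sg (~~ pa) (Sact Sop (br a b) + chi (br a b));
  br_skew : forall pa pb a b, par pa a -> par pb b ->
    br a b =
      sg (pa && pb)
        (evalL (fun p => - lam p - Tact Sop p) (fun p => - chi p - Sact Sop p)
               (@cstL lca_space) (br b a));
  br_jacobi : forall pa pb a b c, par pa a -> par pb b ->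
    br_Lambda_r br pa a (br b c) =
      sg (~~ pa) (br_l br (@inLambdaGamma _) (br a b) c)
      + sg (~~ pa && ~~ pb) (br_Gamma_r br pb b (br a c))
}.

(* Vertex algebras are taken to be nonzero, as rings are in [nzRingType]. *)
Record susyVA (F : fieldType) := SusyVA {
  va_lca :> susyLCA F;
  vac : va_lca;
  nop : va_lca -> va_lca -> va_lca;
  vac_neq0 : vac != 0;
  vac_even : par false vac;
  nop_linl : forall v, linear (nop^~ v);
  nop_linr : forall u, linear (nop u);
  nop_par : forall pa pb a b, par pa a -> par pb b ->
    par (pa (+) pb) (nop a b);
  nop_vacl : forall a, nop vac a = a;
  nop_vacr : forall a, nop a vac = a;
  nop_S : forall pa a b, par pa a ->
    Sop va_lca (nop a b) = nop (Sop va_lca a) b + sg pa (nop a (Sop va_lca b));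
  quasi_comm : forall pa pb a b, par pa a -> par pb b ->
    nop a b - sg (pa && pb) (nop b a) = int_nabla (Sop va_lca) (br a b);
  quasi_assoc : forall pa pb a b c, par pa a -> par pb b ->
    nop (nop a b) c - nop a (nop b c) =
      int_nop (Sop va_lca) nop a (br b c)
      + sg (pa && pb) (int_nop (Sop va_lca) nop b (br a c));
  wick : forall pa pb a b c, par pa a -> par pb b ->
    br a (nop b c) =
      lin_ext (fun (m : mon) u => << nop u c *g m >>) (br a b)
      + sg (~~ pa && pb)
          (lin_ext (fun (m : mon) u => sg (m.2 && pb) << nop b u *g m >>)
             (br a c))
      + int_0Lambda (br_l (@br F va_lca) (@inGamma _) (br a b) c)
}.

Section Morphisms.
Variable F : fieldType.

Definition lca_hom (A B : susyLCA F) (f : A -> B) : Prop :=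
  [/\ linear f,
      forall p v, par p v -> par p (f v),
      forall v, f (Sop A v) = Sop B (f v)
    & forall u v m, (br (f u) (f v))@_m = f (br u v)@_m].

Definition va_hom (V W : susyVA F) (f : V -> W) : Prop :=
  [/\ lca_hom f, f (vac V) = vac W
    & forall u v, f (nop u v) = nop (f u) (f v)].

(* [one] is the element of [A] that stands for the scalar 1: the universal
   enveloping algebra is universal for the morphisms sending it to the vacuum. *)
Definition universal_enveloping (A : susyLCA F) (one : A)
    (V : susyVA F) (iota : A -> V) : Prop :=
  [/\ lca_hom iota, iota one = vac V &
      forall (W : susyVA F) (f : A -> W), lca_hom f -> f one = vac W ->
        exists phi : V -> W,
          [/\ va_hom phi, forall r, phi (iota r) = f r
            & forall psi : V -> W, va_hom psi ->
                (forall r, psi (iota r) = f r) -> psi =1 phi]].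

(* [A] is the direct sum of the free [C[S]]-module on the [X i] and of
   [C one], with [S one = 0]. *)
Definition freely_generated (A : susyLCA F) (I : finType) (X : I -> A)
    (one : A) : Prop :=
  [/\ par false one, Sop A one = 0 &
      bijective (fun q : {ffun I -> {poly F}} * F =>
        \sum_i \sum_(n < size (q.1 i)) (q.1 i)`_n *: iter n (Sop A) (X i)
        + q.2 *: one)].

(* [j] is the inclusion of the odd copy of the Lie algebra [F^n] with
   invariant pairing [form]. *)
Definition superaffine_LCA (n : nat) (lie : 'rV[F]_n -> 'rV[F]_n -> 'rV[F]_n)
    (form : 'rV[F]_n -> 'rV[F]_n -> F) (k : F)
    (A : susyLCA F) (one : A) (j : 'rV[F]_n -> A) : Prop :=
  [/\ linear j,
      forall a, par true (j a),
      forall a b, br (j a) (j b) =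
        cstL (j (lie a b)) + chi (cstL ((k * form a b) *: one))
    & freely_generated (fun i : 'I_n => j (delta_mx 0 i)) one].

Definition N2_relations (c : F) (A : susyLCA F) (one H J : A) : Prop :=
  let S := Sact (Sop A) in let T := Tact (Sop A) in
  [/\ br J J = - (cstL H + lam (chi (cstL ((c / 3%:R) *: one)))),
      br H J = T (cstL J) *+ 2 + lam (cstL J) *+ 2 + chi (S (cstL J))
    & br H H = T (cstL H) *+ 2 + chi (S (cstL H)) + lam (cstL H) *+ 3
               + chi (lam (lam (cstL ((c / 3%:R) *: one))))].

Definition levi_civita (i j k : nat) : F :=
  match i, j, k with
  | 0, 1, 2 | 1, 2, 0 | 2, 0, 1 => 1%R
  | 0, 2, 1 | 2, 1, 0 | 1, 0, 2 => (-1)%R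
  | _, _, _ => 0%R
  end%N.

Definition N4_LCA (c : F) (A : susyLCA F) (one H : A) (J : 'I_3 -> A) : Prop :=
  let S := Sact (Sop A) in
  [/\ par true H /\ forall i, par false (J i),
      forall i, N2_relations c one H (J i),
      forall i j, i != j -> br (J i) (J j) =
        - \sum_(k < 3) (let Jk := cstL (levi_civita i j k *: J k) in
                  S Jk + chi Jk *+ 2)
    & freely_generated (fun o : option 'I_3 => if o is Some i then J i else H)
        one].

End Morphisms.

(** * The quadratic Lie algebra of left-invariant sections of [E_ell] *)

(* [u : 'rV_4] is [\sum_i u_i v_(i+1)] in [k], or [\sum_i u_i v^(i+1)] in the
   dual; [row_mx v alpha : 'rV_(4 + 4)] is [v + alpha]. *)
Section Geometry.
Variables (F : fieldType) (ell x : F).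
Implicit Types (v w al : 'rV[F]_4) (a b u : 'rV[F]_(4 + 4)).

Definition lie_k v w : 'rV[F]_4 :=
  \row_m - \sum_(i < 4) \sum_(j < 4) levi_civita F i j m * v 0 i * w 0 j.

Definition ev al v : F := \sum_i al 0 i * v 0 i.

(* [v^1 /\ v^2 /\ v^3], with value 1 on [(v_1, v_2, v_3)] *)
Definition vol3 (v1 v2 v3 : 'rV[F]_4) : F :=
  \sum_(i < 4) \sum_(j < 4) \sum_(m < 4) levi_civita F i j m * v1 0 i * v2 0 j * v3 0 m.

Definition lie_g a b : 'rV[F]_(4 + 4) :=
  let v := lsubmx a in let al := rsubmx a in
  let w := lsubmx b in let be := rsubmx b in
  row_mx (lie_k v w)
    (\row_j (let vj := delta_mx 0 j in
       - ev be (lie_k v vj) + ev al (lie_k w vj) + ell * vol3 v w vj)).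

(* polarization of [(v + alpha | v + alpha) = alpha(v)] *)
Definition pairing a b : F :=
  2%:R^-1 * (ev (rsubmx a) (lsubmx b) + ev (rsubmx b) (lsubmx a)).

Definition metric : 'M[F]_4 :=
  ell *: diag_mx (\row_(i < 4) (if i == 3 then x ^+ 2 else 1)).

(* [v *m Vplus = v + g_x(v)]: the row space is [V_+^x]. *)
Definition Vplus : 'M[F]_(4, 4 + 4) := row_mx 1%:M metric.

Definition eps_plus : 'rV[F]_(4 + 4) :=
  - 2%:R^-1 *: row_mx ((ell * x)^-1 *: delta_mx 0 3) (x *: delta_mx 0 3).

(* On left-invariant sections [L_v mu / mu = - \tr (ad v)], the volume element
   [mu] of [g_x] being left-invariant. *)
Definition div0 u : F := - \sum_i lie_k (lsubmx u) (delta_mx 0 i) 0 i.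
Definition div_plus u : F := div0 u - pairing eps_plus u.

(* The complex structure with [v_4 |-> x v_p] and [v_q |-> v_r]; matrices act
   on row vectors, [v |-> v *m M]. *)
Definition cstruct (p q r : 'I_4) : 'M[F]_4 :=
  x *: delta_mx 3 p - x^-1 *: delta_mx p 3 + delta_mx q r - delta_mx r q.
Definition I_x := cstruct 0 1 2.
Definition J_x := cstruct 1 2 0.
Definition K_x := cstruct 2 0 1.

End Geometry.

(* A triple [(V_+, div_+, I)]: [V_+] is the row space of [tV], [tdiv] is the
   divergence on left-invariant sections, and [v *m tV |-> v *m tI *m tV] is the
   complex structure. *)
Record triple (F : fieldType) := Triple {
  tV : 'M[F]_(4, 4 + 4);
  tdiv : 'rV[F]_(4 + 4) -> F;
  tI : 'M[F]_4
}.

(** * Complexification and the vectors [J_0], [H'] *)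

Section Generators.
Variable R : realType.
Local Notation C := (R[i]).
Local Notation toC := (map_mx (real_complex R)).

Definition lieC n (lie : 'rV[R]_n -> 'rV[R]_n -> 'rV[R]_n) (a b : 'rV[C]_n) :
    'rV[C]_n :=
  \sum_i \sum_j (a 0 i * b 0 j) *: toC (lie (delta_mx 0 i) (delta_mx 0 j)).

Definition formC n (form : 'rV[R]_n -> 'rV[R]_n -> R) (a b : 'rV[C]_n) : C :=
  \sum_i \sum_j a 0 i * b 0 j * (form (delta_mx 0 i) (delta_mx 0 j))%:C%C.

Definition pairingC := formC (@pairing R).

Definition eigenC (t : triple R) (z : C) : 'M[C]_(4, 4 + 4) :=
  eigenspace (toC (tI t)) z *m toC (tV t).

Definition l_of t := <<eigenC t 'i>>%MS.
Definition lbar_of t := <<eigenC t (- 'i)>>%MS.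

(* orthogonal complement of the complexified row space of [U] *)
Definition orthoC m (U : 'M[R]_(m, 4 + 4)) : 'M[C]_(4 + 4) :=
  kermx (\matrix_(i < 4 + 4, j < m) pairingC (delta_mx 0 i) (row j (toC U))).

(* The rows of [e] and [eb] are the bases [epsilon_j], [\bar epsilon_j]. *)
Definition dual_frame (t : triple R) (e eb : 'M[C]_(2, 4 + 4)) : Prop :=
  [/\ row_free e, row_free eb, (e == l_of t)%MS, (eb == lbar_of t)%MS
    & forall j k, pairingC (row j e) (row k eb) = (j == k)%:R].

(* components in [l (+) \bar l (+) V_+^\perp] *)
Definition pr_l t (u : 'rV[C]_(4 + 4)) :=
  u *m proj_mx (l_of t) (lbar_of t + orthoC (tV t))%MS.
Definition pr_lbar t (u : 'rV[C]_(4 + 4)) :=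
  u *m proj_mx (lbar_of t) (l_of t + orthoC (tV t))%MS.

Section Vectors.
Variables (ell : R) (k : C) (V : susyVA C) (Pi : 'rV[C]_(4 + 4) -> V).
Variables (t : triple R) (e eb : 'M[C]_(2, 4 + 4)).

Local Notation lie := (lieC (lie_g ell)).
Local Notation low j := (row j e).
Local Notation upp j := (row j eb).
Local Notation S := (Sop V).

Definition w_vec : 'rV[C]_(4 + 4) :=
  \sum_j (pr_l t (lie (upp j) (low j)) - pr_lbar t (lie (upp j) (low j))).

Definition J0_vec : V := ('i / k) *: \sum_j nop (Pi (upp j)) (Pi (low j)).

Definition H'_vec : V :=
  k^-1 *: \sum_j (nop (Pi (low j)) (S (Pi (upp j)))
                  + nop (Pi (upp j)) (S (Pi (low j))))
  + (k ^+ 2)^-1 *: \sum_j \sum_m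
      (nop (Pi (low j)) (nop (Pi (upp m)) (Pi (lie (upp j) (low m))))
       + nop (Pi (upp j)) (nop (Pi (low m)) (Pi (lie (low j) (upp m))))
       - nop (Pi (low j)) (nop (Pi (low m)) (Pi (lie (upp j) (upp m))))
       - nop (Pi (upp j)) (nop (Pi (upp m)) (Pi (lie (low j) (low m)))))
  + k^-1 *: S (S (Pi w_vec)).

End Vectors.
End Generators.

(* Main.v *)
Require Import Defs.
From HB Require Import structures.
From mathcomp Require Import all_boot all_order all_algebra.
From mathcomp Require Import finmap complex reals.
From mathcomp.multinomials Require Import monalg.
From mathcomp Require Import ring.

Set Implicit Arguments.
Unset Strict Implicit.
Unset Printing Implicit Defensive.

Import Order.TTheory GRing.Theory Num.Theory.
Local Open Scope ring_scope.

(** The vectors [u_i = v_i + g(v_i)] of V_+ satisfy [[u_i, u_j] = - eps_ijk u_k]: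
    V_+ is a copy of su(2) + u(1) inside the Lie algebra of left-invariant
    sections, and everything takes place in the affine algebra of V_+.  After
    dividing [u_4] by [x] to get a vector [b], the vectors [b], [u_1], [u_2], [u_3]
    are orthogonal of the same length, and with [kap = 2 ell] the odd fields
    satisfy [[u_i Lambda u_j] = - eps_ijk u_k + chi kap delta_ij],
    [[b_Lambda b] = chi kap].

    The vectors [J_0] and [H'] are contractions with the canonical tensor
    [\sum_j e^j (x) e_j] of dual bases of the two eigenspaces of a complex
    structure, hence do not depend on these bases ([dual_bases_sum]).  Its
    symmetric part is the metric and its alternating part the Kaehler form, and one
    finds ([J0_frame], [H'_frame])
      [J = kap^-1 (:b p: + :q r:)],
      [H = kap^-1 (:b S b: + \sum_i :u_i S u_i: - T b) - 2 kap^-2 :u_1 :u_2 u_3::],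
    where [(p, q, r)] is the cyclic permutation of [(u_1, u_2, u_3)] with
    [I b = p], [I q = r].  The expression for [H] is invariant under rotation of the
    [u_i] ([cubicH_rot]), which is the equality of the three vectors [H'].

    By skew-symmetry and the Wick formula, [[J_Lambda -]] on [b], [p], [q], [r] is
    up to sign the complex structure followed by [S + chi], plus one of the other two
    vectors [J] for [q] and [r], and a central term for [p].  A second use of the
    Wick formula gives [[J^i_Lambda J^j]] ([br_quadJ_next], [br_quadJ_self]).  The
    brackets with [H] need no computation in the vertex algebra: as [- H] is the constant term of [[J^i_Lambda J^i]], the
    Jacobi identity at Lambda = 0 yields them from the brackets of the [J^i]
    ([br_HJ], [br_HH]).

    This gives a morphism from the free module over [C[S]] on [H], [J^i] and the
    central element, and from its enveloping algebra.  It is injective on the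
    module because its kernel is an ideal, and bracketing an element that is not
    central with a suitable generator produces a leading coefficient which is a
    nonzero multiple of the central element, and this goes to a nonzero multiple of
    the vacuum ([lca_hom_inj]). *)

Local Notation LPoly V := {malg V[mon]}.
Local Notation LPoly2 V := {malg V[mon2]}.
Local Notation one_mon := (0%N, false).

(** * Coefficients of polynomials in Lambda *)

Section LinExt.
Variables (V : zmodType) (K : choiceType).

Lemma lin_extE (W : zmodType) (f : K -> V -> W) (p : {malg V[K]}) (s : seq K) :
  uniq s -> (forall k, f k 0 = 0) -> (forall k, k \notin s -> f k p@_k = 0) ->
  lin_ext f p = \sum_(k <- s) f k p@_k.
Proof.
move=> s_uniq f0 fs.
have restr (r1 r2 : seq K) : (forall k, k \notin r2 -> f k p@_k = 0) ->
  \sum_(k <- r1) f k p@_k = \sum_(k <- [seq k <- r1 | k \in r2]) f k p@_k.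
  move=> fr; rewrite big_filter [RHS]big_mkcond; apply: eq_bigr => k _.
  by case: ifPn => // /fr.
rewrite /lin_ext (restr _ s) // [RHS](restr _ (msupp p)) => [|k km]; last first.
  by rewrite mcoeff_outdom.
apply: perm_big; apply: uniq_perm; rewrite ?filter_uniq ?fset_uniq // => k.
by rewrite !mem_filter andbC.
Qed.

Lemma lin_ext1 (W : zmodType) (f : K -> V -> W) (p : {malg V[K]}) (k0 : K) :
  (forall k, f k 0 = 0) -> (forall k, k != k0 -> f k p@_k = 0) ->
  lin_ext f p = f k0 p@_k0.
Proof.
move=> f0 fk; rewrite (@lin_extE _ _ _ [:: k0]) ?big_seq1 // => k.
by rewrite inE; apply: fk.
Qed.

Lemma lin_ext_eq0 (W : zmodType) (f : K -> V -> W) (p : {malg V[K]}) :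
  (forall k, f k p@_k = 0) -> lin_ext f p = 0.
Proof. by move=> f0; apply: big1. Qed.

Lemma raddf_lin_ext (W W' : zmodType) (h : {additive W -> W'})
    (f : K -> V -> W) (p : {malg V[K]}) :
  h (lin_ext f p) = lin_ext (fun k v => h (f k v)) p.
Proof. exact: raddf_sum. Qed.

Lemma eq_lin_ext (W : zmodType) (f g : K -> V -> W) (p : {malg V[K]}) :
  (forall k v, f k v = g k v) -> lin_ext f p = lin_ext g p.
Proof. by move=> fg; apply: eq_bigr => k _; apply: fg. Qed.

Lemma lin_ext_id (p : {malg V[K]}) : lin_ext (fun k v => << v *g k >>) p = p.
Proof. by rewrite {2}[p]monalgE. Qed.

Lemma lin_ext_is_additive (W : zmodType) (f : K -> V -> W) :
  (forall k, zmod_morphism (f k)) -> zmod_morphism (lin_ext f).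
Proof.
move=> fB p q; pose D := (msupp p `|` msupp q)%fset.
have f0 k : f k 0 = 0 by rewrite -(subrr 0) fB subrr.
have onD r : (msupp r `<=` D)%fset -> lin_ext f r = \sum_(k <- D) f k r@_k.
  move=> rD; apply: lin_extE; rewrite ?fset_uniq // => k kD.
  by rewrite mcoeff_outdom //; apply: contraNN kD; apply: (fsubsetP rD).
rewrite !onD ?fsubsetUl ?fsubsetUr ?msuppB_le // -sumrB.
by apply: eq_bigr => k _; rewrite mcoeffB fB.
Qed.

End LinExt.

Lemma mcoeff_lin_ext (V W : zmodType) (K L : choiceType) (f : K -> V -> {malg W[L]})
    (p : {malg V[K]}) m :
  (lin_ext f p)@_m = lin_ext (fun k v => (f k v)@_m) p.
Proof. exact: (raddf_lin_ext (mcoeff m)). Qed.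

Fact pol4_key : unit. Proof. exact: tt. Qed.

Section Coefficients.
Variable V : zmodType.
Implicit Types (p : LPoly V) (v : V).

Lemma sg0 (W : zmodType) b : sg b (0 : W) = 0.
Proof. by case: b; rewrite /= ?oppr0. Qed.

Lemma raddf_sg (U W : zmodType) (h : {additive U -> W}) b u : h (sg b u) = sg b (h u).
Proof. by case: b; rewrite /= ?raddfN. Qed.

Lemma sg_is_additive (W : zmodType) b : zmod_morphism (@sg W b).
Proof. by case: b => u v //=; rewrite !opprB opprK addrC. Qed.

Lemma mcoeff_sg b p m : (sg b p)@_m = sg b p@_m.
Proof. exact: (raddf_sg (mcoeff m)). Qed.

Lemma mcoeff_cstL v m : (cstL v)@_m = v *+ (m == one_mon).
Proof. by rewrite mcoeffU eq_sym. Qed.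

Lemma cstL_is_additive : zmod_morphism (@cstL V).
Proof. by move=> u v; apply: raddfB. Qed.
HB.instance Definition _ := GRing.isZmodMorphism.Build _ _ (@cstL V) cstL_is_additive.

Lemma cstL0 : cstL (0 : V) = 0.
Proof. exact: monalgU0. Qed.

Lemma lam_is_additive : zmod_morphism (@lam V).
Proof. by apply: lin_ext_is_additive => k u v; apply: raddfB. Qed.
HB.instance Definition _ := GRing.isZmodMorphism.Build _ _ (@lam V) lam_is_additive.

Lemma chi_is_additive : zmod_morphism (@chi V).
Proof. by apply: lin_ext_is_additive => k u v; rewrite raddfB sg_is_additive. Qed.
HB.instance Definition _ := GRing.isZmodMorphism.Build _ _ (@chi V) chi_is_additive.

Lemma mcoeff_lam p n e : (lam p)@_(n, e) = if n is n'.+1 then p@_(n', e) else 0.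
Proof.
rewrite mcoeff_lin_ext.
case: n => [|n]; first by rewrite lin_ext_eq0 // => -[k d]; rewrite mcoeffU.
rewrite (@lin_ext1 _ _ _ _ _ (n, e)) ?mcoeffUU // => [k|[k d] ne].
  by rewrite monalgU0 mcoeff0.
by rewrite mcoeffU xpair_eqE eqSS -xpair_eqE (negPf ne).
Qed.

Lemma mcoeff_chi p n e : (chi p)@_(n, e) =
  if e then p@_(n, false) else if n is n'.+1 then - p@_(n', true) else 0.
Proof.
rewrite mcoeff_lin_ext.
have f0 (m k : mon) : (sg k.2 << 0 *g chi_mon k >>)@_m = 0 :> V.
  by rewrite monalgU0 sg0 mcoeff0.
case: e => [|].
  rewrite (@lin_ext1 _ _ _ _ _ (n, false)) /= ?mcoeffU /chi_mon /= ?addn0 ?eqxx //.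
  case=> k [] ne; rewrite /= /chi_mon /= ?addn0 ?addn1 ?mcoeffN !mcoeffU !xpair_eqE /=.
    by rewrite andbF oppr0.
  by rewrite andbT; move: ne; rewrite xpair_eqE /= andbT => /negPf->.
case: n => [|n].
  rewrite lin_ext_eq0 // => -[k []]; rewrite /chi_mon /= ?addn1 ?mcoeffN mcoeffU //=.
    by rewrite oppr0.
  by rewrite xpair_eqE andbF.
rewrite (@lin_ext1 _ _ _ _ _ (n, true)) //= ?mcoeffN /chi_mon /= ?addn1 ?mcoeffUU //.
case=> k [] ne; rewrite /= ?addn0 ?addn1 ?mcoeffN !mcoeffU !xpair_eqE /=.
  by move: ne; rewrite xpair_eqE !andbT ?eqSS => /negPf->; rewrite oppr0.
by rewrite andbF.
Qed.

Section Sact.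
Variable S : {additive V -> V}.

Lemma Sact_is_additive : zmod_morphism (Sact S).
Proof.
apply: lin_ext_is_additive => -[k [|]] u v; rewrite [S _]raddfB.
  rewrite mulrnBl !monalgUB !opprB -!addrA; congr (_ + _).
  by rewrite addrCA [RHS]addrCA; congr (_ + _); rewrite addrC.
by rewrite monalgUB.
Qed.
HB.instance Definition _ := GRing.isZmodMorphism.Build _ _ (Sact S) Sact_is_additive.

Lemma mcoeff_Sact p n e : (Sact S p)@_(n, e) =
  if e then - S p@_(n, true)
  else S p@_(n, false) + if n is n'.+1 then p@_(n', true) *+ 2 else 0.
Proof.
rewrite mcoeff_lin_ext.
have f0 (m k : mon) : (if k.2 then << 0 *+ 2 *g (k.1.+1, false) >> - << S 0 *g k >>
    else << S 0 *g k >>)@_m = 0 :> V.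
  by case: k => k []; rewrite /= (raddf0 S) ?mul0rn !monalgU0 ?subrr mcoeff0.
case: e => [|].
  rewrite (lin_ext1 (k0 := (n, true)) (f0 _)).
    by rewrite mcoeffB !mcoeffU eqxx xpair_eqE andbF sub0r.
  case=> k [] ne; rewrite ?mcoeffB !mcoeffU !xpair_eqE ?andbF //=.
  by move: ne; rewrite xpair_eqE !andbT => /negPf->; rewrite subr0.
case: n => [|n].
  rewrite (lin_ext1 (k0 := one_mon) (f0 _)).
    by rewrite mcoeffU eqxx addr0.
  case=> k [] ne; rewrite ?mcoeffB !mcoeffU !xpair_eqE ?andbF ?subrr //=.
  by move: ne; rewrite xpair_eqE !andbT => /negPf->.
rewrite (@lin_extE _ _ _ _ _ [:: (n.+1, false); (n, true)]).
- by rewrite big_cons big_seq1 /= mcoeffB !mcoeffU !xpair_eqE !eqxx !andbF subr0.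
- by rewrite /= inE xpair_eqE andbF.
- exact: f0.
case=> k []; rewrite !inE !xpair_eqE ?andbF ?andbT ?orbF //= => /negPf ne;
  by rewrite ?mcoeffB !mcoeffU !xpair_eqE ?eqSS ?ne ?andbF ?subrr.
Qed.

End Sact.

(** The Jacobi identity is used only at Lambda = 0, where it is an identity between
    polynomials in one variable. *)
Definition at_Lambda0 : LPoly2 V -> LPoly V :=
  lin_ext (fun m v => if m.1 == one_mon then << v *g m.2 >> else 0).

Lemma at_Lambda0_is_additive : zmod_morphism at_Lambda0.
Proof.
by apply: lin_ext_is_additive => k u v; case: ifP; rewrite ?raddfB ?subrr.
Qed.
HB.instance Definition _ :=
  GRing.isZmodMorphism.Build _ _ at_Lambda0 at_Lambda0_is_additive.

Lemma at_Lambda0_lin_ext (K : choiceType) (f : K -> V -> LPoly2 V) (p : {malg V[K]}) :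
  at_Lambda0 (lin_ext f p) = lin_ext (fun k v => at_Lambda0 (f k v)) p.
Proof. exact: (raddf_lin_ext at_Lambda0). Qed.

Lemma at_Lambda0D (p q : LPoly2 V) : at_Lambda0 (p + q) = at_Lambda0 p + at_Lambda0 q.
Proof. exact: raddfD. Qed.

Lemma at_Lambda0_sg b q : at_Lambda0 (sg b q) = sg b (at_Lambda0 q).
Proof. exact: (raddf_sg at_Lambda0). Qed.

Lemma lin_extU (W : zmodType) (K : choiceType) (f : K -> V -> W) k v :
  (forall k, f k 0 = 0) -> lin_ext f << v *g k >> = f k v.
Proof.
move=> f0; rewrite (@lin_ext1 _ _ _ _ _ k) ?mcoeffUU // => k' ne.
by rewrite mcoeffU eq_sym (negPf ne) f0.
Qed.

Lemma at_Lambda0U m v :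
  at_Lambda0 << v *g m >> = if m.1 == one_mon then << v *g m.2 >> else 0.
Proof. by rewrite /at_Lambda0 lin_extU // => k; rewrite monalgU0 if_same. Qed.

Lemma at_Lambda0_lam2 q : at_Lambda0 (lam2 q) = 0.
Proof.
rewrite /lam2 at_Lambda0_lin_ext lin_ext_eq0 // => k.
by rewrite at_Lambda0U.
Qed.

Lemma at_Lambda0_chi2 q : at_Lambda0 (chi2 q) = 0.
Proof.
rewrite /chi2 at_Lambda0_lin_ext lin_ext_eq0 // => -[[k e] m] /=.
rewrite at_Lambda0_sg at_Lambda0U /chi_mon; case: e; rewrite /= ?addn1 ?xpair_eqE ?andbF ?oppr0.
  by [].
by [].
Qed.

Lemma gam2_is_additive : zmod_morphism (@gam2 V).
Proof. by apply: lin_ext_is_additive => k u v; apply: raddfB. Qed.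
HB.instance Definition _ := GRing.isZmodMorphism.Build _ _ (@gam2 V) gam2_is_additive.

Lemma eta2_is_additive : zmod_morphism (@eta2 V).
Proof. by apply: lin_ext_is_additive => k u v; rewrite raddfB sg_is_additive. Qed.
HB.instance Definition _ := GRing.isZmodMorphism.Build _ _ (@eta2 V) eta2_is_additive.

Lemma at_Lambda0_gam2 q : at_Lambda0 (gam2 q) = lam (at_Lambda0 q).
Proof.
rewrite [q]monalgE (raddf_sum (@gam2 V)) !(raddf_sum at_Lambda0) (raddf_sum (@lam V)); apply: eq_bigr => m _.
rewrite /= {1}/gam2 lin_extU => [|k]; last by rewrite monalgU0.
rewrite !at_Lambda0U /=; case: ifP; rewrite ?raddf0 //.
by rewrite /lam lin_extU // => k; rewrite monalgU0.
Qed.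

Lemma at_Lambda0_eta2 q : at_Lambda0 (eta2 q) = chi (at_Lambda0 q).
Proof.
rewrite [q]monalgE (raddf_sum (@eta2 V)) !(raddf_sum at_Lambda0) (raddf_sum (@chi V)); apply: eq_bigr => m _.
rewrite /= {1}/eta2 lin_extU => [|k]; last by rewrite monalgU0 sg0.
rewrite at_Lambda0_sg !at_Lambda0U /=.
case: eqP => [->|_]; last by rewrite raddf0 sg0.
by rewrite /chi lin_extU // => k; rewrite monalgU0 sg0.
Qed.

Lemma lam_chi_cstL (m : mon) v : iter m.1 (@lam V) (iter m.2 (@chi V) (cstL v)) = << v *g m >>.
Proof.
case: m => n e /=; have -> : iter e (@chi V) (cstL v) = << v *g (0%N, e) >>.
  by case: e; rewrite //= /chi lin_extU //= => k; rewrite monalgU0 sg0.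
elim: n => //= n ->.
by rewrite /lam lin_extU // => k; rewrite monalgU0.
Qed.

Lemma at_Lambda0_cstL2 v : at_Lambda0 (cstL2 v) = cstL v.
Proof. by rewrite at_Lambda0U. Qed.

Lemma at_Lambda0_gamma_eta (m : mon) q :
  at_Lambda0 (iter m.1 (@gam2 V) (iter m.2 (@eta2 V) q))
  = iter m.1 (@lam V) (iter m.2 (@chi V) (at_Lambda0 q)).
Proof.
case: m => n e /=; have -> : iter e (@chi V) (at_Lambda0 q) = at_Lambda0 (iter e (@eta2 V) q).
  by case: e; rewrite //= at_Lambda0_eta2.
by elim: n => //= n <-; rewrite at_Lambda0_gam2.
Qed.

Lemma at_Lambda0_lambda_chi (m : mon) q :
  at_Lambda0 (iter m.1 (@lam2 V) (iter m.2 (@chi2 V) q))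
  = if m == one_mon then at_Lambda0 q else 0.
Proof. by case: m => [[|n] []]; rewrite //= ?at_Lambda0_lam2 ?at_Lambda0_chi2. Qed.

Lemma at_Lambda0_inLambda p : at_Lambda0 (inLambda p) = cstL p@_one_mon.
Proof.
rewrite /inLambda /evalL at_Lambda0_lin_ext.
rewrite (@lin_ext1 _ _ _ _ _ one_mon) ?at_Lambda0_lambda_chi ?at_Lambda0_cstL2 //= => [m|m].
  by rewrite at_Lambda0_lambda_chi at_Lambda0_cstL2 /cstL monalgU0 if_same.
by rewrite at_Lambda0_lambda_chi => /negPf->.
Qed.

Lemma at_Lambda0_inGamma p : at_Lambda0 (inGamma p) = p.
Proof.
rewrite /inGamma /evalL at_Lambda0_lin_ext -[RHS]lin_ext_id.
apply: eq_lin_ext => m v.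
by rewrite at_Lambda0_gamma_eta at_Lambda0_cstL2 lam_chi_cstL.
Qed.

Lemma at_Lambda0_inLambdaGamma p : at_Lambda0 (inLambdaGamma p) = p.
Proof.
rewrite /inLambdaGamma /evalL at_Lambda0_lin_ext -[RHS]lin_ext_id.
apply: eq_lin_ext => -[n e] v; rewrite -lam_chi_cstL /=.
elim: n => [|n IHn] /=; last by rewrite raddfD /= at_Lambda0_lam2 add0r at_Lambda0_gam2 IHn.
by case: e; rewrite /= ?at_Lambda0_cstL2 // raddfD /= at_Lambda0_chi2 add0r at_Lambda0_eta2 at_Lambda0_cstL2.
Qed.

(** The general form of the brackets below, apart from [[H_Lambda H]], whose
    central term has degree 2 in [lambda]. *)
Definition pol4 : V -> V -> V -> V -> LPoly V :=
  locked_with pol4_key (fun u v w z =>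
    cstL u + chi (cstL v) + lam (cstL w) + lam (chi (cstL z))).

Lemma pol4E u v w z :
  pol4 u v w z = cstL u + chi (cstL v) + lam (cstL w) + lam (chi (cstL z)).
Proof. by rewrite /pol4 unlock. Qed.

Lemma mcoeff_pol4 u v w z m : (pol4 u v w z)@_m =
  match m with
  | (0, false) => u | (0, true) => v | (1, false) => w | (1, true) => z
  | _ => 0%R
  end%N.
Proof.
case: m => n e; rewrite pol4E !mcoeffD mcoeff_chi !mcoeff_lam !mcoeff_cstL.
case: e; case: n => [|[|[|n]]];
  by rewrite /= ?mcoeff_chi ?mcoeff_cstL ?xpair_eqE /= ?mulr0n ?mulr1n ?oppr0 ?addr0 ?add0r.
Qed.

Lemma pol4P p u v w z : p@_(0%N, false) = u -> p@_(0%N, true) = v ->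
  p@_(1%N, false) = w -> p@_(1%N, true) = z -> (forall n e, p@_(n.+2, e) = 0) ->
  p = pol4 u v w z.
Proof.
move=> p00 p01 p10 p11 p2; apply/malgP => -[[|[|n]] []]; rewrite mcoeff_pol4 //;
  exact: p2.
Qed.

Lemma evalL_pol4 (W : zmodType) (T X : W -> W) (emb : {additive V -> W}) u v w z :
  T 0 = 0 -> X 0 = 0 ->
  evalL T X emb (pol4 u v w z) = emb u + X (emb v) + T (emb w) + T (X (emb z)).
Proof.
move=> T0 X0; have f0 (m : mon) : iter m.1 T (iter m.2 X (emb 0)) = 0.
  case: m => n e; rewrite raddf0 /=; have -> : iter e X 0 = 0 by case: e.
  by elim: n => [|n IHn] //=; rewrite IHn.
rewrite /evalL (@lin_extE _ _ _ _ _
  [:: one_mon; (0%N, true); (1%N, false); (1%N, true)]) //; last first.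
  move=> k ks; suff -> : (pol4 u v w z)@_k = 0 by apply: f0.
  by rewrite mcoeff_pol4; case: k ks => [[|[|n]] []].
by rewrite !big_cons big_nil addr0 !mcoeff_pol4 /= !addrA.
Qed.

(** The substitution [- Lambda - nabla] of the skew-symmetry axiom.  Without a
    [lambda chi]-term the operator [S] only meets constant polynomials, and no
    commutator of [S] with [chi] arises. *)
Lemma evalL_skew_pol4 (S : {additive V -> V}) u v w :
  evalL (fun p => - lam p - Tact S p) (fun p => - chi p - Sact S p) (@cstL V)
    (pol4 u v w 0)
  = pol4 (u - S v - S (S w)) (- v) (- w) 0.
Proof.
pose X (p : LPoly V) : LPoly V := - chi p - Sact S p.
pose T (p : LPoly V) : LPoly V := - lam p - Tact S p.
have X0 : X 0 = 0.
  by rewrite /X (raddf0 (@chi V)) (raddf0 (Sact S)) oppr0 addr0.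
have T0 : T 0 = 0.
  by rewrite /T /Tact (raddf0 (@lam V)) !(raddf0 (Sact S)) oppr0 addr0.
refine (eq_trans (@evalL_pol4 {malg V[mon]} T X (@cstL V) u v w 0 T0 X0) _).
rewrite /= cstL0 X0 T0 addr0 /X /T /Tact.
apply/malgP => -[n e]; rewrite mcoeff_pol4 /=.
rewrite -> !mcoeffD, !mcoeffN.
rewrite !mcoeff_chi !mcoeff_lam !mcoeff_Sact !mcoeff_cstL.
case: e; case: n => [|[|n]]; rewrite /= ?mcoeff_lam ?mcoeff_chi ?mcoeff_Sact ?mcoeff_cstL ?xpair_eqE /=.
all: rewrite ?mulr1n ?mulr0n ?oppr0 ?raddf0 ?addr0 ?sub0r ?add0r ?oppr0 ?raddf0 ?mul0rn ?oppr0 ?addr0 ?opprK //.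
all: by rewrite raddf0 subr0 ?add0r.
Qed.

End Coefficients.

(** * Brackets by coefficients *)

Section LCA.
Variables (F : numFieldType) (L : susyLCA F).
Local Notation S := (Sop L).
Implicit Types (a b c u v w : L).

Lemma br0l v : br (0 : L) v = 0.
Proof.
apply/malgP => m; rewrite mcoeff0.
by have := br_linl v m (-1) 0 0; rewrite scaler0 addr0 scaleN1r addNr.
Qed.

Lemma br0r v : br v (0 : L) = 0.
Proof.
apply/malgP => m; rewrite mcoeff0.
by have := br_linr v m (-1) 0 0; rewrite scaler0 addr0 scaleN1r addNr.
Qed.

Lemma brDl u v w : br (u + v) w = br u w + br v w.
Proof. by apply/malgP => m; rewrite mcoeffD -{1}[u]scale1r br_linl scale1r. Qed.

Lemma brDr u v w : br u (v + w) = br u v + br u w.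
Proof. by apply/malgP => m; rewrite mcoeffD -{1}[v]scale1r br_linr scale1r. Qed.

Lemma brNl u v : br (- u) v = - br u v.
Proof. by apply/eqP; rewrite -subr_eq0 opprK -brDl addNr br0l. Qed.

Lemma brNr u v : br u (- v) = - br u v.
Proof. by apply/eqP; rewrite -subr_eq0 opprK -brDr addNr br0r. Qed.

Lemma mcoeff_brZl (k : F) u v m : (br (k *: u) v)@_m = k *: (br u v)@_m.
Proof. by rewrite -[k *: u]addr0 br_linl br0l mcoeff0 addr0. Qed.

Lemma mcoeff_brZr (k : F) u v m : (br u (k *: v))@_m = k *: (br u v)@_m.
Proof. by rewrite -[k *: v]addr0 br_linr br0r mcoeff0 addr0. Qed.

Lemma brMnr u v n : br u (v *+ n) = br u v *+ n.
Proof. by elim: n => [|n IHn]; rewrite ?mulr0n ?br0r // !mulrS brDr IHn. Qed.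

Lemma Sop0 : S 0 = 0. Proof. exact: linear0. Qed.
Lemma SopD u v : S (u + v) = S u + S v. Proof. exact: linearD. Qed.
Lemma SopN u : S (- u) = - S u. Proof. exact: linearN. Qed.
Lemma SopMn u n : S (u *+ n) = S u *+ n. Proof. exact: linearMn. Qed.
Lemma SopZ (k : F) u : S (k *: u) = k *: S u. Proof. exact: linearZ. Qed.

Lemma parN p v : par p v -> par p (- v).
Proof. by move=> pv; rewrite -[- v]addr0 -scaleN1r; apply: par_lin => //; apply: par0. Qed.

Lemma parD p u v : par p u -> par p v -> par p (u + v).
Proof. by move=> pu pv; rewrite -[u]scale1r; apply: par_lin. Qed.

Lemma parZ p (k : F) v : par p v -> par p (k *: v).
Proof. by move=> pv; rewrite -[k *: v]addr0; apply: par_lin => //; apply: par0. Qed.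

Lemma mcoeff_br_Sl a b n e : (br (S a) b)@_(n, e) =
  if e then (br a b)@_(n, false)
  else if n is n'.+1 then - (br a b)@_(n', true) else 0.
Proof. by rewrite br_Sl mcoeff_chi. Qed.

Lemma mcoeff_br_Sr pa a b n e : par pa a -> (br a (S b))@_(n, e) = sg (~~ pa)
  (if e then (br a b)@_(n, false) - S (br a b)@_(n, true)
   else S (br a b)@_(n, false) + if n is n'.+1 then (br a b)@_(n', true) else 0).
Proof.
move=> pa_a; rewrite (br_Sr b pa_a); set x := _ + _; set y := if e then _ else _.
suff xy : x@_(n, e) = y by case: (pa); rewrite /= ?mcoeffN xy.
rewrite {}/x {}/y mcoeffD mcoeff_Sact mcoeff_chi; case: e; first by rewrite addrC.
case: n => [|n]; first by rewrite !addr0.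
(* [2 lambda] from moving [S] past [chi], and [- lambda] from [chi^2]. *)
by rewrite -addrA mulr2n addrK.
Qed.

Lemma br_skew_pol4 pa pb a b u v w : par pa a -> par pb b ->
  br b a = pol4 u v w 0 ->
  br a b = sg (pa && pb) (pol4 (u - S v - S (S w)) (- v) (- w) 0).
Proof. by move=> pa_a pb_b ba; rewrite (br_skew pa_a pb_b) ba evalL_skew_pol4. Qed.

Lemma at_Lambda0_br_Lambda_r pa a q m :
  (at_Lambda0 (br_Lambda_r (@br _ L) pa a q))@_m
  = sg (m.2 && ~~ pa) (br a q@_m)@_one_mon.
Proof.
have E k u : at_Lambda0 (sg (k.2 && ~~ pa) (iter k.1 (@gam2 L) (iter k.2 (@eta2 L)
    (inLambda (br a u))))) = sg (k.2 && ~~ pa) << (br a u)@_one_mon *g k >>.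
  by rewrite at_Lambda0_sg at_Lambda0_gamma_eta at_Lambda0_inLambda lam_chi_cstL.
rewrite /br_Lambda_r at_Lambda0_lin_ext (eq_lin_ext _ E) mcoeff_lin_ext.
rewrite (@lin_ext1 _ _ _ _ q m) ?mcoeff_sg ?mcoeffUU // => k.
  by rewrite br0r mcoeff0 monalgU0 sg0 mcoeff0.
by move=> km; rewrite mcoeff_sg mcoeffU (negPf km) mulr0n sg0.
Qed.

Lemma at_Lambda0_br_l (inPsi : LPoly L -> LPoly2 L) p c :
  (forall q, at_Lambda0 (inPsi q) = q) ->
  at_Lambda0 (br_l (@br _ L) inPsi p c) = br p@_one_mon c.
Proof.
move=> Psi; have E k u : at_Lambda0 (sg k.2 (iter k.1 (@lam2 L) (iter k.2 (@chi2 L)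
    (inPsi (br u c))))) = if k == one_mon then br u c else 0.
  rewrite at_Lambda0_sg at_Lambda0_lambda_chi Psi.
  by case: eqP => [->|_] //; rewrite sg0.
rewrite /br_l at_Lambda0_lin_ext (eq_lin_ext _ E) (@lin_ext1 _ _ _ _ p one_mon) //.
  by move=> k; rewrite br0l if_same.
by move=> k /negPf->.
Qed.

Lemma at_Lambda0_br_Gamma_r pb b p :
  at_Lambda0 (br_Gamma_r (@br _ L) pb b p) = br b p@_one_mon.
Proof.
have E k u : at_Lambda0 (sg (k.2 && ~~ pb) (iter k.1 (@lam2 L) (iter k.2 (@chi2 L)
    (inGamma (br b u))))) = if k == one_mon then br b u else 0.
  rewrite at_Lambda0_sg at_Lambda0_lambda_chi at_Lambda0_inGamma.
  by case: eqP => [->|_] //; rewrite sg0.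
rewrite /br_Gamma_r at_Lambda0_lin_ext (eq_lin_ext _ E) (@lin_ext1 _ _ _ _ p one_mon) //.
  by move=> k; rewrite br0r if_same.
by move=> k /negPf->.
Qed.

(** At Lambda = 0 the outer brackets [[-_(Lambda + Gamma) c]] become brackets at
    Gamma: up to signs, the constant term of [[a_Lambda -]] is a derivation. *)
Lemma jacobi_Lambda0 pa pb a b c m : par pa a -> par pb b ->
  sg (m.2 && ~~ pa) (br a (br b c)@_m)@_one_mon =
  sg (~~ pa) (br (br a b)@_one_mon c)@_m
  + sg (~~ pa && ~~ pb) (br b (br a c)@_one_mon)@_m.
Proof.
move=> pa_a pb_b; rewrite -at_Lambda0_br_Lambda_r (br_jacobi c pa_a pb_b).
rewrite -> at_Lambda0D, !at_Lambda0_sg, at_Lambda0_br_Gamma_r.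
rewrite -> at_Lambda0_br_l; last exact: at_Lambda0_inLambdaGamma.
by rewrite -> mcoeffD; rewrite !mcoeff_sg.
Qed.

Definition SopE := (Sop0, SopD, SopN, SopMn, SopZ).

End LCA.

(** * Linear identities in a module *)

Section LinearIdentities.
Variables (F : pzRingType) (M : lmodType F).

Inductive lexpr :=
  | LVar of nat
  | LZero
  | LAdd of lexpr & lexpr
  | LOpp of lexpr
  | LMuln of lexpr & nat
  | LScale of F & lexpr.

Fixpoint leval (env : seq M) e : M :=
  match e with
  | LVar n => env`_n
  | LZero => 0
  | LAdd e1 e2 => leval env e1 + leval env e2
  | LOpp e1 => - leval env e1
  | LMuln e1 n => leval env e1 *+ n
  | LScale k e1 => k *: leval env e1
  end.

Fixpoint lcoef i e : F :=
  match e with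
  | LVar n => if eqn n i then 1 else 0
  | LZero => 0
  | LAdd e1 e2 => lcoef i e1 + lcoef i e2
  | LOpp e1 => - lcoef i e1
  | LMuln e1 n => lcoef i e1 *+ n
  | LScale k e1 => k * lcoef i e1
  end.

Fixpoint same_coefs n e1 e2 : Prop :=
  if n is i.+1 then lcoef i e1 = lcoef i e2 /\ same_coefs i e1 e2 else True.

Lemma leval_lcoef env e :
  leval env e = \sum_(i < size env) lcoef i e *: env`_i.
Proof.
elim: e => /= [n||e1 -> e2 ->|e ->|e -> n|k e ->].
- have [n_lt|n_ge] := ltnP n (size env).
    rewrite (bigD1 (Ordinal n_lt)) //= eqnE eqxx scale1r big1 ?addr0 // => i ne.
    by rewrite eq_sym (_ : (i == n :> nat) = false) ?scale0r //; apply: negbTE ne.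
  rewrite nth_default // big1 // => i _; rewrite eqnE gtn_eqF ?scale0r //.
  exact: leq_trans (ltn_ord i) n_ge.
- by rewrite big1 // => i _; rewrite scale0r.
- by rewrite -big_split; apply: eq_bigr => i _; rewrite scalerDl.
- by rewrite -sumrN; apply: eq_bigr => i _; rewrite scaleNr.
- by rewrite -sumrMnl; apply: eq_bigr => i _; rewrite scalerMnl.
- by rewrite scaler_sumr; apply: eq_bigr => i _; rewrite scalerA.
Qed.

Lemma leval_eq env e1 e2 : same_coefs (size env) e1 e2 -> leval env e1 = leval env e2.
Proof.
move=> e12; rewrite !leval_lcoef; apply: eq_bigr => -[i /= i_lt] _; congr (_ *: _).
elim: (size env) i_lt e12 => //= n IHn; rewrite ltnS leq_eqVlt => /predU1P[-> []//|].
by move=> /IHn i_lt [_ /i_lt].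
Qed.

End LinearIdentities.

Ltac lmod_index x env :=
  lazymatch env with
  | x :: _ => constr:(0%N)
  | _ :: ?env' => let n := lmod_index x env' in constr:(n.+1)
  end.

Ltac lmod_add x env :=
  let rec mem e :=
    lazymatch e with
    | x :: _ => constr:(true)
    | _ :: ?e' => mem e'
    | _ => constr:(false)
    end in
  lazymatch mem env with
  | true => env
  | false => constr:(x :: env)
  end.

Ltac lmod_atoms t env :=
  lazymatch t with
  | @Algebra.add _ ?a ?b => let env' := lmod_atoms a env in lmod_atoms b env'
  | @Algebra.opp _ ?a => lmod_atoms a env
  | @Algebra.natmul _ ?a _ => lmod_atoms a env
  | @GRing.scale _ _ _ ?a => lmod_atoms a env
  | @Algebra.zero _ => env
  | _ => lmod_add t env
  end.

Ltac lmod_reify F t env :=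
  lazymatch t with
  | @Algebra.add _ ?a ?b =>
      let a' := lmod_reify F a env in let b' := lmod_reify F b env in
      constr:(@LAdd F a' b')
  | @Algebra.opp _ ?a => let a' := lmod_reify F a env in constr:(@LOpp F a')
  | @Algebra.natmul _ ?a ?n => let a' := lmod_reify F a env in constr:(@LMuln F a' n)
  | @GRing.scale _ _ ?k ?a => let a' := lmod_reify F a env in constr:(@LScale F k a')
  | @Algebra.zero _ => constr:(@LZero F)
  | _ => let n := lmod_index t env in constr:(@LVar F n)
  end.

(** A linear identity in a module over [F] follows from one equation in [F] for
    each atom, which [ring] or [field] can settle. *)
Ltac lmod F M :=
  lazymatch goal with
  | |- ?s = ?t =>
      let env0 := constr:(@nil M) in
      let env1 := lmod_atoms s env0 in
      let env := lmod_atoms t env1 in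
      let s' := lmod_reify F s env in
      let t' := lmod_reify F t env in
      apply: (@leval_eq F M env s' t');
      cbn [size same_coefs lcoef eqn]; repeat split
  end.

(** * The brackets of the N=4 algebra from those of its even generators *)

Section N4Brackets.
Variables (F : numFieldType) (L : susyLCA F).
Local Notation S := (Sop L).

(** In the Jacobi identity for [P], [P], [Q] the inner bracket [[P_Lambda P]] has the
    constant term [- H], so that [[H_Lambda Q]] is expressed by brackets of the even
    vectors. *)
Lemma br_HJ (P Q R H : L) : par false P ->
  (br P P)@_one_mon = - H ->
  br P Q = pol4 (- S R) (- (R *+ 2)) 0 0 ->
  br P R = pol4 (S Q) (Q *+ 2) 0 0 ->
  br H Q = pol4 (S (S Q) *+ 2) (S Q) (Q *+ 2) 0.
Proof.
move=> P_even PP PQ PR.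
have HQ m : (br H Q)@_m = sg m.2 (br P (br P Q)@_m)@_one_mon - (br P (S R))@_m.
  have PQ0 : (br P Q)@_one_mon = - S R by rewrite PQ mcoeff_pol4.
  have := jacobi_Lambda0 Q m P_even P_even.
  rewrite PP PQ0 brNl brNr /= andbT => ->.
  by rewrite -> !mcoeffN; rewrite !opprK addrK.
have PR2 : (br P (- (R *+ 2)))@_one_mon = - (S Q *+ 2).
  by rewrite brNr brMnr; rewrite -> mcoeffN, mcoeffMn; rewrite PR mcoeff_pol4.
have PSR n e := mcoeff_br_Sr R n e P_even.
apply: pol4P => [||||n e]; rewrite HQ PSR PR PQ !mcoeff_pol4 /=.
- rewrite brNr; rewrite -> mcoeffN; rewrite PSR PR !mcoeff_pol4 /=.
  by lmod F L; ring.
- by rewrite PR2 !SopMn; lmod F L; ring.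
- by rewrite br0r mcoeff0 Sop0; lmod F L; ring.
- by rewrite br0r mcoeff0 Sop0; lmod F L; ring.
by rewrite br0r mcoeff0 sg0; case: e; case: n => [|n]; rewrite ?Sop0; lmod F L; ring.
Qed.

Lemma br_JH (Q H : L) : par false Q -> par true H ->
  br H Q = pol4 (S (S Q) *+ 2) (S Q) (Q *+ 2) 0 ->
  br Q H = pol4 (- S (S Q)) (- S Q) (- (Q *+ 2)) 0.
Proof.
move=> Qe Ho HQ; rewrite (br_skew_pol4 Qe Ho HQ) /=; congr pol4.
by rewrite !SopMn; lmod F L; ring.
Qed.

(** The same argument for [P], [P], [H]; the central term of [[H_Lambda H]] is
    [- lambda] times that of [[P_Lambda P]], because of the factor
    [(S + chi)^2 = T + lambda] of [[P_Lambda T P]]. *)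
Lemma br_HH (P H one : L) (k : F) : par false P -> par true H -> S one = 0 ->
  br P P = pol4 (- H) 0 0 (- (k *: one)) ->
  br P H = pol4 (- S (S P)) (- S P) (- (P *+ 2)) 0 ->
  forall m, (br H H)@_m = match m with
    | (0, false) => S (S H) *+ 2 | (0, true) => S H | (1, false) => H *+ 3
    | (2, true) => k *: one | _ => 0%R end%N.
Proof.
move=> P_even Ho S1 PP PH.
have HH m : (br H H)@_m =
    sg m.2 (br P (br P H)@_m)@_one_mon - (br P (S (S P)))@_m.
  have PP0 : (br P P)@_one_mon = - H by rewrite PP mcoeff_pol4.
  have PH0 : (br P H)@_one_mon = - S (S P) by rewrite PH mcoeff_pol4.
  have := jacobi_Lambda0 H m P_even P_even.
  rewrite PP0 PH0 brNl brNr /= andbT => ->.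
  by rewrite -> !mcoeffN; rewrite !opprK addrK.
have PS u n e := mcoeff_br_Sr u n e P_even.
have PP00 : (br P P)@_one_mon = - H by rewrite PP mcoeff_pol4.
have PSP : (br P (- S P))@_one_mon = - S H.
  by rewrite brNr; rewrite -> mcoeffN; rewrite PS PP00 /= SopN addr0 opprK.
have P2P : (br P (- (P *+ 2)))@_one_mon = H *+ 2.
  rewrite brNr brMnr; rewrite -> mcoeffN, mcoeffMn; rewrite PP00.
  by lmod F L; ring.
have PSSP : (br P (- S (S P)))@_one_mon = S (S H).
  rewrite brNr; rewrite -> mcoeffN; rewrite !PS PP00 /= !addr0 !SopN.
  by rewrite !opprK.
case=> [[|[|[|n]]] []]; rewrite HH PH mcoeff_pol4 ?PSP ?P2P ?PSSP !PS PP !mcoeff_pol4 /=.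
all: by rewrite ?br0r ?mcoeff0 !SopE ?S1 ?scaler0 ?SopE; lmod F L; ring.
Qed.

End N4Brackets.

(** * Morphisms out of a freely generated SUSY Lie conformal algebra *)

Section Central.
Variables (F : numFieldType) (L : susyLCA F).
Local Notation S := (Sop L).

(** As [[S one_Lambda v] = chi [one_Lambda v]] and [chi] is injective, an element
    killed by [S] is central. *)
Lemma br_centrall (one v : L) : S one = 0 -> br one v = 0.
Proof.
move=> S1; have S1v m : (br (S one) v)@_m = 0 by rewrite S1 br0l mcoeff0.
apply/malgP => -[n []]; rewrite mcoeff0.
  by have := S1v (n.+1, false); rewrite mcoeff_br_Sl => /eqP; rewrite oppr_eq0 => /eqP.
by have := S1v (n, true); rewrite mcoeff_br_Sl.
Qed.

Lemma br_centralr (one v : L) p : par p one -> S one = 0 -> br v one = 0.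
Proof.
move=> one_par S1; have hom pw w : par pw w -> br w one = 0.
  move=> w_par; rewrite (br_skew w_par one_par) br_centrall // /evalL /lin_ext.
  by rewrite msupp0 big_nil sg0.
have [v0 [v1 [v0_par v1_par ->]]] := par_decomp v.
by rewrite brDl (hom _ _ v0_par) (hom _ _ v1_par) addr0.
Qed.

End Central.

Section Combinations.
Variables (F : numFieldType) (L : susyLCA F) (I : finType).
Local Notation S := (Sop L).
Implicit Types (p : {poly F}) (v one : L) (X : I -> L).

Definition Spoly p v : L := \sum_(n < size p) p`_n *: iter n S v.

Lemma Spoly_wide N p v : (size p <= N)%N ->
  Spoly p v = \sum_(n < N) p`_n *: iter n S v.
Proof.
move=> pN; rewrite /Spoly (big_ord_widen N (fun n => p`_n *: iter n S v) pN).
rewrite [LHS]big_mkcond; apply: eq_bigr => n _.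
by case: ltnP => // /(nth_default 0) ->; rewrite scale0r.
Qed.

Lemma Spoly_linear v : linear (Spoly^~ v).
Proof.
move=> a p q; pose N := maxn (size p) (size q).
have pN : (size p <= N)%N by apply: leq_maxl.
have qN : (size q <= N)%N by apply: leq_maxr.
have rN : (size (a *: p + q)%R <= N)%N.
  apply: leq_trans (size_polyD _ _) _; rewrite geq_max qN andbT.
  exact: leq_trans (size_scale_leq _ _) pN.
rewrite (Spoly_wide v pN) (Spoly_wide v qN) (Spoly_wide v rN) scaler_sumr -big_split.
by apply: eq_bigr => n _; rewrite coefD coefZ scalerDl scalerA.
Qed.

Lemma SpolyMX p v : Spoly (p * 'X) v = S (Spoly p v).
Proof.
have pX : (size (p * 'X)%R <= (size p).+1)%N.
  by apply: leq_trans (size_polyMleq _ _) _; rewrite size_polyX addn2.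
rewrite (Spoly_wide v pX) big_ord_recl coefMX scale0r add0r linear_sum.
by apply: eq_bigr => n _; rewrite coefMX /= linearZ.
Qed.

Definition lcomb X one (q : {ffun I -> {poly F}} * F) : L :=
  \sum_i Spoly (q.1 i) (X i) + q.2 *: one.

Lemma lcomb_linear X one a q r :
  lcomb X one (a *: q.1 + r.1, a * q.2 + r.2) = a *: lcomb X one q + lcomb X one r.
Proof.
rewrite /lcomb scalerDr addrACA scaler_sumr -big_split; congr (_ + _).
  by apply: eq_bigr => i _; rewrite /= !ffunE Spoly_linear.
by rewrite scalerA -scalerDl.
Qed.

Lemma S_lcomb X one q : S one = 0 ->
  S (lcomb X one q) = lcomb X one ([ffun i => q.1 i * 'X], 0).
Proof.
move=> S1; rewrite /lcomb SopD SopZ S1 scaler0 scale0r linear_sum; congr (_ + _).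
by apply: eq_bigr => i _; rewrite ffunE SpolyMX.
Qed.

Lemma lcomb_gen X one i : lcomb X one ([ffun j => (j == i)%:R%:P], 0) = X i.
Proof.
rewrite /lcomb scale0r addr0 (bigD1 i) //= big1 ?addr0 => [|j ji]; last first.
  by rewrite ffunE (negPf ji) /Spoly size_poly0 big_ord0.
by rewrite ffunE eqxx /Spoly size_polyC oner_eq0 big_ord1 coefC scale1r.
Qed.

Lemma lcomb_one X one : lcomb X one (0, 1) = one.
Proof.
rewrite /lcomb scale1r big1 ?add0r // => i _.
by rewrite ffunE /Spoly size_poly0 big_ord0.
Qed.

Lemma generated_ind X one (P : L -> Prop) :
  freely_generated X one -> P one -> (forall i, P (X i)) ->
  (forall a u v, P u -> P v -> P (a *: u + v)) -> (forall v, P v -> P (S v)) ->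
  forall v, P v.
Proof.
case=> _ _ [g _ gK] P1 PX Plin PS v; rewrite -(gK v).
have P0 : P 0 by rewrite -(addNr one) -scaleN1r; apply: Plin.
have PD u w : P u -> P w -> P (u + w) by move=> ? ?; rewrite -[u]scale1r; apply: Plin.
have PZ a u : P u -> P (a *: u) by move=> ?; rewrite -[_ *: u]addr0; apply: Plin.
apply: (PD _ _); last exact: (PZ _ _); apply: (big_ind P P0 PD) => i _.
apply: (big_ind P P0 PD) => n _; apply: PZ.
by elim: (n : nat) => //= k; apply: PS.
Qed.

End Combinations.

Section Extension.
Variables (F : numFieldType) (A B : susyLCA F) (I : finType).
Variables (X : I -> A) (oneA : A) (Y : I -> B) (oneB : B) (pX : I -> bool).
Hypothesis A_free : freely_generated X oneA.
Hypotheses (X_par : forall i, par (pX i) (X i)) (Y_par : forall i, par (pX i) (Y i)).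
Hypotheses (oneB_even : par false oneB) (S_oneB : Sop B oneB = 0).
Local Notation SA := (Sop A).
Local Notation SB := (Sop B).

(** By freeness the coefficients over [C[S]] of an element are well defined, and
    can be used for other generators. *)
Lemma linear_extension : exists f : A -> B,
  [/\ linear f, forall v, f (SA v) = SB (f v), forall i, f (X i) = Y i
    & f oneA = oneB].
Proof.
have [_ S1 [g gK Kg]] := A_free.
have lA (q : {ffun I -> {poly F}} * F) : \sum_i \sum_(n < size (q.1 i)) (q.1 i)`_n *: iter n SA (X i) + q.2 *: oneA
  = lcomb X oneA q by [].
have gl q : g (lcomb X oneA q) = q by rewrite -lA gK.
have lg v : lcomb X oneA (g v) = v by rewrite -lA Kg.
exists (fun v => lcomb Y oneB (g v)); split=> [a u v|v|i|].
- by rewrite -lcomb_linear; congr lcomb; rewrite -{1}[u]lg -{1}[v]lg -lcomb_linear gl.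
- by rewrite S_lcomb //; congr lcomb; rewrite -{1}[v]lg S_lcomb // gl.
- by rewrite -(lcomb_gen X oneA i) gl lcomb_gen.
- by rewrite -[oneA](lcomb_one X oneA) gl lcomb_one.
Qed.

Variable f : A -> B.
Hypotheses (f_lin : linear f) (fS : forall v, f (SA v) = SB (f v)).
Hypotheses (fX : forall i, f (X i) = Y i) (f1 : f oneA = oneB).
Hypothesis f_br : forall i j m, (br (Y i) (Y j))@_m = f (br (X i) (X j))@_m.

Let f0 : f 0 = 0.
Proof. by have := f_lin (-1) 0 0; rewrite scaler0 addr0 scaleN1r addNr. Qed.
Let fD u v : f (u + v) = f u + f v.
Proof. by rewrite -{1}[u]scale1r f_lin scale1r. Qed.
Let fN u : f (- u) = - f u.
Proof. by apply/eqP; rewrite -subr_eq0 opprK -fD addNr f0. Qed.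
Let f_sg b u : f (sg b u) = sg b (f u).
Proof. by case: b; rewrite /= ?fN. Qed.

(** An element splits into homogeneous parts with homogeneous images; by
    uniqueness of the parts, [f] preserves the parity. *)
Lemma extension_par p v : par p v -> par p (f v).
Proof.
have split : forall v, exists v0 v1, [/\ par false v0, par true v1, v = v0 + v1,
    par false (f v0) & par true (f v1)].
  have [one_even _ _] := A_free.
  apply: (generated_ind A_free) => [|i|a u w [u0 [u1 [? ? -> ? ?]]] [w0 [w1 [? ? -> ? ?]]]|
      u [u0 [u1 [? ? -> ? ?]]]].
  - by exists oneA, 0; split; rewrite ?addr0 ?f0 ?f1 //; apply: par0.
  - have := X_par i; have := Y_par i; case: (pX i) => YP XP.
      by exists 0, (X i); split; rewrite ?add0r ?f0 ?fX //; apply: par0.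
    by exists (X i), 0; split; rewrite ?addr0 ?f0 ?fX //; apply: par0.
  - exists (a *: u0 + w0), (a *: u1 + w1); split; rewrite ?f_lin; try exact: par_lin.
    by rewrite scalerDr addrACA.
  - exists (SA u1), (SA u0); split; rewrite ?fS; try exact: (Sop_odd (p := true));
      try exact: (Sop_odd (p := false)).
    by rewrite linearD addrC.
have [v0 [v1 [v0e v1o -> f0e f1o]]] := split v.
case: p => v_par.
  suff -> : v0 = 0 by rewrite add0r.
  by apply: par_direct => //; rewrite -[v0](addrK v1); apply: parD => //; apply: parN.
suff -> : v1 = 0 by rewrite addr0.
apply: par_direct => //; rewrite -[v1](addKr v0); apply: parD => //; exact: parN.
Qed.

(** Brackets of arbitrary elements are determined by those of the generators,
    by sesquilinearity; the central element contributes nothing. *)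
Lemma extension_lca_hom : lca_hom f.
Proof.
have [one_even S1 _] := A_free.
split=> //; first exact: extension_par.
apply: (generated_ind A_free) => [|i|a u w fu fw|u fu].
- by move=> v m; rewrite f1 !br_centrall // !mcoeff0 f0.
- apply: (generated_ind A_free) => [|j|a u w fu fw|u fu] m.
  + by rewrite f1 (br_centralr _ oneB_even) ?(br_centralr _ one_even) // !mcoeff0 f0.
  + by rewrite !fX f_br.
  + by rewrite f_lin !br_linr f_lin fu fw.
  + case: m => n e; rewrite fS fX (mcoeff_br_Sr _ _ _ (Y_par i)) (mcoeff_br_Sr _ _ _ (X_par i)).
    rewrite f_sg -fX !fu; congr sg; case: e; first by rewrite fD fN fS.
    by case: n => [|n]; rewrite !fD fS ?fu ?f0.
- by move=> v m; rewrite f_lin !br_linl f_lin fu fw.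
- move=> v [n e]; rewrite fS !mcoeff_br_Sl !fu.
  by case: e; rewrite ?fu //; case: n => [|n]; rewrite ?f0 ?fN ?fu.
Qed.

End Extension.

(** * Injectivity of morphisms *)

Section Degree.
Variable V : zmodType.
Implicit Types p : LPoly V.

(** As [chi^2 = - lambda], the monomials are the powers of [chi] up to sign. *)
Definition mon_of_deg k : mon := (k./2, odd k).

Lemma mcoeff_chi_deg p k :
  (chi p)@_(mon_of_deg k.+1) = sg (odd k) p@_(mon_of_deg k).
Proof.
rewrite /mon_of_deg mcoeff_chi /= uphalf_half.
by case: (odd k); rewrite ?add0n ?add1n.
Qed.

Lemma mcoeff_iter_chi_deg n k : exists b, forall p,
  (iter n (@chi V) p)@_(mon_of_deg (n + k)) = sg b p@_(mon_of_deg k).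
Proof.
elim: n => [|n [b IHn]]; first by exists false.
exists (odd (n + k) (+) b) => p; rewrite addSn /= mcoeff_chi_deg IHn.
by case: (odd _); case: b {IHn}; rewrite /= ?opprK.
Qed.

End Degree.

Section Injectivity.
Variables (F : numFieldType) (A B : susyLCA F) (I : finType).
Variables (X : I -> A) (one : A).
Hypothesis A_free : freely_generated X one.

Lemma linear_lcomb (W : lmodType F) (g : A -> W) q : linear g ->
  g (lcomb X one q) =
  \sum_i \sum_(n < size (q.1 i)) (q.1 i)`_n *: g (iter n (Sop A) (X i)) + q.2 *: g one.
Proof.
move=> g_lin; have g0 : g 0 = 0.
  by have := g_lin (-1) 0 0; rewrite scaler0 addr0 scaleN1r addNr.
have gD u v : g (u + v) = g u + g v by rewrite -{1}[u]scale1r g_lin scale1r.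
have gZ a u : g (a *: u) = a *: g u by rewrite -[_ *: u]addr0 g_lin g0 addr0.
rewrite /lcomb gD gZ (big_morph g gD g0); congr (_ + _); apply: eq_bigr => i _.
by rewrite /Spoly (big_morph g gD g0); apply: eq_bigr => n _; rewrite gZ.
Qed.

Variable d : I -> nat.
Hypothesis d_gt2 : forall i, (2 < d i)%N.
Hypothesis br_top : forall i, exists2 z, z != 0 &
  (br (X i) (X i))@_(mon_of_deg (d i)) = z *: one.
Hypothesis br_diag : forall i k, (d i < k)%N ->
  (br (X i) (X i))@_(mon_of_deg k) = 0.
Hypothesis br_offdiag : forall i j k, i != j -> (2 < k)%N ->
  (br (X i) (X j))@_(mon_of_deg k) = 0.

(** The kernel of a morphism is an ideal.  If it contained an element involving the
    generators, then bracketing it with a generator whose coefficient has the highest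
    degree over [C[S]] would give a polynomial whose leading coefficient is a nonzero
    multiple of the central element, which would therefore be killed as well. *)
Lemma lca_hom_inj (f : A -> B) : lca_hom f -> f one != 0 -> injective f.
Proof.
case=> f_lin _ fS f_br f1_neq0.
have f0 : f 0 = 0 by have := f_lin (-1) 0 0; rewrite scaler0 addr0 scaleN1r addNr.
have fZ a u : f (a *: u) = a *: f u by rewrite -[_ *: u]addr0 f_lin f0 addr0.
suff ker0 r : f r = 0 -> r = 0.
  move=> r s frs; apply/eqP; rewrite -subr_eq0; apply/eqP/ker0.
  by rewrite addrC -scaleN1r f_lin frs scaleN1r addNr.
have [_ S1 [g _ gK]] := A_free.
rewrite -(gK r); set q : {ffun I -> {poly F}} * F := g r; move: q => q fq0.
have {}fq0 : f (lcomb X one q) = 0 by [].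
change (lcomb X one q = 0).
pose N := (\max_i size (q.1 i))%N.
have q_le i : (size (q.1 i) <= N)%N by apply: leq_bigmax.
have [N0|N_gt0] := posnP N.
  have q10 i : Spoly (q.1 i) (X i) = 0.
    by rewrite /Spoly; move: (q_le i); rewrite N0 leqn0 => /eqP->; rewrite big_ord0.
  move: fq0; rewrite /lcomb big1 // add0r fZ => /eqP.
  by rewrite scaler_eq0 (negPf f1_neq0) orbF => /eqP->; rewrite scale0r.
have [|i qiN] := @bigop.eq_bigmax I (fun i => size (q.1 i)).
  rewrite lt0n; apply: contraTneq N_gt0 => /card0_eq I0.
  by rewrite -eqn0Ngt /N big_pred0.
rewrite -/N in qiN.
have [z z_neq0 top_z] := br_top i.
(* Sizes exceed degrees by one: [N.-1] is the largest degree over [C[S]]. *)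
pose m := mon_of_deg (N.-1 + d i).
have lead : exists2 c, c != 0 & (br (lcomb X one q) (X i))@_m = c *: one.
  have [b chi_b] := mcoeff_iter_chi_deg A N.-1 (d i).
  exists ((q.1 i)`_N.-1 * (sg b z)).
    rewrite mulf_neq0 //; last by case: (b); rewrite /= ?oppr_eq0.
    by rewrite qiN -/(lead_coef _) lead_coef_eq0 -size_poly_gt0 -qiN.
  have br_lin : linear (fun u => (br u (X i))@_m) := br_linl (X i) m.
  rewrite (linear_lcomb q br_lin) br_centrall // mcoeff0 scaler0 addr0.
  have br_iter n j : br (iter n (Sop A) (X j)) (X i) = iter n (@chi A) (br (X j) (X i)).
    by elim: n => //= n <-; rewrite br_Sl.
  have drop n j : (n < N)%N -> (j != i) || (n < N.-1)%N ->
      (iter n (@chi A) (br (X j) (X i)))@_m = 0.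
    move=> n_lt jn; pose k := (N.-1 + d i - n)%N.
    have n_le : (n <= N.-1)%N by rewrite -ltnS prednK.
    have mk : (N.-1 + d i = n + k)%N by rewrite subnKC // (leq_trans n_le) ?leq_addr.
    have k_ge : (d i <= k)%N by rewrite /k -addnBAC // leq_addl.
    have [b' ->] : exists b', (iter n (@chi A) (br (X j) (X i)))@_m
        = sg b' (br (X j) (X i))@_(mon_of_deg k).
      by have [b' E] := mcoeff_iter_chi_deg A n k; exists b'; rewrite /m mk E.
    case: eqVneq jn => [-> /= n_ltN|ji _]; last first.
      by rewrite br_offdiag ?sg0 //; apply: leq_trans k_ge.
    rewrite br_diag ?sg0 //.
    by rewrite /k -addnBAC // -[X in (X < _)%N]add0n ltn_add2r subn_gt0.
  rewrite (bigD1 i) //= [X in _ + X]big1 ?addr0 => [|j ji]; last first.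
    apply: big1 => n _; rewrite br_iter drop ?ji ?scaler0 //.
    exact: leq_trans (ltn_ord n) (q_le j).
  rewrite -qiN -(prednK N_gt0) big_ord_recr /= big1 ?add0r => [|n _]; last first.
    by rewrite br_iter drop ?scaler0 ?ltn_ord ?orbT // (leq_trans (ltn_ord n)) ?leq_pred.
  rewrite br_iter chi_b top_z -scalerA; congr (_ *: _).
  by case: (b); rewrite /= ?scaleNr.
have [c c_neq0 c_one] := lead.
have := f_br (lcomb X one q) (X i) m; rewrite fq0 br0l mcoeff0 c_one fZ => /esym/eqP.
by rewrite scaler_eq0 (negPf c_neq0) (negPf f1_neq0).
Qed.

End Injectivity.

(** * Realizations of the N=4 algebra *)

Section N4Algebra.
Variables (F : numFieldType) (L : susyLCA F) (k : F) (one H : L) (J : 'I_3 -> L).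
Local Notation S := (Sop L).

Definition Jcross (i j : 'I_3) : L := \sum_(l < 3) levi_civita F i j l *: J l.

(** With [c = 3 k], the relations of the N=4 algebra that do not involve brackets
    with [H]. *)
Definition JJ_brackets : Prop :=
  (forall i, br (J i) (J i) = pol4 (- H) 0 0 (- (k *: one))) /\
  (forall i j, i != j -> br (J i) (J j) = pol4 (- S (Jcross i j)) (- (Jcross i j *+ 2)) 0 0).

Definition H_brackets : Prop :=
  [/\ forall i, br H (J i) = pol4 (S (S (J i)) *+ 2) (S (J i)) (J i *+ 2) 0,
      forall i, br (J i) H = pol4 (- S (S (J i))) (- S (J i)) (- (J i *+ 2)) 0
    & forall m, (br H H)@_m = match m with
        | (0, false) => S (S H) *+ 2 | (0, true) => S H | (1, false) => H *+ 3
        | (2, true) => k *: one | _ => 0%R end%N].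

(** Every generator is the middle term of an oriented triple, which is what [br_HJ]
    asks for. *)
Lemma Jcross_next (j : 'I_3) : exists i l, [/\ i != j, i != l,
  Jcross i j = J l & Jcross i l = - J j].
Proof.
have sum3 (G : 'I_3 -> L) : \sum_(l < 3) G l = G 0 + G 1 + G 2.
  by rewrite !big_ord_recl big_ord0 addr0 addrA; congr (_ + G _ + G _); apply: val_inj.
have cases : [\/ j = 0, j = 1 | j = 2].
  by case: j => [[|[|[|j]]]] // ?; [apply: Or31|apply: Or32|apply: Or33]; apply: val_inj.
case: cases => ->; [exists 2, 1|exists 0, 2|exists 1, 0]; split=> //;
  by rewrite /Jcross sum3 /levi_civita /= ?scale0r ?scale1r ?scaleN1r ?addr0 ?add0r.
Qed.

Lemma JJ_H_brackets : (forall i, par false (J i)) -> par true H -> S one = 0 ->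
  JJ_brackets -> H_brackets.
Proof.
move=> J_even H_odd S1 [JJ JK].
have HJ i : br H (J i) = pol4 (S (S (J i)) *+ 2) (S (J i)) (J i *+ 2) 0.
  have [p [r [pi pr Jpi Jpr]]] := Jcross_next i.
  apply: (br_HJ (J_even p)) (JK p i pi) _; first by rewrite JJ mcoeff_pol4.
  by rewrite Jpi JK // Jpr SopN mulNrn !opprK.
have JH i := br_JH (J_even i) H_odd (HJ i).
split=> //; exact: (br_HH (J_even 0) H_odd S1 (JJ 0) (JH 0)).
Qed.

Lemma Sact_cstL (v : L) : Sact S (cstL v) = cstL (S v).
Proof.
apply/malgP => -[n e]; rewrite mcoeff_Sact !mcoeff_cstL.
by case: e; case: n => [|n]; rewrite ?mcoeff_cstL ?xpair_eqE /= ?andbF ?mulr0n ?mulr1n ?Sop0 ?mul0rn ?addr0 ?oppr0.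
Qed.

Lemma N4_LCA_JJ_brackets : N4_LCA (k * 3%:R) one H J -> JJ_brackets.
Proof.
case=> _ N2 JK _; split=> [i|i j ij].
  have [-> _ _] := N2 i; rewrite mulfK ?pnatr_eq0 //.
  apply/malgP => -[n e]; rewrite mcoeff_pol4.
  rewrite -> mcoeffN, mcoeffD; rewrite mcoeff_lam mcoeff_cstL.
  by case: e; case: n => [|[|n]]; rewrite ?mcoeff_chi ?mcoeff_cstL /= ?xpair_eqE /= ?andbF ?mulr0n ?mulr1n ?addr0 ?add0r ?oppr0.
rewrite JK //; apply/malgP => m; rewrite mcoeff_pol4.
rewrite -> mcoeffN; rewrite (raddf_sum (mcoeff m)) /=.
pose g (m : mon) (v : L) := match m with (0, false) => S v | (0, true) => v *+ 2 | _ => 0%R end%N.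
have gD : zmod_morphism (g m).
  by case: (m) => [[|n] []] u v; rewrite /g ?subr0 ?mulrnBl ?linearB.
have E (l : 'I_3) : (Sact S (cstL (levi_civita F i j l *: J l))
    + chi (cstL (levi_civita F i j l *: J l)) *+ 2)@_m = g m (levi_civita F i j l *: J l).
  rewrite /g; case: (m) => n e; rewrite Sact_cstL; rewrite -> mcoeffD, mcoeffMn.
  rewrite mcoeff_chi !mcoeff_cstL.
  by case: e; case: n => [|[|n]]; rewrite /= ?mcoeff_cstL ?xpair_eqE /= ?andbF ?mulr0n ?oppr0 ?mul0rn ?mulr1n ?addr0 ?add0r.
under eq_bigr => l _ do rewrite E.
pose ga : {additive L -> L} := HB.pack (g m) (GRing.isZmodMorphism.Build _ _ (g m) gD).
rewrite -(raddf_sum ga) /= /g -/(Jcross i j).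
by case: (m) => [[|[|n]] []]; rewrite ?oppr0.
Qed.

End N4Algebra.

Section N4Embedding.
Variables (F : numFieldType) (B V : susyLCA F) (k : F).
Variables (oneB HB : B) (JB : 'I_3 -> B) (oneV HV : V) (JV : 'I_3 -> V).
Hypothesis k_neq0 : k != 0.
Hypothesis B_N4 : N4_LCA (k * 3%:R) oneB HB JB.
Hypotheses (oneV_even : par false oneV) (S_oneV : Sop V oneV = 0) (oneV_neq0 : oneV != 0).
Hypotheses (HV_odd : par true HV) (JV_even : forall i, par false (JV i)).
Hypothesis V_JJ : JJ_brackets k oneV HV JV.

(** It suffices to know the brackets of the even vectors: the other ones follow in
    both algebras.  Injectivity uses [c <> 0], the leading coefficients of
    [[H_Lambda H]] and [[J^i_Lambda J^i]] being multiples of [c]. *)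
Lemma N4_embedding : exists f : B -> V,
  [/\ lca_hom f, f oneB = oneV, f HB = HV, forall i, f (JB i) = JV i & injective f].
Proof.
have B_JJ := N4_LCA_JJ_brackets B_N4.
have [[HB_odd JB_even] _ _ B_free] := B_N4.
have [_ S_oneB _] := B_free.
have B_H := JJ_H_brackets JB_even HB_odd S_oneB B_JJ.
have V_H := JJ_H_brackets JV_even HV_odd S_oneV V_JJ.
have [BJJ BJK] := B_JJ; have [VJJ VJK] := V_JJ.
have [BHJ BJH BHH] := B_H; have [VHJ VJH VHH] := V_H.
pose X o := if o is Some i then JB i else HB.
pose Y o := if o is Some i then JV i else HV.
have [f [f_lin fS fX f1]] := linear_extension Y B_free S_oneV.
have fH : f HB = HV := fX None.
have fJ i : f (JB i) = JV i := fX (Some i).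
have f0 : f 0 = 0 by have := f_lin (-1) 0 0; rewrite scaler0 addr0 scaleN1r addNr.
have fD u v : f (u + v) = f u + f v by rewrite -{1}[u]scale1r f_lin scale1r.
have fZ a u : f (a *: u) = a *: f u by rewrite -[_ *: u]addr0 f_lin f0 addr0.
have fN u : f (- u) = - f u by rewrite -!scaleN1r fZ.
have fMn u n : f (u *+ n) = f u *+ n by rewrite -!scaler_nat fZ.
have fcross i j : f (Jcross JB i j) = Jcross JV i j.
  rewrite /Jcross (big_morph f fD f0); apply: eq_bigr => l _.
  by rewrite fZ fJ.
have f_hom : lca_hom f.
  apply: (@extension_lca_hom _ B V _ X oneB Y oneV (fun o => o == None)) => //.
  - by case=> [i|]; [apply: JB_even|apply: HB_odd].
  - by case=> [i|]; [apply: JV_even|apply: HV_odd].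
  - case=> [i|] [j|] m; rewrite /X /Y.
    + have [->|ij] := eqVneq i j.
        rewrite BJJ VJJ !mcoeff_pol4.
        by case: m => [[|[|n]] []]; rewrite ?fN ?fZ ?f0 ?f1 ?fH.
      rewrite BJK // VJK // !mcoeff_pol4.
      by case: m => [[|[|n]] []]; rewrite ?fN ?fMn ?fS ?f0 ?fcross.
    + rewrite BJH VJH !mcoeff_pol4.
      by case: m => [[|[|n]] []]; rewrite ?fN ?fMn ?fS ?f0 ?fJ.
    + rewrite BHJ VHJ !mcoeff_pol4.
      by case: m => [[|[|n]] []]; rewrite ?fN ?fMn ?fS ?f0 ?fJ.
    + rewrite BHH VHH.
      by case: m => [[|[|[|n]]] []]; rewrite ?fMn ?fS ?fZ ?f1 ?f0 ?fH.
exists f; split=> //.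
(* The central terms [lambda chi] and [lambda^2 chi] have degrees 3 and 5. *)
apply: (lca_hom_inj B_free (d := fun o => if o is Some _ then 3%N else 5%N)) f_hom _;
  last by rewrite f1.
- by case.
- case=> [i|].
    exists (- k); first by rewrite oppr_eq0.
    by rewrite BJJ mcoeff_pol4 /= scaleNr.
  by exists k; rewrite ?BHH.
- case=> [i|] n n_gt.
    by rewrite BJJ mcoeff_pol4; case: n n_gt => [|[|[|[|n]]]].
  by rewrite BHH; case: n n_gt => [|[|[|[|[|[|n]]]]]].
- case=> [i|] [j|] n //= ij n_gt.
  + by rewrite BJK // mcoeff_pol4; case: n n_gt => [|[|[|[|n]]]].
  + by rewrite BJH mcoeff_pol4; case: n n_gt => [|[|[|[|n]]]].
  + by rewrite BHJ mcoeff_pol4; case: n n_gt => [|[|[|[|n]]]].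
Qed.

End N4Embedding.

(** * The operations of a SUSY vertex algebra by coefficients *)

Section Integral.
Variables (F : numFieldType) (V : lmodType F).
Implicit Types (q : LPoly V) (v : V).

Lemma lam_chi_cstL2 (k m : mon) v :
  iter k.1 (@lam2 V) (iter k.2 (@chi2 V) << v *g (one_mon, m) >>) = << v *g (k, m) >>.
Proof.
case: k => j d /=; have -> : iter d (@chi2 V) << v *g (one_mon, m) >> = << v *g ((0%N, d), m) >>.
  by case: d; rewrite //= /chi2 lin_extU //= => k; rewrite monalgU0 sg0.
elim: j => //= j ->.
by rewrite /lam2 lin_extU // => k; rewrite monalgU0.
Qed.

Lemma gamma_eta_cstL2 (m : mon) v :
  iter m.1 (@gam2 V) (iter m.2 (@eta2 V) (cstL2 v)) = << v *g (one_mon, m) >>.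
Proof.
case: m => j d /=; have -> : iter d (@eta2 V) (cstL2 v) = << v *g (one_mon, (0%N, d)) >>.
  by case: d; rewrite //= /eta2 lin_extU //= => k; rewrite monalgU0 sg0.
elim: j => //= j ->.
by rewrite /gam2 lin_extU // => k; rewrite monalgU0.
Qed.

Lemma int_0Lambda_is_additive : zmod_morphism (@int_0Lambda F V).
Proof.
apply: lin_ext_is_additive => k u v; case: ifP => _; last by rewrite subrr.
by rewrite scalerBr raddfB sg_is_additive.
Qed.
HB.instance Definition _ :=
  GRing.isZmodMorphism.Build _ _ (@int_0Lambda F V) int_0Lambda_is_additive.

Lemma lam2_is_additive : zmod_morphism (@lam2 V).
Proof. by apply: lin_ext_is_additive => k u v; apply: raddfB. Qed.
HB.instance Definition _ := GRing.isZmodMorphism.Build _ _ (@lam2 V) lam2_is_additive.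

Lemma chi2_is_additive : zmod_morphism (@chi2 V).
Proof. by apply: lin_ext_is_additive => k u v; rewrite raddfB sg_is_additive. Qed.
HB.instance Definition _ := GRing.isZmodMorphism.Build _ _ (@chi2 V) chi2_is_additive.

Lemma int_0Lambda_inGamma (k : mon) q :
  int_0Lambda (sg k.2 (iter k.1 (@lam2 V) (iter k.2 (@chi2 V) (inGamma q))))
  = lin_ext (fun (m : mon) v => if m.2 then
      << m.1.+1%:R^-1 *: v *g ((k.1 + m.1.+1)%N, k.2) >> else 0) q.
Proof.
have -> : iter k.1 (@lam2 V) (iter k.2 (@chi2 V) (inGamma q))
    = lin_ext (fun (m : mon) v => << v *g (k, m) >>) q.
  rewrite /inGamma /evalL.
  have -> : iter k.2 (@chi2 V) (lin_ext (fun (m : mon) v => iter m.1 (@gam2 V) (iter m.2 (@eta2 V) (cstL2 v))) q)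
    = lin_ext (fun (m : mon) v => iter k.2 (@chi2 V) << v *g (one_mon, m) >>) q.
    case: (k.2) => /=.
      rewrite (raddf_lin_ext (@chi2 V)); apply: eq_lin_ext => m v /=.
      by rewrite gamma_eta_cstL2.
    by apply: eq_lin_ext => m v; rewrite gamma_eta_cstL2.
  have -> : lin_ext (fun (m : mon) v => << v *g (k, m) >>) q = lin_ext (fun (m : mon) v =>
      iter k.1 (@lam2 V) (iter k.2 (@chi2 V) << v *g (one_mon, m) >>)) q.
    by apply: eq_lin_ext => m v; rewrite lam_chi_cstL2.
  elim: (k.1) => //= j ->; exact: (raddf_lin_ext (@lam2 V)).
rewrite (raddf_sg (@int_0Lambda F V)) (raddf_lin_ext (@int_0Lambda F V)).
have -> : sg k.2 (lin_ext (fun (m : mon) v => int_0Lambda << v *g (k, m) >>) q) 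
  = lin_ext (fun (m : mon) v => sg k.2 (int_0Lambda << v *g (k, m) >>)) q.
  case: (k.2) => //=; exact: (raddf_lin_ext -%R).
apply: eq_lin_ext => m v; rewrite /int_0Lambda lin_extU => [|k' /=]; last first.
  by case: ifP => //; rewrite scaler0 monalgU0 sg0.
by case: (m.2) => /=; case: (k.2) => //=; rewrite ?opprK ?oppr0.
Qed.

(** The integral keeps the terms with [eta] and raises the degree in [gamma] by one;
    moving [d/deta] past [chi] cancels the sign from moving the bracket past it. *)
Lemma mcoeff_int_0Lambda (k : mon) q n e :
  (int_0Lambda (sg k.2 (iter k.1 (@lam2 V) (iter k.2 (@chi2 V) (inGamma q)))))@_(n, e)
  = if (k.1 < n)%N && (k.2 == e)
    then (n - k.1)%:R^-1 *: q@_((n - k.1).-1, true) else 0.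
Proof.
rewrite int_0Lambda_inGamma mcoeff_lin_ext; case: k => j d /=.
case: ifP => [/andP[j_lt /eqP ->]|jn].
  rewrite (@lin_ext1 _ _ _ _ q ((n - j).-1, true)) /=.
  - by rewrite mcoeffU !prednK ?subn_gt0 // subnKC ?eqxx // ltnW.
  - by case=> i []; rewrite ?scaler0 ?monalgU0 mcoeff0.
  - case=> i []; rewrite ?mcoeff0 // => ne; rewrite mcoeffU xpair_eqE eqxx andbT.
    case: eqP => // ijn; case/eqP: ne; congr (_, _).
    by rewrite -ijn addKn.
rewrite lin_ext_eq0 // => -[i []]; rewrite ?mcoeff0 // mcoeffU xpair_eqE.
case: andP => // -[/= /eqP ijn /eqP de]; case/negP: (negbT jn).
by rewrite de eqxx andbT -ijn addnS ltnS leq_addr.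
Qed.

End Integral.

Section VertexAlgebra.
Variables (F : numFieldType) (V : susyVA F).
Local Notation S := (Sop V).
Local Notation vac := (vac V).
Implicit Types (a b c u v w : V).

Lemma nopDl u v w : nop (u + v) w = nop u w + nop v w.
Proof. by have := nop_linl w 1 u v; rewrite !scale1r. Qed.

Lemma nopDr u v w : nop w (u + v) = nop w u + nop w v.
Proof. by have := nop_linr w 1 u v; rewrite !scale1r. Qed.

Lemma nop0l w : nop 0 w = 0.
Proof. by have := nop_linl w (-1) 0 0; rewrite scaler0 addr0 scaleN1r addNr. Qed.

Lemma nop0r w : nop w 0 = 0.
Proof. by have := nop_linr w (-1) 0 0; rewrite scaler0 addr0 scaleN1r addNr. Qed.

Lemma nopZl (k : F) v w : nop (k *: v) w = k *: nop v w.
Proof. by have := nop_linl w k v 0; rewrite nop0l !addr0. Qed.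

Lemma nopZr (k : F) v w : nop w (k *: v) = k *: nop w v.
Proof. by have := nop_linr w k v 0; rewrite nop0r !addr0. Qed.

Lemma nopNl v w : nop (- v) w = - nop v w.
Proof. by rewrite -scaleN1r nopZl scaleN1r. Qed.

Lemma nopNr v w : nop w (- v) = - nop w v.
Proof. by rewrite -scaleN1r nopZr scaleN1r. Qed.

Definition nopE := (nopDl, nopDr, nopZl, nopZr, nopNl, nopNr, nop0l, nop0r,
  nop_vacl, nop_vacr).

Lemma S_vac : S vac = 0.
Proof.
have := nop_S vac (vac_even V); rewrite !(nop_vacl, nop_vacr) /= => E.
by apply: (addrI (S vac)); rewrite addr0 -E.
Qed.

(** In degree [n] the integral term of the Wick formula collects the coefficients of
    [[a_Lambda b]] of smaller degree [j], the other [n - j] powers of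
    [lambda] being produced by the integration. *)
Lemma wick_coef pa pb a b c n e : par pa a -> par pb b ->
  (br a (nop b c))@_(n, e) = nop (br a b)@_(n, e) c
    + sg (~~ pa && pb) (sg (e && pb) (nop b (br a c)@_(n, e)))
    + \sum_(j < n) (n - j)%:R^-1 *: (br (br a b)@_(nat_of_ord j, e) c)@_((n - j).-1, true).
Proof.
move=> pa_a pb_b; rewrite (wick c pa_a pb_b); rewrite -> !mcoeffD; congr (_ + _ + _).
- rewrite mcoeff_lin_ext (@lin_ext1 _ _ _ _ (br a b) (n, e)) ?mcoeffUU // => k.
    by rewrite nop0l monalgU0 mcoeff0.
  by move=> ne; rewrite mcoeffU (negPf ne).
- rewrite mcoeff_sg; congr sg.
  rewrite mcoeff_lin_ext (@lin_ext1 _ _ _ _ (br a c) (n, e)) ?mcoeff_sg ?mcoeffUU // => k.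
    by rewrite mcoeff_sg nop0r monalgU0 mcoeff0 sg0.
  by move=> ne; rewrite mcoeff_sg mcoeffU (negPf ne) sg0.
rewrite /br_l (raddf_lin_ext (@int_0Lambda F V)) mcoeff_lin_ext.
rewrite (@lin_extE _ _ _ _ (br a b) [seq (j, e) | j <- iota 0 n]); first last.
- move=> [j d]; rewrite mcoeff_int_0Lambda; case: ifP => // /andP[/= jn /eqP->].
  by case/negP; apply/mapP; exists j; rewrite // mem_iota.
- by move=> [j d]; rewrite mcoeff_int_0Lambda br0l mcoeff0 scaler0 if_same.
- by rewrite map_inj_uniq ?iota_uniq // => i j [].
rewrite big_map (_ : iota 0 n = index_iota 0 n) ?big_mkord; last first.
  by rewrite /index_iota subn0.
apply: eq_bigr => j _.
by rewrite mcoeff_int_0Lambda /= ltn_ord eqxx.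
Qed.

Lemma iter_SS0 n : iter n (S \o S) 0 = 0.
Proof. by elim: n => //= n ->; rewrite !Sop0. Qed.

Lemma nop_comm pa pb a b u v w : par pa a -> par pb b -> br a b = pol4 u v w 0 ->
  nop a b = sg (pa && pb) (nop b a) + S (S v).
Proof.
move=> pa_a pb_b ab; apply/eqP; rewrite addrC -subr_eq; apply/eqP.
rewrite (quasi_comm pa_a pb_b) ab /int_nabla.
rewrite (@lin_ext1 _ _ _ _ _ (0%N, true)) /=.
- by rewrite mcoeff_pol4 expr1 divr1 opprK scale1r.
- by case=> n [] //=; rewrite iter_SS0 !Sop0 scaler0.
- case=> [n []] // ne; have -> : (pol4 u v w 0)@_(n, true) = 0.
    by rewrite mcoeff_pol4; case: n ne => [|[]].
  by rewrite /= iter_SS0 !Sop0 scaler0.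
Qed.

Lemma int_nop_pol4 a u v w : int_nop S (@nop F V) a (pol4 u v w 0) = nop (S (S a)) v.
Proof.
rewrite /int_nop (@lin_ext1 _ _ _ _ _ (0%N, true)) /=.
- by rewrite mcoeff_pol4 invr1 scale1r.
- by case=> n [] //=; rewrite nop0r scaler0.
- case=> [n []] // ne; have -> : (pol4 u v w 0)@_(n, true) = 0.
    by rewrite mcoeff_pol4; case: n ne => [|[]].
  by rewrite /= nop0r scaler0.
Qed.

Lemma nop_assoc pa pb a b c u v w u' v' w' : par pa a -> par pb b ->
  br b c = pol4 u v w 0 -> br a c = pol4 u' v' w' 0 ->
  nop (nop a b) c = nop a (nop b c) + nop (S (S a)) v
    + sg (pa && pb) (nop (S (S b)) v').
Proof.
move=> pa_a pb_b bc ac; apply/eqP; rewrite -addrA addrC -subr_eq; apply/eqP.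
by rewrite (quasi_assoc c pa_a pb_b) bc ac !int_nop_pol4.
Qed.

Lemma br_vacl v : br vac v = 0.
Proof. exact: br_centrall S_vac. Qed.

(** The integral term sees only the [eta]-coefficients of [[u_Gamma z]] and
    [[v_Gamma z]]; the scalar [k vac] has no bracket with [z]. *)
Lemma br_even_nop Q y z u v k u' v' k' : par false Q -> par true y ->
  br Q y = pol4 u v (k *: vac) 0 -> br Q z = pol4 u' v' (k' *: vac) 0 ->
  (forall n, (br u z)@_(n.+1, true) = 0) -> (forall n, (br v z)@_(n.+1, true) = 0) ->
  br Q (nop y z) = pol4 (nop u z - nop y u') (nop v z + nop y v')
    (k *: z - k' *: y + (br u z)@_(0%N, true)) ((br v z)@_(0%N, true)).
Proof.
move=> Q_even y_odd Qy Qz uz vz.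
have W n e := wick_coef z n e Q_even y_odd.
apply: pol4P => [||||n e]; rewrite W Qy Qz !mcoeff_pol4 /=.
- by rewrite big_ord0 addr0.
- by rewrite big_ord0 addr0 opprK.
- by rewrite big_ord1 mcoeff_pol4 invr1 scale1r nopZl nopZr nop_vacl nop_vacr.
- by rewrite big_ord1 mcoeff_pol4 invr1 scale1r nop0l nop0r !oppr0 !add0r.
rewrite nop0l nop0r sg0 oppr0 !add0r big1 // => j _; rewrite mcoeff_pol4.
have br0z m : (br (0 : V) z)@_m = 0 by rewrite br0l mcoeff0.
have br1z m : (br (k *: vac) z)@_m = 0.
  by rewrite mcoeff_brZl br_vacl mcoeff0 scaler0.
case: j => [[|[|j]] j_lt] /=; case: e; rewrite ?br0z ?br1z ?scaler0 //.
  by rewrite vz scaler0.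
by rewrite uz scaler0.
Qed.

(** The [chi]-coefficient of [[x_Lambda y]] is a scalar, so that only
    [[u_Gamma z]] contributes to the integral. *)
Lemma br_odd_nop x y z u k u' k' k'' : par true x -> par true y ->
  br x y = pol4 u (k *: vac) 0 0 -> br x z = pol4 u' (k' *: vac) 0 0 ->
  (br u z)@_(0%N, true) = k'' *: vac -> (forall n, (br u z)@_(n.+1, true) = 0) ->
  br x (nop y z) = pol4 (nop u z + nop y u') (k *: z - k' *: y) (k'' *: vac) 0.
Proof.
move=> x_odd y_odd xy xz uz uz2.
have W n e := wick_coef z n e x_odd y_odd.
have br0z m : (br (0 : V) z)@_m = 0 by rewrite br0l mcoeff0.
have br1z m : (br (k *: vac) z)@_m = 0.
  by rewrite mcoeff_brZl br_vacl mcoeff0 scaler0.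
apply: pol4P => [||||n e]; rewrite W xy xz !mcoeff_pol4 /=.
- by rewrite big_ord0 addr0.
- by rewrite big_ord0 addr0 nopZl nopZr nop_vacl nop_vacr.
- by rewrite big_ord1 mcoeff_pol4 invr1 scale1r nop0l nop0r !add0r.
- by rewrite big_ord1 mcoeff_pol4 br1z scaler0 nop0l nop0r oppr0 !addr0.
rewrite nop0l nop0r !sg0 !add0r big1 // => j _; rewrite mcoeff_pol4.
case: j => [[|[|j]] j_lt] /=; case: e; rewrite ?br0z ?br1z ?scaler0 //.
by rewrite uz2 scaler0.
Qed.

End VertexAlgebra.

(** * The affine algebra of su(2) + u(1) *)

Section Affine.
Variables (F : numFieldType) (V : susyVA F).
Local Notation S := (Sop V).
Local Notation vac := (vac V).
Implicit Types (a b c u v w x y z : V).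

(** The commutation relations of an affine algebra: [w] is the Lie bracket and [k]
    the pairing, multiplied by the level. *)
Definition affine a b w (k : F) : Prop := br a b = pol4 w (k *: vac) 0 0.

Lemma affineN a b w k : affine a b w k -> affine (- a) b (- w) (- k).
Proof.
rewrite /affine brNl => ->; apply/malgP => m.
rewrite -> mcoeffN; rewrite !mcoeff_pol4.
by case: m => [[|[|n]] []]; rewrite ?scaleNr ?oppr0.
Qed.

Lemma affine0 b : affine 0 b 0 0.
Proof.
by apply/malgP => m; rewrite br0l mcoeff0 mcoeff_pol4 scale0r; case: m => [[|[|n]] []].
Qed.

Lemma mcoeff_br_affine a b w k n : affine a b w k -> (br a b)@_(n.+1, true) = 0.
Proof. by move=> ->; rewrite mcoeff_pol4; case: n. Qed.

Lemma mcoeff_br_S_affine a b w k n : affine a b w k ->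
  (br (S a) b)@_(n, true) = if n is 0%N then w else 0.
Proof. by move=> ab; rewrite mcoeff_br_Sl ab mcoeff_pol4; case: n => [|[]]. Qed.

Lemma S_kvac k : S (k *: vac) = 0.
Proof. by rewrite SopZ S_vac scaler0. Qed.

Lemma nop_anticomm a b w k : par true a -> par true b -> affine a b w k ->
  nop a b = - nop b a.
Proof.
by move=> a_odd b_odd ab; rewrite (nop_comm a_odd b_odd ab) S_kvac Sop0 addr0.
Qed.

Lemma nop_square a w k : par true a -> affine a a w k -> nop a a = 0.
Proof.
move=> a_odd /(nop_anticomm a_odd a_odd) /eqP; rewrite -addr_eq0 -mulr2n.
by rewrite -scaler_nat scaler_eq0 pnatr_eq0 => /eqP.
Qed.

(** The correction comes from the [chi]-coefficient of
    [[S a_Lambda b] = chi [a_Lambda b]]. *)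
Lemma nop_S_comm a b w k : par true a -> par true b -> affine a b w k ->
  nop (S a) b = nop b (S a) + S (S w).
Proof.
move=> a_odd b_odd ab.
have Sab : br (S a) b = pol4 0 w (- (k *: vac)) 0.
  apply: pol4P => [||||n e]; rewrite mcoeff_br_Sl /= ?ab ?mcoeff_pol4 //.
  by case: e; case: n => [|n]; rewrite ?mcoeff_pol4 ?oppr0.
by rewrite (nop_comm (Sop_odd a_odd) b_odd Sab).
Qed.

Lemma nop_affine_assoc a b c w k w' k' : par true a -> par true b ->
  affine b c w k -> affine a c w' k' ->
  nop (nop a b) c = nop a (nop b c) + k *: S (S a) - k' *: S (S b).
Proof.
by move=> a_odd b_odd bc ac; rewrite (nop_assoc a_odd b_odd bc ac) !nopZr !nop_vacr.
Qed.

Lemma br_odd_quadratic (k0 : F) x y z y' z' u k u' k' w'' k'' v h v' h' s'' h'' :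
  par true x -> par true y -> par true y' ->
  affine x y u k -> affine x z u' k' -> affine u z w'' k'' ->
  affine x y' v h -> affine x z' v' h' -> affine v z' s'' h'' ->
  br x (k0 *: (nop y z + nop y' z')) =
    pol4 (k0 *: (nop u z + nop y u' + (nop v z' + nop y' v')))
         (k0 *: (k *: z - k' *: y + (h *: z' - h' *: y')))
         ((k0 * (k'' + h'')) *: vac) 0.
Proof.
move=> x_odd y_odd y'_odd xy xz uz xy' xz' vz'.
have xyz : br x (nop y z) = pol4 (nop u z + nop y u') (k *: z - k' *: y) (k'' *: vac) 0.
  by apply: br_odd_nop => // [|n]; rewrite uz mcoeff_pol4 //; case: n.
have xyz' : br x (nop y' z') = pol4 (nop v z' + nop y' v') (h *: z' - h' *: y') (h'' *: vac) 0.
  by apply: br_odd_nop => // [|n]; rewrite vz' mcoeff_pol4 //; case: n.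
apply/malgP => m; rewrite mcoeff_brZr brDr; rewrite -> mcoeffD; rewrite xyz xyz' !mcoeff_pol4.
by case: m => [[|[|n]] []]; rewrite ?addr0 ?scaler0 // -scalerDl scalerA.
Qed.

Lemma br_even_quadratic (k0 : F) Q A B u v w z u' v' w' z' :
  br Q A = pol4 u v w z -> br Q B = pol4 u' v' w' z' ->
  br Q (k0 *: (A + B)) = pol4 (k0 *: (u + u')) (k0 *: (v + v')) (k0 *: (w + w')) (k0 *: (z + z')).
Proof.
move=> QA QB; apply/malgP => m; rewrite mcoeff_brZr brDr; rewrite -> mcoeffD.
rewrite QA QB !mcoeff_pol4.
by case: m => [[|[|n]] []]; rewrite ?addr0 ?scaler0.
Qed.

Lemma br_skew_affine Q x u v k : par false Q -> par true x ->
  br x Q = pol4 u v (k *: vac) 0 -> br Q x = pol4 (u - S v) (- v) ((- k) *: vac) 0.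
Proof.
move=> Q_even x_odd xQ; rewrite (br_skew_pol4 Q_even x_odd xQ) /=.
by rewrite S_kvac Sop0 subr0 scaleNr.
Qed.

Variable kap : F.
Hypothesis kap_neq0 : kap != 0.

(** A third of the relations of the affine algebra of su(2) + u(1).  The other ones
    are obtained by rotating [p], [q], [r], so that each computation below serves
    for all three complex structures. *)
Definition frame_brackets b p q r : Prop :=
  [/\ par true p, affine p p 0 kap, affine b p 0 0, affine p b 0 0
    & affine p q (- r) 0 /\ affine q p r 0].

Definition frame b p q r : Prop :=
  [/\ par true b, affine b b 0 kap, frame_brackets b p q r, frame_brackets b q r p
    & frame_brackets b r p q].

Lemma frame_rot b p q r : frame b p q r -> frame b q r p.
Proof. by case. Qed.

(** The Kaehler form of the complex structure [b |-> p], [q |-> r]. *)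
Definition quadJ b p q r := kap^-1 *: (nop b p + nop q r).

(** The Kac-Todorov superconformal vector of the affine algebra, shifted by a
    multiple of [T b]. *)
Definition cubicH b p q r :=
  kap^-1 *: (nop b (S b) + nop p (S p) + nop q (S q) + nop r (S r) - S (S b))
  - (2%:R * kap ^- 2) *: nop p (nop q r).

Section Frame.
Variables b p q r : V.
Hypothesis bpqr : frame b p q r.

Lemma quadJ_even : par false (quadJ b p q r).
Proof.
have [b_odd _ [p_odd _ _ _ _] [q_odd _ _ _ _] [r_odd _ _ _ _]] := bpqr.
apply: parZ; apply: parD; first exact: (nop_par (pa := true) (pb := true)).
exact: (nop_par (pa := true) (pb := true)).
Qed.

Lemma cubicH_odd : par true (cubicH b p q r).
Proof.
have [b_odd _ [p_odd _ _ _ _] [q_odd _ _ _ _] [r_odd _ _ _ _]] := bpqr.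
have nopS_odd x : par true x -> par true (nop x (S x)).
  by move=> x_odd; apply: (nop_par (pa := true) (pb := false)) x_odd (Sop_odd x_odd).
rewrite /cubicH; apply: parD; last first.
  apply/parN/parZ/(nop_par (pa := true) (pb := false)) => //.
  exact: (nop_par (pa := true) (pb := true)).
apply: parZ; apply: parD; last exact/parN/(Sop_odd (p := false))/(Sop_odd (p := true)).
by apply: parD; [apply: parD; [apply: parD|]|]; apply: nopS_odd.
Qed.

(** Distinct vectors of the basis are orthogonal, so that reordering a triple
    product of them costs only signs. *)
Lemma nop_cycle : nop q (nop r p) = nop p (nop q r).
Proof.
have [b_odd bb [p_odd pp bp pb [pq qp]] [q_odd qq bq qb [qr rq]]
  [r_odd rr b_r rb [rp pr]]] := bpqr.
have := nop_affine_assoc q_odd p_odd pr qr.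
rewrite (nop_anticomm q_odd p_odd qp) nopNl (nop_affine_assoc p_odd q_odd qr pr).
rewrite (nop_anticomm r_odd p_odd rp) nopNr !scale0r !subr0 !addr0 => <-.
by rewrite opprK.
Qed.

Lemma cubicH_rot : cubicH b q r p = cubicH b p q r.
Proof. by rewrite /cubicH nop_cycle; lmod F V; ring. Qed.

Lemma br_quadJ_b : br (quadJ b p q r) b = pol4 (- S p) (- p) (0 *: vac) 0.
Proof.
have [b_odd bb [p_odd pp bp pb [pq qp]] [q_odd qq bq qb [qr rq]]
  [r_odd rr b_r rb [rp pr]]] := bpqr.
have E : br b (quadJ b p q r) = pol4 0 p (0 *: vac) 0.
  rewrite (br_odd_quadratic _ b_odd b_odd q_odd bb bp (affine0 p) bq b_r (affine0 r)).
  rewrite !nop0l !nop0r; congr pol4.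
  - by lmod F V.
  - by lmod F V; field.
  - by congr (_ *: _); ring.
by rewrite (br_skew_affine quadJ_even b_odd E) sub0r oppr0.
Qed.

Lemma br_quadJ_p : br (quadJ b p q r) p = pol4 (S b) b (1 *: vac) 0.
Proof.
have [b_odd bb [p_odd pp bp pb [pq qp]] [q_odd qq bq qb [qr rq]]
  [r_odd rr b_r rb [rp pr]]] := bpqr.
have E : br p (quadJ b p q r) = pol4 0 (- b) ((-1) *: vac) 0.
  rewrite (br_odd_quadratic _ p_odd b_odd q_odd pb pp (affine0 p) pq pr (affineN rr)).
  rewrite nopNl (nop_square r_odd rr) (nop_square q_odd qq) nop0l nop0r; congr pol4.
  - by lmod F V.
  - by lmod F V; field.
  - by congr (_ *: _); field.
by rewrite (br_skew_affine quadJ_even p_odd E) SopN sub0r !opprK.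
Qed.

Lemma br_quadJ_q : br (quadJ b p q r) q = pol4 (quadJ b r p q - S r) (- r) (0 *: vac) 0.
Proof.
have [b_odd bb [p_odd pp bp pb [pq qp]] [q_odd qq bq qb [qr rq]]
  [r_odd rr b_r rb [rp pr]]] := bpqr.
have E : br q (quadJ b p q r) = pol4 (quadJ b r p q) r (0 *: vac) 0.
  rewrite (br_odd_quadratic _ q_odd b_odd q_odd qb qp (affine0 p) qq qr (affine0 r)).
  rewrite nopNr nop0l /quadJ (nop_anticomm q_odd p_odd qp) nop0l; congr pol4.
  - by lmod F V; ring.
  - by lmod F V; field.
  - by congr (_ *: _); ring.
by rewrite (br_skew_affine quadJ_even q_odd E) oppr0.
Qed.

Lemma br_quadJ_r : br (quadJ b p q r) r = pol4 (S q - quadJ b q r p) q (0 *: vac) 0.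
Proof.
have [b_odd bb [p_odd pp bp pb [pq qp]] [q_odd qq bq qb [qr rq]]
  [r_odd rr b_r rb [rp pr]]] := bpqr.
have E : br r (quadJ b p q r) = pol4 (- quadJ b q r p) (- q) (0 *: vac) 0.
  rewrite (br_odd_quadratic _ r_odd b_odd q_odd rb rp (affine0 p) rq rr pr).
  rewrite nopNr nop0l /quadJ nop0r (nop_anticomm p_odd r_odd pr); congr pol4.
  - by lmod F V; ring.
  - by lmod F V; field.
  - by congr (_ *: _); ring.
by rewrite (br_skew_affine quadJ_even r_odd E) oppr0 SopN !opprK addrC.
Qed.

End Frame.

Section JJ.
Variables b p q r : V.
Hypothesis bpqr : frame b p q r.
Let qrp : frame b q r p := frame_rot bpqr.
Let rpq : frame b r p q := frame_rot qrp.

(** After the Wick formula the terms of degree 0 are quadratic with one [S], or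
    cubic.  The cubic ones cancel up to the [T r] from reassociating
    [::r p: p:], which compensates the [T r] from reordering [:S q p:]. *)
Lemma br_quadJ_next : br (quadJ b p q r) (quadJ b q r p) =
  pol4 (- S (quadJ b r p q)) (- (quadJ b r p q *+ 2)) 0 0.
Proof.
have [b_odd bb [p_odd pp bp pb [pq qp]] [q_odd qq bq qb [qr rq]]
  [r_odd rr b_r rb [rp pr]]] := bpqr.
have Jb := br_quadJ_b bpqr; have Jp := br_quadJ_p bpqr.
have Jq := br_quadJ_q bpqr; have Jr := br_quadJ_r bpqr.
have Jqp := br_quadJ_r qrp.
have Jbq : br (quadJ b p q r) (nop b q) = pol4
    (nop (- S p) q - nop b (quadJ b r p q - S r)) (nop (- p) q + nop b (- r)) r 0.
  rewrite (br_even_nop (quadJ_even bpqr) b_odd Jb Jq) => [|n|n]; last first.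
  - by rewrite brNl; rewrite -> mcoeffN; rewrite (mcoeff_br_affine _ pq) oppr0.
  - by rewrite brNl; rewrite -> mcoeffN; rewrite (mcoeff_br_S_affine _ pq) /= oppr0.
  rewrite !brNl; rewrite -> !mcoeffN; rewrite (mcoeff_br_S_affine _ pq) pq mcoeff_pol4.
  by rewrite !scale0r subr0 add0r opprK oppr0.
have Jrp : br (quadJ b p q r) (nop r p) = pol4
    (nop (S q - quadJ b q r p) p - nop r (S b)) (nop q p + nop r b) (- r) 0.
  rewrite (br_even_nop (quadJ_even bpqr) r_odd Jr Jp) => [|n|n]; last first.
  - exact: mcoeff_br_affine qp.
  - rewrite brDl brNl; rewrite -> mcoeffD, mcoeffN.
    by rewrite (mcoeff_br_S_affine _ qp) Jqp mcoeff_pol4; case: n => [|n]; rewrite /= subr0.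
  rewrite brDl brNl; rewrite -> mcoeffD, mcoeffN.
  rewrite (mcoeff_br_S_affine _ qp) Jqp qp !mcoeff_pol4.
  by rewrite !scale0r scale1r sub0r subrr addr0.
rewrite /(quadJ b q r p) (br_even_quadratic _ Jbq Jrp).
have bbr : nop b (nop b r) = 0.
  have := nop_affine_assoc b_odd b_odd b_r b_r.
  by rewrite (nop_square b_odd bb) nop0l !scale0r subr0 addr0.
have bqp := nop_affine_assoc b_odd q_odd qp bp.
have rpp := nop_affine_assoc r_odd p_odd pp rp.
rewrite (nop_square p_odd pp) nop0r in rpp.
rewrite (nop_anticomm q_odd p_odd qp) nopNr in bqp.
have Sbr := nop_S_comm b_odd r_odd b_r.
have Sqp := nop_S_comm q_odd p_odd qp.
congr pol4.
- rewrite /quadJ !SopE !(nop_S _ b_odd) !(nop_S _ p_odd) !nopE bbr bqp rpp Sbr Sqp Sop0 Sop0 /=.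
  by lmod F V; field.
- rewrite /quadJ (nop_anticomm q_odd p_odd qp) (nop_anticomm r_odd b_odd rb) !nopE.
  by lmod F V; field.
- by rewrite subrr scaler0.
- by rewrite addr0 scaler0.
Qed.

(** The [lambda]-terms [- b] and [b] cancel.  The term [T b] of [H] comes from
    reassociating [::b r: r:], and the two equal cubic terms from [:J_r r:] and
    [:q J_q:]. *)
Lemma br_quadJ_self : br (quadJ b p q r) (quadJ b p q r) =
  pol4 (- cubicH b p q r) 0 0 (- (2%:R *: vac)).
Proof.
have [b_odd bb [p_odd pp bp pb [pq qp]] [q_odd qq bq qb [qr rq]]
  [r_odd rr b_r rb [rp pr]]] := bpqr.
have Jb := br_quadJ_b bpqr; have Jp := br_quadJ_p bpqr.
have Jq := br_quadJ_q bpqr; have Jr := br_quadJ_r bpqr.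
have Jrr := br_quadJ_p rpq.
have Jbp : br (quadJ b p q r) (nop b p) = pol4
    (nop (- S p) p - nop b (S b)) (nop (- p) p + nop b b) (- b) (- (kap *: vac)).
  rewrite (br_even_nop (quadJ_even bpqr) b_odd Jb Jp) => [|n|n]; last first.
  - by rewrite brNl; rewrite -> mcoeffN; rewrite (mcoeff_br_affine _ pp) oppr0.
  - by rewrite brNl; rewrite -> mcoeffN; rewrite (mcoeff_br_S_affine _ pp) /= oppr0.
  rewrite !brNl; rewrite -> !mcoeffN; rewrite (mcoeff_br_S_affine _ pp) pp mcoeff_pol4.
  by rewrite !scale0r scale1r sub0r oppr0 addr0.
have Jqr : br (quadJ b p q r) (nop q r) = pol4
    (nop (quadJ b r p q - S r) r - nop q (S q - quadJ b q r p)) (nop (- r) r + nop q q)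
    b (- (kap *: vac)).
  rewrite (br_even_nop (quadJ_even bpqr) q_odd Jq Jr) => [|n|n]; last first.
  - by rewrite brNl; rewrite -> mcoeffN; rewrite (mcoeff_br_affine _ rr) oppr0.
  - rewrite brDl brNl; rewrite -> mcoeffD, mcoeffN.
    by rewrite (mcoeff_br_S_affine _ rr) Jrr mcoeff_pol4; case: n => [|n]; rewrite /= subr0.
  rewrite brDl !brNl; rewrite -> mcoeffD, !mcoeffN.
  rewrite (mcoeff_br_S_affine _ rr) Jrr rr !mcoeff_pol4.
  by rewrite !scale0r !subr0 add0r.
rewrite {2}/quadJ (br_even_quadratic _ Jbp Jqr).
have brr := nop_affine_assoc b_odd r_odd rr b_r.
rewrite (nop_square r_odd rr) nop0r in brr.
have pqr := nop_affine_assoc p_odd q_odd qr pr.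
have qqb := nop_affine_assoc q_odd q_odd qb qb.
rewrite (nop_square q_odd qq) nop0l !scale0r subr0 addr0 in qqb.
have Spp := nop_S_comm p_odd p_odd pp.
have Srr := nop_S_comm r_odd r_odd rr.
congr pol4.
- rewrite /quadJ /cubicH (nop_anticomm b_odd q_odd bq) !nopE brr pqr -qqb Spp Srr Sop0 Sop0.
  by rewrite (nop_cycle bpqr); lmod F V; field.
- rewrite !nopNl (nop_square p_odd pp) (nop_square b_odd bb) (nop_square q_odd qq).
  by rewrite (nop_square r_odd rr) oppr0 !addr0 scaler0.
- by rewrite addrC subrr scaler0.
- by lmod F V; field.
Qed.

End JJ.
End Affine.

Section FrameBrackets.
Variables (F : numFieldType) (V : susyVA F) (kap : F) (b a0 a1 a2 : V).
Hypotheses (kap_neq0 : kap != 0) (ba : frame kap b a0 a1 a2).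

Lemma frame_JJ_brackets (J : 'I_3 -> V) :
  J 0 = quadJ kap b a0 a1 a2 -> J 1 = quadJ kap b a1 a2 a0 ->
  J 2 = quadJ kap b a2 a0 a1 ->
  JJ_brackets 2%:R (vac V) (cubicH kap b a0 a1 a2) J.
Proof.
move=> J0 J1 J2; have ba' := frame_rot ba; have ba'' := frame_rot ba'.
have next p q r : frame kap b p q r ->
    br (quadJ kap b q r p) (quadJ kap b p q r) =
    pol4 (- Sop V (- quadJ kap b r p q)) (- ((- quadJ kap b r p q) *+ 2)) 0 0.
  move=> pqr; have qrp := frame_rot pqr; have rpq := frame_rot qrp.
  have E : br (quadJ kap b p q r) (quadJ kap b q r p) =
      pol4 (- Sop V (quadJ kap b r p q)) (- (quadJ kap b r p q *+ 2)) 0 0.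
    exact: br_quadJ_next.
  rewrite (br_skew_pol4 (quadJ_even qrp) (quadJ_even pqr) E) /=.
  congr pol4; rewrite ?SopE ?oppr0 //; last by lmod F V; ring.
  by lmod F V; ring.
have ord3 (i : 'I_3) : [\/ i = 0, i = 1 | i = 2].
  by case: i => [[|[|[|i]]]] // ?; [apply: Or31|apply: Or32|apply: Or33]; apply: val_inj.
have cross i j : Jcross J i j = levi_civita F i j 0 *: J 0
    + levi_civita F i j 1 *: J 1 + levi_civita F i j 2 *: J 2.
  rewrite /Jcross !big_ord_recl big_ord0 addr0 addrA.
  by congr (_ + _ *: J _ + _ *: J _); apply: val_inj.
have [self self' self''] : [/\ br (J 0) (J 0) = pol4 (- cubicH kap b a0 a1 a2) 0 0 (- (2%:R *: vac V)),
    br (J 1) (J 1) = pol4 (- cubicH kap b a0 a1 a2) 0 0 (- (2%:R *: vac V))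
  & br (J 2) (J 2) = pol4 (- cubicH kap b a0 a1 a2) 0 0 (- (2%:R *: vac V))].
  rewrite J0 J1 J2 !br_quadJ_self //.
  by rewrite (cubicH_rot ba') (cubicH_rot ba).
split=> [i|i j ij]; first by case: (ord3 i) => ->.
rewrite cross; case: (ord3 i) ij => ->; case: (ord3 j) => -> // _;
  rewrite /= ?scale0r ?add0r ?addr0 ?scale1r ?scaleN1r ?J0 ?J1 ?J2.
- exact: br_quadJ_next.
- exact: next.
- exact: next.
- exact: br_quadJ_next.
- exact: br_quadJ_next.
- exact: next.
Qed.

End FrameBrackets.

(** * Sums over dual bases *)

Section DualBases.
Variables (F : fieldType) (n : nat).
Local Notation U := 'rV[F]_n.

Definition bilin (W W' W'' : lmodType F) (B : W -> W' -> W'') : Prop :=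
  (forall y, linear (B^~ y)) /\ (forall x, linear (B x)).

Section Bilin.
Variables (W W' W'' : lmodType F) (B : W -> W' -> W'').
Hypothesis Bbil : bilin B.

Lemma bilinDl x x' y : B (x + x') y = B x y + B x' y.
Proof. by have := Bbil.1 y 1 x x'; rewrite !scale1r. Qed.
Lemma bilinDr x y y' : B x (y + y') = B x y + B x y'.
Proof. by have := Bbil.2 x 1 y y'; rewrite !scale1r. Qed.
Lemma bilin0l y : B 0 y = 0.
Proof. by have := Bbil.1 y (-1) 0 0; rewrite scaler0 addr0 scaleN1r addNr. Qed.
Lemma bilin0r x : B x 0 = 0.
Proof. by have := Bbil.2 x (-1) 0 0; rewrite scaler0 addr0 scaleN1r addNr. Qed.
Lemma bilinZl a x y : B (a *: x) y = a *: B x y.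
Proof. by have := Bbil.1 y a x 0; rewrite bilin0l !addr0. Qed.
Lemma bilinZr a x y : B x (a *: y) = a *: B x y.
Proof. by have := Bbil.2 x a y 0; rewrite bilin0r !addr0. Qed.
Lemma bilinNl x y : B (- x) y = - B x y.
Proof. by rewrite -scaleN1r bilinZl scaleN1r. Qed.
Lemma bilinNr x y : B x (- y) = - B x y.
Proof. by rewrite -scaleN1r bilinZr scaleN1r. Qed.
Lemma bilin_suml I (r : seq I) (f : I -> W) y :
  B (\sum_(i <- r) f i) y = \sum_(i <- r) B (f i) y.
Proof. exact: (big_morph (B^~ y) (fun x x' => bilinDl x x' y) (bilin0l y)). Qed.
Lemma bilin_sumr I (r : seq I) (f : I -> W') x :
  B x (\sum_(i <- r) f i) = \sum_(i <- r) B x (f i).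
Proof. exact: (big_morph (B x) (bilinDr x) (bilin0r x)). Qed.
Definition bilinE := (bilinDl, bilinDr, bilinZl, bilinZr, bilinNl, bilinNr).

End Bilin.

(** The metric and the Kaehler form are the symmetric and the alternating part of
    the tensor [(u + i v) (x) (u - i v)]. *)
Lemma bilin_conjugates (W W' : lmodType F) (B : W -> W -> W') (i k : F) (u v : W) :
  bilin B -> i * i = -1 ->
  B (k *: (u - (- i) *: v)) (u - i *: v) =
  k *: (B u u + B v v + i *: (B v u - B u v)).
Proof.
move=> Bbil ii; rewrite (bilinZl Bbil) scaleNr opprK; congr (_ *: _).
rewrite (bilinDl Bbil) !(bilinDr Bbil) !(bilinNr Bbil) !(bilinZl Bbil) !(bilinZr Bbil).
by rewrite [i *: (i *: _)]scalerA ii; lmod F W'; ring.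
Qed.

(** If [e' = G e] and [eb' = G' eb] with both pairs dual for the same form, then
    [G'^T G = 1]: the tensor [\sum_j eb_j (x) e_j] does not depend on the bases. *)
Lemma dual_bases_sum (Gm : 'M[F]_n) m (e eb e' eb' : 'M[F]_(m, n)) (W : lmodType F)
    (B : U -> U -> W) :
  bilin B -> (e' <= e)%MS -> (eb' <= eb)%MS ->
  e *m Gm *m eb^T = 1%:M -> e' *m Gm *m eb'^T = 1%:M ->
  \sum_j B (row j eb) (row j e) = \sum_j B (row j eb') (row j e').
Proof.
move=> Bbil /submxP[G ->] /submxP[G' ->] ee'.
rewrite trmx_mul !mulmxA -(mulmxA G) -(mulmxA G) ee' mulmx1 => /mulmx1C GG.
have rowM (D : 'M[F]_m) (f : 'M[F]_(m, n)) j : row j (D *m f) = \sum_l D j l *: row l f.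
  by rewrite row_mul mulmx_sum_row; apply: eq_bigr => l _; rewrite !mxE.
have -> : \sum_j B (row j (G' *m eb)) (row j (G *m e)) =
    \sum_j \sum_i \sum_l (G' j i * G j l) *: B (row i eb) (row l e).
  apply: eq_bigr => j _; rewrite !rowM (bilin_suml Bbil); apply: eq_bigr => i _.
  rewrite (bilin_sumr Bbil); apply: eq_bigr => l _.
  by rewrite (bilinZl Bbil) (bilinZr Bbil) scalerA.
rewrite exchange_big /=; apply: eq_bigr => i _; rewrite exchange_big /=.
rewrite (bigD1 i) //= [X in _ + X]big1 ?addr0 => [|l li]; rewrite -scaler_suml.
  have -> : \sum_j G' j i * G j i = (G'^T *m G) i i.
    by rewrite mxE; apply: eq_bigr => j _; rewrite mxE.
  by rewrite GG mxE eqxx scale1r.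
have -> : \sum_j G' j i * G j l = (G'^T *m G) i l.
  by rewrite mxE; apply: eq_bigr => j _; rewrite mxE.
by rewrite GG mxE eq_sym (negPf li) scale0r.
Qed.

Lemma dual_pair_sum (Gm : 'M[F]_n) (e eb e' eb' : 'M[F]_(2, n)) (i k : F) (b p q r : U)
    (W : lmodType F) (B : U -> U -> W) :
  bilin B -> i * i = -1 ->
  (e' <= e)%MS -> (eb' <= eb)%MS ->
  e *m Gm *m eb^T = 1%:M -> e' *m Gm *m (k *: eb')^T = 1%:M ->
  row 0 e' = b - i *: p -> row 1 e' = q - i *: r ->
  row 0 eb' = b - (- i) *: p -> row 1 eb' = q - (- i) *: r ->
  \sum_j B (row j eb) (row j e) =
  k *: (B b b + B p p + B q q + B r r + i *: (B p b - B b p + B r q - B q r)).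
Proof.
move=> Bbil ii e'e eb'eb ee' kee' e0 e1 eb0 eb1.
rewrite (dual_bases_sum Bbil e'e _ ee' kee'); last exact: submx_trans (scalemx_sub _ _) eb'eb.
have rowZ j : row j (k *: eb') = k *: row j eb' by apply/rowP => l; rewrite !mxE.
rewrite !big_ord_recl big_ord0 addr0 !rowZ (_ : lift ord0 ord0 = 1); last exact: val_inj.
rewrite e0 e1 eb0 eb1 !(bilin_conjugates _ _ _ Bbil ii) -scalerDr.
by congr (_ *: _); rewrite addrACA -scalerDr !addrA.
Qed.

End DualBases.

(** * The Lie algebra of V_+ *)

Section RealGeometry.
Variables (F : fieldType) (ell x : F).
Local Notation delta i := (delta_mx 0 i).

Lemma lie_k_bilin : bilin (@lie_k F).
Proof.
split=> [w|v] a u u'; apply/rowP => m; rewrite !mxE mulrN -opprD; congr (- _);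
  rewrite mulr_sumr -big_split; apply: eq_bigr => i _; rewrite mulr_sumr -big_split;
  by apply: eq_bigr => j _; rewrite /= !mxE; ring.
Qed.

Lemma ev_bilin : bilin (@ev F : _ -> _ -> F^o).
Proof.
split=> [w|v] a u u'; rewrite /ev /GRing.scale /= mulr_sumr -big_split;
  by apply: eq_bigr => j _; rewrite /= !mxE; ring.
Qed.

Lemma vol3_linl a u u' v w :
  vol3 (a *: u + u') v w = a * vol3 u v w + vol3 u' v w :> F.
Proof.
rewrite /vol3 mulr_sumr -big_split; apply: eq_bigr => i _.
rewrite mulr_sumr -big_split; apply: eq_bigr => j _.
by rewrite mulr_sumr -big_split; apply: eq_bigr => l _; rewrite /= !mxE; ring.
Qed.

Lemma vol3_linr a u v v' w :
  vol3 u (a *: v + v') w = a * vol3 u v w + vol3 u v' w :> F.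
Proof.
rewrite /vol3 mulr_sumr -big_split; apply: eq_bigr => i _.
rewrite mulr_sumr -big_split; apply: eq_bigr => j _.
by rewrite mulr_sumr -big_split; apply: eq_bigr => l _; rewrite /= !mxE; ring.
Qed.

Lemma lie_g_bilin : bilin (lie_g ell).
Proof.
split=> [w|v] a u u'; rewrite /lie_g !linearP scale_row_mx add_row_mx;
  congr row_mx; rewrite ?(lie_k_bilin.1 _ a) ?(lie_k_bilin.2 _ a) //;
  apply/rowP => j; rewrite !mxE.
- rewrite (ev_bilin.1 _ a) vol3_linl (lie_k_bilin.1 _ a) (ev_bilin.2 _ a).
  by rewrite /GRing.scale /=; ring.
- rewrite (ev_bilin.1 _ a) vol3_linr (lie_k_bilin.1 _ a) (ev_bilin.2 _ a).
  by rewrite /GRing.scale /=; ring.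
Qed.

Lemma pairing_bilin : bilin (@pairing F : _ -> _ -> F^o).
Proof.
split=> [w|v] a u u'; rewrite /pairing !linearP (ev_bilin.1 _ a) (ev_bilin.2 _ a);
  by rewrite /GRing.scale /=; ring.
Qed.

Lemma lie_k_delta i j m : lie_k (delta i : 'rV[F]_4) (delta j) 0 m = - levi_civita F i j m.
Proof.
rewrite mxE (bigD1 i) //= (bigD1 j) //= !mxE !eqxx !mulr1 !big1 ?addr0 //.
  by move=> l /negPf li; rewrite big1 // => l' _; rewrite !mxE li andbF mulr0 mul0r.
by move=> l /negPf lj; rewrite !mxE lj andbF mulr0.
Qed.

Lemma ev_scale_delta (k : F) i v : ev (k *: delta i) v = k * v 0 i.
Proof.
rewrite /ev (bigD1 i) //= !mxE !eqxx mulr1 big1 ?addr0 // => l /negPf li.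
by rewrite !mxE li andbF mulr0 mul0r.
Qed.

Lemma vol3_delta i j m : vol3 (delta i : 'rV[F]_4) (delta j) (delta m) = levi_civita F i j m.
Proof.
rewrite /vol3 (bigD1 i) //= (bigD1 j) //= (bigD1 m) //= !mxE !eqxx !mulr1 !big1 ?addr0 //.
- move=> l /negPf li; rewrite big1 // => l' _; rewrite big1 // => l'' _.
  by rewrite !mxE li andbF mulr0 !mul0r.
- by move=> l /negPf li; rewrite big1 // => l' _; rewrite !mxE li andbF mulr0 !mul0r.
- by move=> l /negPf li; rewrite !mxE li andbF !mulr0.
Qed.

Definition gdiag (i : 'I_4) : F := ell * (if i == 3 then x ^+ 2 else 1).

Lemma row_Vplus i : row i (Vplus ell x) = row_mx (delta i) (gdiag i *: delta i).
Proof.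
rewrite /Vplus row_row_mx row1 /metric linearZ /=; congr row_mx.
apply/rowP => j; rewrite !mxE /gdiag; case: (eqVneq i j) => [->|ij].
  by rewrite !eqxx !mulr1n mulr1.
by rewrite ?mulr0n ?andbF !mulr0.
Qed.

(** In the dual part the two coadjoint terms contribute [- 2 ell eps] and the
    three-form [ell eps], which leaves the metric dual of the vector part: V_+ is a
    copy of the Lie algebra of K. *)
Lemma lie_row_Vplus i j : lie_g ell (row i (Vplus ell x)) (row j (Vplus ell x)) =
  - \sum_(m < 4) levi_civita F i j m *: row m (Vplus ell x).
Proof.
rewrite !row_Vplus /lie_g !row_mxKl !row_mxKr.
have -> : \sum_(m < 4) levi_civita F i j m *: row m (Vplus ell x) =
    row_mx (\sum_(m < 4) levi_civita F i j m *: delta m)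
           (\sum_(m < 4) (levi_civita F i j m * gdiag m) *: delta m).
  rewrite (eq_bigr (fun m : 'I_4 => row_mx (levi_civita F i j m *: delta m)
    ((levi_civita F i j m * gdiag m) *: delta m))) => [|m _]; last first.
    by rewrite row_Vplus scale_row_mx scalerA.
  apply/rowP => l; rewrite summxE -(splitK l); case: (split l) => m; rewrite /= ?row_mxEl ?row_mxEr summxE;
    by apply: eq_bigr => h _; rewrite ?row_mxEl ?row_mxEr.
have deltaE (f : 'I_4 -> F) m : (\sum_l f l *: delta l : 'rV[F]_4) 0 m = f m.
  rewrite summxE (bigD1 m) //= !mxE !eqxx mulr1 big1 ?addr0 // => l /negPf lm.
  by rewrite !mxE eq_sym lm andbF mulr0.
rewrite opp_row_mx; congr row_mx; apply/rowP => m; rewrite [RHS]mxE deltaE.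
  exact: lie_k_delta.
rewrite mxE !ev_scale_delta !lie_k_delta vol3_delta /gdiag.
case: i => [[|[|[|[|i]]]] ?] //; case: j => [[|[|[|[|j]]]] ?] //;
  by case: m => [[|[|[|[|m]]]] ?] //; rewrite /=; ring.
Qed.

Lemma pairing_row_Vplus i j : 2%:R != 0 :> F ->
  pairing (row i (Vplus ell x)) (row j (Vplus ell x)) = gdiag i * (i == j)%:R.
Proof.
move=> two_neq0; rewrite !row_Vplus /pairing !row_mxKl !row_mxKr !ev_scale_delta !mxE !eqxx /=.
by rewrite (eq_sym j); case: eqVneq => [->|_]; rewrite ?mulr1 ?mulr0 ?addr0 ?mulr0 //; field.
Qed.

Lemma cstruct_rows (p q r : 'I_4) : uniq [:: p; q; r; 3] ->
  [/\ (delta 3 : 'rV[F]_4) *m cstruct x p q r = x *: delta p,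
      (delta p : 'rV[F]_4) *m cstruct x p q r = - x^-1 *: delta 3,
      (delta q : 'rV[F]_4) *m cstruct x p q r = delta r
    & (delta r : 'rV[F]_4) *m cstruct x p q r = - delta q].
Proof.
rewrite /= !inE !negb_or => /andP[/and3P[pq pr p3]] /andP[/andP[qr q3]] /andP[r3 _].
rewrite /cstruct !mulmxDr !mulmxN -!scalemxAr.
rewrite !mul_delta_mx_cond !eqxx (eq_sym 3) (eq_sym q p) (eq_sym r p) (eq_sym r q).
rewrite (eq_sym 3 q) (eq_sym 3 r) (negPf pq) (negPf pr) (negPf p3) (negPf qr) (negPf q3) (negPf r3).
by rewrite !mulr1n !mulr0n !scaler0 !subr0 !addr0 ?add0r ?sub0r scaleNr.
Qed.

End RealGeometry.

(** * Dual bases of the eigenspaces of a complex structure *)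

Section ComplexGeometry.
Variable R : realType.
Local Notation C := (R[i]).
Local Notation toC := (map_mx (real_complex R)).
Local Notation pairingC := (@pairingC R).

Lemma lieC_toC n (lie : 'rV[R]_n -> 'rV[R]_n -> 'rV[R]_n) a b : bilin lie ->
  lieC lie (toC a) (toC b) = toC (lie a b).
Proof.
move=> lie_bil; rewrite /lieC {2}[a]row_sum_delta {2}[b]row_sum_delta.
rewrite (bilin_suml lie_bil) raddf_sum; apply: eq_bigr => i _.
rewrite (bilin_sumr lie_bil) raddf_sum; apply: eq_bigr => j _ /=.
by rewrite (bilinZl lie_bil) (bilinZr lie_bil) scalerA !map_mxZ !mxE rmorphM.
Qed.

Lemma formC_toC n (form : 'rV[R]_n -> 'rV[R]_n -> R) a b :
  bilin (form : _ -> _ -> R^o) -> Defs.formC form (toC a) (toC b) = (form a b)%:C%C.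
Proof.
move=> form_bil; rewrite /Defs.formC {2}[a]row_sum_delta {2}[b]row_sum_delta.
rewrite (bilin_suml form_bil) raddf_sum; apply: eq_bigr => i _.
rewrite (bilin_sumr form_bil) raddf_sum; apply: eq_bigr => j _ /=.
rewrite (bilinZl form_bil) (bilinZr form_bil) !mxE.
by rewrite /GRing.scale /= mulrA !rmorphM.
Qed.

Lemma lieC_bilin n (lie : 'rV[R]_n -> 'rV[R]_n -> 'rV[R]_n) : bilin (lieC lie).
Proof.
split=> [w|v] a u u'; rewrite /lieC scaler_sumr -big_split; apply: eq_bigr => i _;
  rewrite scaler_sumr -big_split; apply: eq_bigr => j _;
  by rewrite /= !mxE scalerA -scalerDl; congr (_ *: _); ring.
Qed.

Definition gram : 'M[C]_(4 + 4) :=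
  \matrix_(i, j) (pairing (delta_mx 0 i) (delta_mx 0 j) : R)%:C%C.

Lemma pairingC_gram a b : pairingC a b = (a *m gram *m b^T) 0 0.
Proof.
rewrite /Defs.pairingC /Defs.formC !mxE exchange_big; apply: eq_bigr => j _ /=.
rewrite !mxE mulr_suml; apply: eq_bigr => i _.
by rewrite !mxE mulrAC.
Qed.

Lemma pairingC_rows m n (a : 'M[C]_(m, 4 + 4)) (b : 'M[C]_(n, 4 + 4)) i j :
  (a *m gram *m b^T) i j = pairingC (row i a) (row j b).
Proof.
rewrite pairingC_gram tr_row !mxE; apply: eq_bigr => k _; rewrite !mxE; congr (_ * _).
by apply: eq_bigr => l _; rewrite !mxE.
Qed.

Lemma pairingC_bilin : bilin (pairingC : _ -> _ -> C^o).
Proof.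
split=> [w|v] a u u'; rewrite !pairingC_gram ?linearP /= ?mulmxDl ?mulmxDr -?scalemxAl -?scalemxAr !mxE //.
Qed.

Variables (ell x : R).
Hypotheses (ell_gt0 : 0 < ell) (x_gt0 : 0 < x).
Local Notation lie := (lieC (lie_g ell)).
Local Notation VplusC := (toC (Vplus ell x)).

Definition uC (i : 'I_4) : 'rV[C]_(4 + 4) := row i VplusC.
(** The central direction, normalized to the length of the other ones. *)
Definition ub : 'rV[C]_(4 + 4) := (x%:C%C)^-1 *: uC 3.

Definition kapC : C := 2%:R * ell%:C%C.

Lemma ellC_neq0 : ell%:C%C != 0 :> C.
Proof. by rewrite fmorph_eq0 gt_eqF. Qed.

Lemma xC_neq0 : x%:C%C != 0 :> C.
Proof. by rewrite fmorph_eq0 gt_eqF. Qed.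

Lemma kapC_neq0 : kapC != 0.
Proof. by rewrite mulf_neq0 ?ellC_neq0 // pnatr_eq0. Qed.

Lemma lie_uC i j : lie (uC i) (uC j) = - \sum_(m < 4) (levi_civita R i j m)%:C%C *: uC m.
Proof.
rewrite /uC -!map_row lieC_toC; last exact: lie_g_bilin.
rewrite lie_row_Vplus raddfN raddf_sum; congr (- _); apply: eq_bigr => m _.
by rewrite /= map_mxZ -map_row.
Qed.

Lemma pairing_uC i j : pairingC (uC i) (uC j) = (gdiag ell x i * (i == j)%:R)%:C%C.
Proof.
rewrite /uC -!map_row /Defs.pairingC formC_toC; last exact: pairing_bilin.
by rewrite pairing_row_Vplus // pnatr_eq0.
Qed.

Definition cyc (p q r : 'I_4) : Prop :=
  [\/ [/\ p = 0, q = 1 & r = 2], [/\ p = 1, q = 2 & r = 0] | [/\ p = 2, q = 0 & r = 1]].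

Lemma cyc_rot p q r : cyc p q r -> cyc q r p.
Proof. by case=> [[-> -> ->]|[-> -> ->]|[-> -> ->]]; [apply: Or32|apply: Or33|apply: Or31]. Qed.

Lemma lie_uC_single (i j k : 'I_4) : (forall m : 'I_4, m != k -> levi_civita R i j m = 0) ->
  lie (uC i) (uC j) = - ((levi_civita R i j k)%:C%C *: uC k).
Proof.
move=> eps; rewrite lie_uC (bigD1 k) //= big1 ?addr0 // => m mk.
by rewrite eps // scale0r.
Qed.

Lemma lie_uC3l i : lie (uC 3) (uC i) = 0.
Proof.
rewrite (@lie_uC_single _ _ 0) => [|m _]; last by [].
by rewrite /= scale0r oppr0.
Qed.

Lemma lie_uC3r i : lie (uC i) (uC 3) = 0.
Proof.
have E (m : 'I_4) : levi_civita R i (3%R : 'I_4) m = 0 by case: i => [[|[|[|[|i]]]] ?].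
by rewrite (@lie_uC_single _ _ 0) // E scale0r oppr0.
Qed.

Lemma lie_cyc p q r : cyc p q r ->
  [/\ lie (uC p) (uC p) = 0, lie (uC p) (uC q) = - uC r & lie (uC q) (uC p) = uC r].
Proof.
have val3 (m k : 'I_4) : m != k -> val m != val k by rewrite -(inj_eq val_inj).
case=> [[-> -> ->]|[-> -> ->]|[-> -> ->]]; split.
all: try by rewrite (@lie_uC_single _ _ 3) => [|m]; rewrite /= ?scale0r ?oppr0 //;
  case: m => [[|[|[|[|m]]]] ?] //.
all: match goal with |- _ = - uC ?k => rewrite (@lie_uC_single _ _ k) | |- _ = uC ?k => rewrite (@lie_uC_single _ _ k) end.
all: try by move=> m /val3; case: m => [[|[|[|[|m]]]] ?].
all: by rewrite /= ?rmorphN rmorph1 ?scaleNr scale1r ?opprK.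
Qed.

Lemma pairing_cyc p q r : cyc p q r ->
  [/\ pairingC (uC p) (uC p) = ell%:C%C, pairingC (uC p) (uC q) = 0,
      pairingC (uC q) (uC p) = 0, pairingC (uC 3) (uC p) = 0 & pairingC (uC p) (uC 3) = 0].
Proof.
by case=> [[-> -> _]|[-> -> _]|[-> -> _]]; split;
  rewrite pairing_uC /gdiag /= ?mulr1 ?mulr0 ?rmorph0.
Qed.

Lemma pairing_ub : pairingC ub ub = ell%:C%C.
Proof.
rewrite /ub (bilinZl pairingC_bilin) (bilinZr pairingC_bilin) pairing_uC /gdiag /= mulr1.
rewrite /GRing.scale /= rmorphM rmorphXn /=; field; exact: xC_neq0.
Qed.

End ComplexGeometry.

Section Eigenspaces.
Variable R : realType.
Local Notation C := (R[i]).
Local Notation toC := (map_mx (real_complex R)).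
Local Notation pairingC := (@pairingC R).
Local Notation gram := (gram R).
Variables (ell x : R).
Hypotheses (ell_gt0 : 0 < ell) (x_gt0 : 0 < x).
Local Notation lie := (lieC (lie_g ell)).
Local Notation VplusC := (toC (Vplus ell x)).
Local Notation uC := (uC ell x).
Local Notation ub := (ub ell x).
Local Notation kap := (kapC ell).
Variables (p q r : 'I_4) (dv : 'rV[R]_(4 + 4) -> R).
Hypothesis pqr : cyc p q r.
Local Notation t := (Triple (Vplus ell x) dv (cstruct x p q r)).

Definition ceigen (s : C) : 'M[C]_(2, 4 + 4) :=
  \matrix_(j < 2) (if j == 0 then ub - s *: uC p else uC q - s *: uC r).

Lemma row_ceigen0 s : row 0 (ceigen s) = ub - s *: uC p.
Proof. by rewrite rowK. Qed.

Lemma row_ceigen1 s : row 1 (ceigen s) = uC q - s *: uC r.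
Proof. by rewrite rowK. Qed.

(** For a complex structure [I] and [s^2 = -1] the vectors [v - s I v] are
    eigenvectors for [s]; here [v] is [b] or [q], with [I b = p] and [I q = r]. *)
Lemma ceigen_sub (s : C) : s * s = -1 -> (ceigen s <= eigenC t s)%MS.
Proof.
move=> ss; have s_neq0 : s != 0.
  by apply: contra_eqN ss => /eqP->; rewrite mul0r eq_sym oppr_eq0 oner_eq0.
have upqr : uniq [:: p; q; r; 3].
  by case: pqr => [[-> -> ->]|[-> -> ->]|[-> -> ->]].
have [M3 Mp Mq Mr] := cstruct_rows x upqr.
have toCr i (v : 'rV[R]_4) : delta_mx 0 i *m cstruct x p q r = v ->
    (delta_mx 0 i : 'rV[C]_4) *m toC (cstruct x p q r) = toC v.
  by move=> <-; rewrite map_mxM map_delta_mx.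
have x0 := xC_neq0 x_gt0.
have uE i : uC i = delta_mx 0 i *m VplusC by rewrite /uC rowE.
apply/row_subP => j; rewrite rowK; case: ifP => _.
  have -> : ub - s *: uC p =
      ((x%:C%C)^-1 *: delta_mx 0 3 - s *: delta_mx 0 p) *m VplusC.
    by rewrite mulmxBl -!scalemxAl -!uE.
  apply: submxMr; apply/eigenspaceP; rewrite mulmxBl -!scalemxAl.
  rewrite (toCr _ _ M3) (toCr _ _ Mp) !map_mxZ !map_delta_mx rmorphN fmorphV /=.
  rewrite scalerA mulVf // scale1r scaleNr scalerN opprK.
  by rewrite scalerBr (scalerA s s) ss scaleN1r opprK addrC.
have -> : uC q - s *: uC r = (delta_mx 0 q - s *: delta_mx 0 r) *m VplusC.
  by rewrite mulmxBl -!scalemxAl -!uE.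
apply: submxMr; apply/eigenspaceP; rewrite mulmxBl -!scalemxAl.
rewrite (toCr _ _ Mq) (toCr _ _ Mr) map_mxN !map_delta_mx.
by rewrite scalerN opprK scalerBr scalerA ss scaleN1r opprK addrC.
Qed.

Let pp := pairing_cyc ell x pqr.
Let qq := pairing_cyc ell x (cyc_rot pqr).
Let rr := pairing_cyc ell x (cyc_rot (cyc_rot pqr)).

Lemma pairing_ub_u i : pairingC (uC 3) (uC i) = 0 -> pairingC ub (uC i) = 0.
Proof.
by move=> E; rewrite /ub (bilinZl (pairingC_bilin R)) E scaler0.
Qed.

Lemma pairing_u_ub i : pairingC (uC i) (uC 3) = 0 -> pairingC (uC i) ub = 0.
Proof.
by move=> E; rewrite /ub (bilinZr (pairingC_bilin R)) E scaler0.
Qed.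

Lemma gram_ceigen s s' : ceigen s *m gram *m (ceigen s')^T = (ell%:C%C * (1 + s * s'))%:M.
Proof.
have [Ppp Ppq Pqp P3p Pp3] := pp; have [Pqq Pqr Prq P3q Pq3] := qq.
have [Prr Prp Ppr P3r Pr3] := rr.
have ord2 (j : 'I_2) : j = 0 \/ j = 1.
  by case: j => [[|[|j]]] // ?; [left|right]; apply: val_inj.
have bE := bilinE (pairingC_bilin R).
apply/matrixP => j k; rewrite pairingC_rows mxE.
have Pbp := pairing_ub_u P3p; have Pbq := pairing_ub_u P3q; have Pbr := pairing_ub_u P3r.
have Ppb := pairing_u_ub Pp3; have Pqb := pairing_u_ub Pq3; have Prb := pairing_u_ub Pr3.
have Pbb := pairing_ub ell x_gt0.
have [r0 r1] := (row_ceigen0, row_ceigen1); move: Pbp Pbq Pbr Ppb Pqb Prb Pbb r0 r1.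
move: (ub) => b Pbp Pbq Pbr Ppb Pqb Prb Pbb r0 r1.
case: (ord2 j) => ->; case: (ord2 k) => ->; rewrite ?r0 ?r1 !bE;
  rewrite ?Pbb ?Pbp ?Pbq ?Pbr ?Ppb ?Pqb ?Prb ?Ppp ?Ppq ?Pqp ?Pqq ?Pqr ?Prq ?Prr ?Prp ?Ppr;
  rewrite /GRing.scale /= ?mulr1n ?mulr0n; ring.
Qed.

Lemma imaginary_sq : 'i * 'i = -1 :> C.
Proof. by rewrite -expr2 sqrCi. Qed.

Lemma gram_ceigen_dual :
  ceigen 'i *m gram *m (kap^-1 *: ceigen (- 'i))^T = 1%:M.
Proof.
rewrite linearZ /= -scalemxAr gram_ceigen mulrN imaginary_sq opprK scale_scalar_mx; congr (_%:M).
rewrite /kap; field; exact: ellC_neq0.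
Qed.

Variables e eb : 'M[C]_(2, 4 + 4).
Hypothesis e_eb : dual_frame t e eb.

Lemma gram_dual_frame : e *m gram *m eb^T = 1%:M.
Proof.
have [_ _ _ _ dual] := e_eb; apply/matrixP => j k.
by rewrite pairingC_rows dual mxE.
Qed.

Lemma ceigen_sub_e : (ceigen 'i <= e)%MS.
Proof.
have [_ _ /eqmxP ee _ _] := e_eb; rewrite ee genmxE.
exact: ceigen_sub imaginary_sq.
Qed.

Lemma ceigen_sub_eb : (ceigen (- 'i) <= eb)%MS.
Proof.
have [_ _ _ /eqmxP ee _] := e_eb; rewrite ee genmxE.
by apply: ceigen_sub; rewrite mulrNN imaginary_sq.
Qed.

Lemma dual_frame_sum (W : lmodType C) (B : 'rV[C]_(4 + 4) -> 'rV[C]_(4 + 4) -> W) :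
  bilin B -> \sum_j B (row j eb) (row j e) =
  kap^-1 *: (B ub ub + B (uC p) (uC p) + B (uC q) (uC q) + B (uC r) (uC r)
    + 'i *: (B (uC p) ub - B ub (uC p) + B (uC r) (uC q) - B (uC q) (uC r))).
Proof.
move=> Bbil; exact: (dual_pair_sum Bbil imaginary_sq ceigen_sub_e ceigen_sub_eb gram_dual_frame
  gram_ceigen_dual (row_ceigen0 _) (row_ceigen1 _) (row_ceigen0 _) (row_ceigen1 _)).
Qed.

Lemma dual_frame_sumC (W : lmodType C) (B : 'rV[C]_(4 + 4) -> 'rV[C]_(4 + 4) -> W) :
  bilin B -> \sum_j B (row j e) (row j eb) =
  kap^-1 *: (B ub ub + B (uC p) (uC p) + B (uC q) (uC q) + B (uC r) (uC r)
    - 'i *: (B (uC p) ub - B ub (uC p) + B (uC r) (uC q) - B (uC q) (uC r))).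
Proof.
move=> Bbil; have Bt : bilin (fun u v => B v u) by split=> [v|v]; [apply: Bbil.2|apply: Bbil.1].
rewrite (dual_frame_sum Bt) -scalerN; congr (_ *: (_ + _ *: _)).
by rewrite !opprD !opprK addrAC [- _ + _]addrC -!addrA; congr (_ + (_ + _)); rewrite addrC.
Qed.

End Eigenspaces.

(** * The generators in terms of a frame *)

Section Generators.
Variables (F : numFieldType) (V : susyVA F) (U : lmodType F).
Variables (Pi : U -> V) (lie : U -> U -> U) (form : U -> U -> F).
Hypotheses (Pi_lin : linear Pi) (Pi_odd : forall u, par true (Pi u)) (lie_bil : bilin lie).
Hypothesis br_Pi : forall u v, affine (Pi u) (Pi v) (Pi (lie u v)) (form u v).
Local Notation S := (Sop V).

Lemma Pi0 : Pi 0 = 0.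
Proof. by have := Pi_lin (-1) 0 0; rewrite scaler0 addr0 scaleN1r addNr. Qed.
Lemma PiZ a u : Pi (a *: u) = a *: Pi u.
Proof. by have := Pi_lin a u 0; rewrite Pi0 !addr0. Qed.
Lemma PiN u : Pi (- u) = - Pi u.
Proof. by rewrite -!scaleN1r PiZ. Qed.

Variable kap : F.
Hypothesis kap_neq0 : kap != 0.

(** The structure constants behind [frame_brackets]. *)
Definition lie_frame_brackets b p q r : Prop :=
  [/\ lie p p = 0, lie p q = - r & lie q p = r] /\
  [/\ lie b p = 0, lie p b = 0, form b p = 0 & form p b = 0] /\
  [/\ form p p = kap, form p q = 0 & form q p = 0].

Definition lie_frame b p q r : Prop :=
  [/\ lie b b = 0, form b b = kap, lie_frame_brackets b p q r, lie_frame_brackets b q r p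
    & lie_frame_brackets b r p q].

Lemma lie_frame_brackets_frame b p q r : lie_frame_brackets b p q r ->
  frame_brackets kap (Pi b) (Pi p) (Pi q) (Pi r).
Proof.
case=> -[pp pq qp] [[bp pb fbp fpb] [fpp fpq fqp]]; split=> //.
- by have := br_Pi p p; rewrite pp fpp Pi0.
- by have := br_Pi b p; rewrite bp fbp Pi0.
- by have := br_Pi p b; rewrite pb fpb Pi0.
split; first by have := br_Pi p q; rewrite pq fpq PiN.
by have := br_Pi q p; rewrite qp fqp.
Qed.

Lemma lie_frame_frame b p q r : lie_frame b p q r ->
  frame kap (Pi b) (Pi p) (Pi q) (Pi r).
Proof.
case=> bb fbb P Q T; split=> //; try exact: lie_frame_brackets_frame.
by have := br_Pi b b; rewrite bb fbb Pi0.
Qed.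

Variables (b p q r : U).
Hypothesis bpqr : lie_frame b p q r.
Variables (m : nat) (e eb : 'I_m -> U) (i : F).
Hypothesis ii : i * i = -1.
(** Contractions with the metric and with the Kaehler form. *)
Definition symsum (W : lmodType F) (B : U -> U -> W) := B b b + B p p + B q q + B r r.
Definition altsum (W : lmodType F) (B : U -> U -> W) := B p b - B b p + B r q - B q r.
Hypothesis dual_sum : forall (W : lmodType F) (B : U -> U -> W), bilin B ->
  \sum_j B (eb j) (e j) = kap^-1 *: (symsum B + i *: altsum B).
Hypothesis dual_sumC : forall (W : lmodType F) (B : U -> U -> W), bilin B ->
  \sum_j B (e j) (eb j) = kap^-1 *: (symsum B - i *: altsum B).

Let fr := lie_frame_frame bpqr.

(** The metric does not contribute, the square of an odd vector being 0. *)
Lemma J0_frame :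
  (i / 2%:R) *: \sum_j nop (Pi (eb j)) (Pi (e j)) = quadJ kap (Pi b) (Pi p) (Pi q) (Pi r).
Proof.
have Bbil : bilin (fun u v => nop (Pi u) (Pi v)).
  by split=> [v|u] a w w'; rewrite Pi_lin ?nop_linl ?nop_linr.
have [b_odd bb [p_odd pp bp pb _] [q_odd qq _ _ [qr rq]] [r_odd rr _ _ _]] := fr.
rewrite (dual_sum Bbil) /symsum /altsum /quadJ !(nop_square _ bb, nop_square _ pp, nop_square _ qq, nop_square _ rr) //.
rewrite (nop_anticomm p_odd b_odd pb) (nop_anticomm r_odd q_odd rq) scalerA scalerDr !scalerA.
have E : i / 2%:R * kap^-1 * i = - (2%:R * kap)^-1.
  by rewrite mulrAC -(mulrAC i i) ii; field.
by rewrite E; lmod F V; field.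
Qed.

(** Up to sign the four terms are the product of two tensors
    [\sum_j (e^j (x) e_j - e_j (x) e^j) = 2 i kap^-1 altsum], one in the variables
    [x], [x'] and one in [y], [y']. *)
Lemma dual_sum2 (W : lmodType F) (Q : U -> U -> U -> U -> W) :
  (forall y y', bilin (fun x x' => Q x y x' y')) ->
  (forall x x', bilin (fun y y' => Q x y x' y')) ->
  \sum_j \sum_l (Q (e j) (eb l) (eb j) (e l) + Q (eb j) (e l) (e j) (eb l)
    - Q (e j) (e l) (eb j) (eb l) - Q (eb j) (eb l) (e j) (e l))
  = (4%:R * kap ^- 2) *: altsum (fun x x' => altsum (fun y y' => Q x y x' y')).
Proof.
move=> Q1 Q2; 
pose D x x' := altsum (fun y y' => Q x y x' y').
pose A x x' := (2%:R * i * kap^-1) *: D x x'.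
have AE x x' : \sum_l (Q x (eb l) x' (e l) - Q x (e l) x' (eb l)) = A x x'.
  rewrite sumrB (dual_sum (Q2 x x')) (dual_sumC (Q2 x x')) /A /D.
  by move: (symsum _) (altsum _) => s a; lmod F W; ring.
have QL a u u' y x' y' : Q (a *: u + u') y x' y' = a *: Q u y x' y' + Q u' y x' y'.
  exact: (Q1 y y').1.
have QR a u u' x y y' : Q x y (a *: u + u') y' = a *: Q x y u y' + Q x y u' y'.
  exact: (Q1 y y').2.
have Abil : bilin A.
  by split=> [x'|x] a u u'; rewrite /A /D /altsum ?QL ?QR; lmod F W; ring.
rewrite (eq_bigr (fun j => A (e j) (eb j) - A (eb j) (e j))) => [|j _]; last first.
  by rewrite -!AE -sumrB; apply: eq_bigr => l _; lmod F W; ring.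
rewrite sumrB (dual_sum Abil) (dual_sumC Abil).
have -> : altsum A = (2%:R * i * kap^-1) *: altsum D.
  by rewrite /altsum /A; lmod F W; ring.
rewrite -/D; move: (symsum A) (altsum D) => s a; transitivity (- (4%:R * kap ^- 2 * (i * i)) *: a).
  by lmod F W; field.
by rewrite ii mulrN1 opprK.
Qed.

Lemma nop_sandwich x y : par true x -> par true y ->
  affine x x 0 kap -> affine x y 0 0 -> affine y x 0 0 -> nop x (nop y x) = 0 :> V.
Proof.
move=> x_odd y_odd xx xy yx; rewrite (nop_anticomm y_odd x_odd yx) nopNr.
have := nop_affine_assoc x_odd x_odd xy xy.
by rewrite (nop_square x_odd xx) nop0l !scale0r subr0 addr0 => <-; rewrite oppr0.
Qed.

(** The metric gives the terms [:a S a:].  In the double contraction with the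
    Kaehler form the terms with [b] vanish: [b] is central, or a square or a product as in
    [nop_sandwich] occurs.  The two remaining terms are both [- :p :q r::]. *)
Lemma H'_frame w : w = - ((2%:R / kap) *: b) ->
  2%:R^-1 *: \sum_j (nop (Pi (e j)) (S (Pi (eb j))) + nop (Pi (eb j)) (S (Pi (e j))))
  + (2%:R ^+ 2)^-1 *: \sum_j \sum_l
      (nop (Pi (e j)) (nop (Pi (eb l)) (Pi (lie (eb j) (e l))))
       + nop (Pi (eb j)) (nop (Pi (e l)) (Pi (lie (e j) (eb l))))
       - nop (Pi (e j)) (nop (Pi (e l)) (Pi (lie (eb j) (eb l))))
       - nop (Pi (eb j)) (nop (Pi (eb l)) (Pi (lie (e j) (e l)))))
  + 2%:R^-1 *: S (S (Pi w)) = cubicH kap (Pi b) (Pi p) (Pi q) (Pi r).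
Proof.
move=> ->.
have Bbil : bilin (fun u v => nop (Pi u) (S (Pi v))).
  by split=> [v|u] a u1 u2; rewrite Pi_lin ?nop_linl // SopD SopZ nop_linr.
pose Q x y x' y' := nop (Pi x) (nop (Pi y) (Pi (lie x' y'))).
have Q1 y y' : bilin (fun x x' => Q x y x' y').
  split=> [x'|x] a u u'; rewrite /Q ?Pi_lin ?nop_linl //.
  by rewrite (lie_bil.1 _ a) Pi_lin !nop_linr.
have Q2 x x' : bilin (fun y y' => Q x y x' y').
  split=> [y'|y] a u u'; rewrite /Q ?Pi_lin ?nop_linl ?nop_linr //.
  by rewrite (lie_bil.2 _ a) Pi_lin !nop_linr.
rewrite (dual_sum2 Q1 Q2) big_split /= (dual_sumC Bbil) (dual_sum Bbil).
have [b_odd bb [p_odd pp bp pb [pq qp]] [q_odd qq bq qb [qr rq]] [r_odd rr b_r rb [rp pr]]] := fr.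
have -> : altsum (fun x x' => altsum (fun y y' => Q x y x' y')) =
    - (nop (Pi p) (nop (Pi q) (Pi r)) *+ 2).
  case: bpqr => lbb _ [[lpp lpq lqp] [[lbp lpb _ _] _]]
    [[lqq lqr lrq] [[lbq lqb _ _] _]] [[lrr lrp lpr] [[lbr lrb _ _] _]].
  rewrite /altsum /Q ?lbb ?lpp ?lqq ?lrr ?lbp ?lpb ?lbq ?lqb ?lbr ?lrb ?lpq ?lqp ?lqr ?lrq ?lrp ?lpr.
  rewrite !PiN !Pi0 !nopNr !nop0r (nop_square r_odd rr) (nop_square q_odd qq) !nop0r.
  rewrite (nop_sandwich r_odd b_odd) // (nop_sandwich q_odd b_odd) //.
  rewrite (nop_anticomm q_odd p_odd qp) nopNr (nop_cycle (frame_rot fr)) (nop_cycle fr).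
  by lmod F V; ring.
rewrite /symsum /cubicH PiN PiZ !SopE.
move: (altsum _) => a.
by lmod F V; field.
Qed.

(** The operator [P], projection to [l] minus projection to its conjugate, is [- i]
    times the complex structure and sends [p] to [i b]; the Kaehler form contracted
    with the Lie bracket is [2 p]. *)
Lemma w_frame (P : U -> U) : linear P ->
  P (b - i *: p) = b - i *: p -> P (b + i *: p) = - (b + i *: p) ->
  \sum_j P (lie (eb j) (e j)) = - ((2%:R / kap) *: b).
Proof.
move=> P_lin Pl Plb; have P0 : P 0 = 0.
  by have := P_lin (-1) 0 0; rewrite scaler0 addr0 scaleN1r addNr.
have PZ a u : P (a *: u) = a *: P u by have := P_lin a u 0; rewrite P0 !addr0.
have PN u : P (- u) = - P u by rewrite -!scaleN1r PZ.
have PD u v : P (u + v) = P u + P v by have := P_lin 1 u v; rewrite !scale1r.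
have Bbil : bilin (fun u v => P (lie u v)).
  by split=> [v|u] a w w'; rewrite ?(lie_bil.1 _ a) ?(lie_bil.2 _ a) P_lin.
have iPp : i *: P p = - b.
  move: Pl Plb; rewrite !PD PN PZ => Pl Plb.
  transitivity (2%:R^-1 *: ((P b + i *: P p) - (P b - i *: P p))).
    by lmod F U; field.
  by rewrite Pl Plb; lmod F U; field.
case: bpqr => lbb _ [[lpp lpq lqp] [[lbp lpb _ _] _]]
  [[lqq lqr lrq] [[lbq lqb _ _] _]] [[lrr lrp lpr] [[lbr lrb _ _] _]].
rewrite (dual_sum Bbil) /symsum /altsum lbb lpp lqq lrr lpb lbp lrq lqr PN !P0.
transitivity ((2%:R / kap) *: (i *: P p)); first by lmod F U; field.
by rewrite iPp scalerN.
Qed.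

End Generators.

(** * Projections onto the eigenspaces *)

Section Projections.
Variables (F : fieldType) (n m : nat) (Gm : 'M[F]_n) (A B : 'M[F]_(m, n)) (L Lb O : 'M[F]_n).
Hypotheses (LA : (L :=: A)%MS) (LbB : (Lb :=: B)%MS).
Hypotheses (AB : A *m Gm *m B^T = 1%:M) (BB : B *m Gm *m B^T = 0) (OB : O *m Gm *m B^T = 0).

(** Pairing with [B] recovers the coordinates of a vector of [A], and kills both [B]
    and [O]. *)
Lemma capmx_dual : (L :&: (Lb + O) = 0)%MS.
Proof.
apply/eqP; rewrite -submx0; apply/rV_subP => v; rewrite sub_capmx LA.
case/andP=> /submxP[c ->] /sub_addsmxP[[u1 u2] /= cE].
have c0 : c = 0.
  rewrite -[c]mulmx1 -AB !mulmxA cE mulmxDl mulmxDl.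
  rewrite -!mulmxA (mulmxA O) OB mulmx0 addr0 !mulmxA.
  have /submxP[D ->] : (u1 *m Lb <= B)%MS by rewrite -LbB submxMl.
  by rewrite -!mulmxA (mulmxA B) BB mulmx0.
by rewrite c0 mul0mx sub0mx.
Qed.

Lemma proj_dual_id (v : 'rV[F]_n) : (v <= A)%MS -> v *m proj_mx L (Lb + O)%MS = v.
Proof. by move=> vA; rewrite proj_mx_id ?capmx_dual ?LA. Qed.

Lemma proj_dual_0 (v : 'rV[F]_n) : (v <= B)%MS -> v *m proj_mx L (Lb + O)%MS = 0.
Proof.
move=> vB; rewrite proj_mx_0 ?capmx_dual //.
by apply: submx_trans vB _; rewrite -LbB addsmxSl.
Qed.

End Projections.

Lemma mulmx_sub_linear (F : fieldType) n (A B : 'M[F]_n) :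
  linear (fun v : 'rV[F]_n => v *m A - v *m B).
Proof. by move=> a u v; rewrite !mulmxDl -!scalemxAl scalerBr opprD addrACA. Qed.

(** By duality the matrix expressing [C] in [B] is invertible, so that isotropy
    passes from [C] back to [B]. *)
Lemma gram_eq0_sub (F : fieldType) n m (Gm : 'M[F]_n) (A B C D : 'M[F]_(m, n)) :
  (C <= B)%MS -> (D <= A)%MS -> A *m Gm *m B^T = 1%:M -> D *m Gm *m C^T = 1%:M ->
  C *m Gm *m C^T = 0 -> B *m Gm *m B^T = 0.
Proof.
case/submxP=> G -> /submxP[G' ->] AB.
rewrite trmx_mul !mulmxA -(mulmxA G') -(mulmxA G') AB mulmx1 => G'G.
have GG' : G^T *m G' = 1%:M by apply: mulmx1C.
have GG'T : G'^T *m G = 1%:M by rewrite -[G'^T *m G]trmxK trmx_mul trmxK GG' trmx1.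
move=> CC; have := congr1 (fun M => G'^T *m M *m G') CC.
rewrite mulmx0 mul0mx !mulmxA GG'T mul1mx.
by rewrite -[_ *m B^T *m G^T *m G']mulmxA GG' mulmx1.
Qed.

Section EigenProjections.
Variable R : realType.
Local Notation C := (R[i]).
Local Notation toC := (map_mx (real_complex R)).
Local Notation gram := (gram R).
Variables (ell x : R).
Hypotheses (ell_gt0 : 0 < ell) (x_gt0 : 0 < x).
Local Notation uC := (uC ell x).
Local Notation ub := (ub ell x).
Local Notation kap := (kapC ell).
Variables (p q r : 'I_4) (dv : 'rV[R]_(4 + 4) -> R).
Hypothesis pqr : cyc p q r.
Local Notation t := (Triple (Vplus ell x) dv (cstruct x p q r)).
Variables e eb : 'M[C]_(2, 4 + 4).
Hypothesis e_eb : dual_frame t e eb.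

Lemma gram_tr : gram^T = gram.
Proof.
apply/matrixP => i j; rewrite !mxE; congr (_%:C%C).
by rewrite /pairing addrC.
Qed.

Lemma orthoC_gram m (B : 'M[C]_(m, 4 + 4)) : (B <= toC (Vplus ell x))%MS ->
  orthoC (tV t) *m gram *m B^T = 0.
Proof.
case/submxP=> D ->; rewrite trmx_mul !mulmxA.
suff -> : orthoC (tV t) *m gram *m (toC (Vplus ell x))^T = 0 by rewrite mul0mx.
rewrite -mulmxA /orthoC; set K := \matrix_(_, _) _.
suff -> : gram *m (toC (Vplus ell x))^T = K by rewrite mulmx_ker.
apply/matrixP => i j; rewrite [RHS]mxE pairingC_gram.
rewrite -rowE -row_mul tr_row.
by rewrite !mxE; apply: eq_bigr => k _; rewrite !mxE.
Qed.

Lemma eigenC_sub s : (eigenC t s <= toC (Vplus ell x))%MS.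
Proof. exact: submxMl. Qed.

Let el : (l_of t :=: e)%MS.
Proof. by apply: eqmx_sym; have [_ _ /eqmxP ee _ _] := e_eb. Qed.
Let ebl : (lbar_of t :=: eb)%MS.
Proof. by apply: eqmx_sym; have [_ _ _ /eqmxP ee _] := e_eb. Qed.

Let gram_eb_e : eb *m gram *m e^T = 1%:M.
Proof.
have := congr1 trmx (gram_dual_frame e_eb).
by rewrite !trmx_mul trmxK gram_tr trmx1 mulmxA.
Qed.

Let ceigen_iso (s : C) : s * s = -1 -> ceigen ell x p q r s *m gram *m (ceigen ell x p q r s)^T = 0.
Proof. by move=> ss; rewrite gram_ceigen // ss subrr mulr0 raddf0. Qed.

Let iso_eb : eb *m gram *m eb^T = 0.
Proof.
have kC := kapC_neq0 ell_gt0.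
apply: (gram_eq0_sub (C := kap^-1 *: ceigen ell x p q r (- 'i)) (D := ceigen ell x p q r 'i)) (gram_dual_frame e_eb) _ _.
- by apply: submx_trans (ceigen_sub_eb x_gt0 pqr e_eb); apply: scalemx_sub.
- exact: (ceigen_sub_e x_gt0 pqr e_eb).
- exact: gram_ceigen_dual.
rewrite linearZ /= -scalemxAr -scalemxAl -scalemxAl ceigen_iso ?scaler0 //.
by rewrite mulrNN imaginary_sq.
Qed.

Let iso_e : e *m gram *m e^T = 0.
Proof.
apply: (gram_eq0_sub (C := ceigen ell x p q r 'i) (D := kap^-1 *: ceigen ell x p q r (- 'i))) gram_eb_e _ _.
- exact: (ceigen_sub_e x_gt0 pqr e_eb).
- by apply: submx_trans (ceigen_sub_eb x_gt0 pqr e_eb); apply: scalemx_sub.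
- have := congr1 trmx (gram_ceigen_dual ell_gt0 x_gt0 pqr).
  by rewrite !trmx_mul trmxK gram_tr trmx1 mulmxA.
exact: ceigen_iso (imaginary_sq R).
Qed.

Let e_sub : (e <= toC (Vplus ell x))%MS.
Proof. by have [_ _ /eqmxP ee _ _] := e_eb; rewrite ee genmxE eigenC_sub. Qed.
Let eb_sub : (eb <= toC (Vplus ell x))%MS.
Proof. by have [_ _ _ /eqmxP ee _] := e_eb; rewrite ee genmxE eigenC_sub. Qed.

Lemma pr_l_sub_pr_lbar_e (v : 'rV[C]_(4 + 4)) : (v <= e)%MS -> pr_l t v - pr_lbar t v = v.
Proof.
move=> ve; have El : pr_l t v = v.
  exact: (proj_dual_id el ebl (gram_dual_frame e_eb) iso_eb (orthoC_gram eb_sub) ve).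
have Elb : pr_lbar t v = 0.
  exact: (proj_dual_0 ebl el gram_eb_e iso_e (orthoC_gram e_sub) ve).
by rewrite -> El, Elb; exact: subr0.
Qed.

Lemma pr_l_sub_pr_lbar_eb (v : 'rV[C]_(4 + 4)) : (v <= eb)%MS -> pr_l t v - pr_lbar t v = - v.
Proof.
move=> ve; have El : pr_l t v = 0.
  exact: (proj_dual_0 el ebl (gram_dual_frame e_eb) iso_eb (orthoC_gram eb_sub) ve).
have Elb : pr_lbar t v = v.
  exact: (proj_dual_id ebl el gram_eb_e iso_e (orthoC_gram e_sub) ve).
by rewrite -> El, Elb; exact: sub0r.
Qed.

Lemma pr_l_sub_pr_lbar_linear : linear (fun v => pr_l t v - pr_lbar t v).
Proof. exact: mulmx_sub_linear. Qed.

End EigenProjections.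

(** * The superaffine vertex algebra of g_ell *)

Section SuperAffine.
Variable R : realType.
Local Notation C := (R[i]).
Variables (ell x : R).
Hypotheses (ell_gt0 : 0 < ell) (x_gt0 : 0 < x).
Local Notation lie := (lieC (lie_g ell)).
Local Notation uC := (uC ell x).
Local Notation ub := (ub ell x).
Local Notation kap := (kapC ell).
Let form (u v : 'rV[C]_(4 + 4)) : C := 2%:R * pairingC u v.

Lemma lie_frame_uC p q r : cyc p q r -> lie_frame lie form kap ub (uC p) (uC q) (uC r).
Proof.
have lb := lieC_bilin (lie_g ell); have fb := pairingC_bilin R.
have lie_ub u : lie (uC 3) u = 0 -> lie ub u = 0.
  by move=> E; rewrite /ub (bilinZl lb) E scaler0.
have lie_ubr u : lie u (uC 3) = 0 -> lie u ub = 0.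
  by move=> E; rewrite /ub (bilinZr lb) E scaler0.
have brackets i j k : cyc i j k -> lie_frame_brackets lie form kap ub (uC i) (uC j) (uC k).
  move=> ijk; have [lii lij lji] := lie_cyc ell x ijk.
  have [pii pij pji p3i pi3] := pairing_cyc ell x ijk.
  split; first by split.
  split; split.
  - by rewrite lie_ub // lie_uC3l.
  - by rewrite lie_ubr // lie_uC3r.
  - by rewrite /form pairing_ub_u // mulr0.
  - by rewrite /form pairing_u_ub // mulr0.
  - by rewrite /form pii.
  - by rewrite /form pij mulr0.
  - by rewrite /form pji mulr0.
move=> pqr; have qrp := cyc_rot pqr; split.
- by rewrite lie_ub // lie_ubr // lie_uC3l.
- by rewrite /form pairing_ub.
- exact: brackets.
- exact: brackets.
- exact: brackets (cyc_rot qrp).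
Qed.

Variables (A : susyLCA C) (oneA : A) (jA : 'rV[C]_(4 + 4) -> A).
Hypothesis A_affine : superaffine_LCA lie (@pairingC R) 2%:R oneA jA.
Variables (V : susyVA C) (iotaV : A -> V).
Hypotheses (iota_hom : lca_hom iotaV) (iota_one : iotaV oneA = vac V).
Let Pi a := iotaV (jA a).

Lemma Pi_linear : linear Pi.
Proof.
have [j_lin _ _ _] := A_affine; have [i_lin _ _ _] := iota_hom.
by move=> a u v; rewrite /Pi j_lin i_lin.
Qed.

Lemma Pi_odd u : par true (Pi u).
Proof.
have [_ j_odd _ _] := A_affine; have [_ i_par _ _] := iota_hom.
exact: i_par (j_odd u).
Qed.

Lemma br_Pi u v : affine (Pi u) (Pi v) (Pi (lie u v)) (form u v).
Proof.
have [_ _ j_br _] := A_affine; have [i_lin _ _ i_br] := iota_hom.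
have i0 : iotaV 0 = 0 by have := i_lin (-1) 0 0; rewrite scaler0 addr0 scaleN1r addNr.
have iZ a w : iotaV (a *: w) = a *: iotaV w.
  by have := i_lin a w 0; rewrite i0 !addr0.
have j_br4 : br (jA u) (jA v) = pol4 (jA (lie u v)) (form u v *: oneA) 0 0.
  rewrite j_br; apply/malgP => -[n e]; rewrite mcoeff_pol4.
  rewrite -> mcoeffD; rewrite mcoeff_chi !mcoeff_cstL.
  by case: e; case: n => [|[|n]]; rewrite ?mcoeff_cstL ?xpair_eqE /= ?mulr0n ?mulr1n ?oppr0 ?addr0 ?add0r.
apply/malgP => m; rewrite i_br j_br4 !mcoeff_pol4.
by case: m => [[|[|n]] []]; rewrite ?i0 // iZ iota_one.
Qed.

Variables (p q r : 'I_4) (dv : 'rV[R]_(4 + 4) -> R).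
Hypothesis pqr : cyc p q r.
Local Notation t := (Triple (Vplus ell x) dv (cstruct x p q r)).
Variables e eb : 'M[C]_(2, 4 + 4).
Hypothesis e_eb : dual_frame t e eb.

Let fr := lie_frame_uC pqr.
Let sum1 := dual_frame_sum ell_gt0 x_gt0 pqr e_eb.
Let sum2 := dual_frame_sumC ell_gt0 x_gt0 pqr e_eb.

Lemma J0_vecE :
  J0_vec 2%:R Pi e eb = quadJ kap (Pi ub) (Pi (uC p)) (Pi (uC q)) (Pi (uC r)).
Proof.
exact: (J0_frame Pi_linear Pi_odd br_Pi (kapC_neq0 ell_gt0) fr (imaginary_sq R) sum1).
Qed.

Lemma w_vecE : w_vec ell t e eb = - ((2%:R / kap) *: ub).
Proof.
have Pl : pr_l t (ub - 'i *: uC p) - pr_lbar t (ub - 'i *: uC p) = ub - 'i *: uC p.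
  apply: (pr_l_sub_pr_lbar_e ell_gt0 x_gt0 pqr e_eb).
  apply: submx_trans (ceigen_sub_e x_gt0 pqr e_eb).
  by rewrite -(row_ceigen0 ell x p q r); apply: row_sub.
have Plb : pr_l t (ub + 'i *: uC p) - pr_lbar t (ub + 'i *: uC p) = - (ub + 'i *: uC p).
  apply: (pr_l_sub_pr_lbar_eb ell_gt0 x_gt0 pqr e_eb).
  apply: submx_trans (ceigen_sub_eb x_gt0 pqr e_eb).
  have -> : ub + 'i *: uC p = ub - (- 'i) *: uC p by rewrite scaleNr opprK.
  by rewrite -(row_ceigen0 ell x p q r); apply: row_sub.
exact: (w_frame (lieC_bilin _) (kapC_neq0 ell_gt0) fr sum1
  (pr_l_sub_pr_lbar_linear ell x p q r dv) Pl Plb).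
Qed.

Lemma H'_vecE :
  H'_vec ell 2%:R Pi t e eb = cubicH kap (Pi ub) (Pi (uC p)) (Pi (uC q)) (Pi (uC r)).
Proof.
exact: (H'_frame Pi_linear Pi_odd (lieC_bilin _) br_Pi (kapC_neq0 ell_gt0) fr (imaginary_sq R)
  sum1 sum2 w_vecE).
Qed.

End SuperAffine.

Lemma pol4_S_2chi (F : numFieldType) (L : susyLCA F) (u : L) :
  pol4 (- Sop L u) (- (u *+ 2)) 0 0 = - (chi (cstL u) *+ 2 + Sact (Sop L) (cstL u)).
Proof.
apply/malgP => -[n e]; rewrite mcoeff_pol4 Sact_cstL.
rewrite -> mcoeffN, mcoeffD, mcoeffMn; rewrite mcoeff_chi !mcoeff_cstL.
by case: e; case: n => [|[|n]];
  rewrite ?mcoeff_cstL ?xpair_eqE /= ?andbF ?mulr0n ?mulr1n ?oppr0 ?mul0rn ?addr0 ?add0r ?oppr0.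
Qed.

Theorem proposition5p2 (R : realType) (ell x : R)
    (ell_gt0 : 0 < ell) (x_gt0 : 0 < x)
    (* V is the universal superaffine vertex algebra of g_ell of level 2 *)
    (A : susyLCA R[i]) (oneA : A) (jA : 'rV[R[i]]_(4 + 4) -> A)
    (A_superaffine :
       superaffine_LCA (lieC (lie_g ell)) (@pairingC R) 2%:R oneA jA)
    (V : susyVA R[i]) (iotaV : A -> V)
    (V_univ : universal_enveloping oneA iotaV)
    (* N is the N=4 superconformal vertex algebra of central charge 6 *)
    (B : susyLCA R[i]) (oneB H : B) (J : 'I_3 -> B)
    (B_N4 : N4_LCA 6%:R oneB H J)
    (N : susyVA R[i]) (iotaN : B -> N)
    (N_univ : universal_enveloping oneB iotaN)
    (eI ebI eJ ebJ eK ebK : 'M[R[i]]_(2, 4 + 4)) :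
  let trI := Triple (Vplus ell x) (div_plus ell x) (I_x x) in
  let trJ := Triple (Vplus ell x) (div_plus ell x) (J_x x) in
  let trK := Triple (Vplus ell x) (div_plus ell x) (K_x x) in
  dual_frame trI eI ebI -> dual_frame trJ eJ ebJ -> dual_frame trK eK ebK ->
  let Pi a := iotaV (jA a) in
  let J0I := J0_vec 2%:R Pi eI ebI in
  let J0J := J0_vec 2%:R Pi eJ ebJ in
  let J0K := J0_vec 2%:R Pi eK ebK in
  let HI := H'_vec ell 2%:R Pi trI eI ebI in
  let HJ := H'_vec ell 2%:R Pi trJ eJ ebJ in
  let HK := H'_vec ell 2%:R Pi trK eK ebK in
  let rhs (u : V) := - (chi (cstL u) *+ 2 + Sact (Sop V) (cstL u)) in
  [/\ HI = HJ /\ HJ = HK,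
      br J0I J0J = rhs J0K,
      br J0J J0K = rhs J0I,
      br J0K J0I = rhs J0J
    & exists phi : N -> V,
        [/\ va_hom phi,
            phi (iotaN H) = HI,
            [/\ phi (iotaN (J 0)) = J0I,
                phi (iotaN (J 1)) = J0J
              & phi (iotaN (J 2)) = J0K]
          & injective (fun r : B => phi (iotaN r))]].
Proof.
move=> trI trJ trK dI dJ dK Pi J0I J0J J0K HI HJ HK rhs.
have [iota_hom iota_one _] := V_univ.
have c012 : cyc 0 1 2 by apply: Or31.
have c120 := cyc_rot c012; have c201 := cyc_rot c120.
pose kap : R[i] := kapC ell.
have kap0 : kap != 0 := kapC_neq0 ell_gt0.
pose b := Pi (ub ell x); pose a j := Pi (uC ell x j).
have JIE : J0I = quadJ kap b (a 0) (a 1) (a 2).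
  exact: (J0_vecE ell_gt0 x_gt0 A_superaffine iota_hom iota_one c012 dI).
have JJE : J0J = quadJ kap b (a 1) (a 2) (a 0).
  exact: (J0_vecE ell_gt0 x_gt0 A_superaffine iota_hom iota_one c120 dJ).
have JKE : J0K = quadJ kap b (a 2) (a 0) (a 1).
  exact: (J0_vecE ell_gt0 x_gt0 A_superaffine iota_hom iota_one c201 dK).
have HIE : HI = cubicH kap b (a 0) (a 1) (a 2).
  exact: (H'_vecE ell_gt0 x_gt0 A_superaffine iota_hom iota_one c012 dI).
have HJE : HJ = cubicH kap b (a 1) (a 2) (a 0).
  exact: (H'_vecE ell_gt0 x_gt0 A_superaffine iota_hom iota_one c120 dJ).
have HKE : HK = cubicH kap b (a 2) (a 0) (a 1).
  exact: (H'_vecE ell_gt0 x_gt0 A_superaffine iota_hom iota_one c201 dK).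
have fr : frame kap b (a 0) (a 1) (a 2).
  exact: (lie_frame_frame (Pi_linear A_superaffine iota_hom) (Pi_odd A_superaffine iota_hom)
    (br_Pi A_superaffine iota_hom iota_one) (lie_frame_uC ell x_gt0 c012)).
have fr' := frame_rot fr; have fr'' := frame_rot fr'.
pose JV (j : 'I_3) : V := if j == 0 then J0I else if j == 1 then J0J else J0K.
have JJ : JJ_brackets 2%:R (vac V) HI JV.
  by rewrite HIE; apply: frame_JJ_brackets.
have JV_even j : par false (JV j).
  rewrite /JV JIE JJE JKE; case: ifP => _; last case: ifP => _; exact: quadJ_even.
have two0 : 2%:R != 0 :> R[i] by rewrite pnatr_eq0.
have B6 : N4_LCA (2%:R * 3%:R) oneB H J by rewrite -natrM.
have HI_odd : par true HI.
  by rewrite HIE; apply: cubicH_odd.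
have [f [f_hom f1 fH fJ f_inj]] := N4_embedding two0 B6 (vac_even V) (S_vac V)
  (vac_neq0 V) HI_odd JV_even JJ.
have [_ _ N_ext] := N_univ; have [phi [phi_hom phi_f _]] := N_ext V f f_hom f1.
have br_next p q r (pqr : frame kap b p q r) : br (quadJ kap b p q r) (quadJ kap b q r p)
    = rhs (quadJ kap b r p q).
  by rewrite /rhs -pol4_S_2chi; apply: br_quadJ_next.
split.
- by rewrite HIE HJE HKE (cubicH_rot fr') (cubicH_rot fr).
- by rewrite JIE JJE JKE; apply: br_next.
- by rewrite JIE JJE JKE; apply: br_next.
- by rewrite JIE JJE JKE; apply: br_next.
exists phi; split=> //.
- by rewrite phi_f.
- by split; rewrite phi_f fJ.
- by move=> r s; rewrite !phi_f => /f_inj.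
Qed.
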